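(* Given a set $S$ of $n>2$ points in the plane, let $P^*,Q^*$ be two curves that partition $S$ with $d_{dF}(P^*,Q^* )=\varepsilon^*$ such that $\max\{\ell(P^* ),\ell(Q^* )\}$ is minimized. Then one can find in $O(n\log n)$ time two curves $P,Q$ that partition $S$ such that $d_{dF}(P,Q)=\varepsilon^*$ and $\ell(P)+\ell(Q)=O(\ell(P^* )+\ell(Q^* ))$; likewise, one can find in $O(n\log n)$ time two curves $P,Q$ that partition $S$ such that $d_{dF}(P,Q)=\varepsilon^*$ and $\max\{\ell(P),\ell(Q)\}=O(\max\{\ell(P^* ),\ell(Q^* )\})$. (The constants hidden in the $O$-notation are absolute.)
   Context: A (polygonal) curve is given by its finite non-empty sequence of vertices; $\ell(P)$ denotes the sum of the lengths of the edges (segments between consecutive vertices) of $P$. Two curves $P,Q$ partition a finite point set $S$ if there is a partition of $S$ into two sets $A,B$ such that the vertex set of $P$ is exactly $A$, the vertex set of $Q$ is exactly $B$, and each point of $S$ is used exactly once (either in $P$ or in $Q$). A paired-walk along $P$ and $Q$ is a sequence of pairs $\pi=\{(P_i,Q_i)\}_{i=1}^k$ such that $P_1,\dots,P_k$ and $Q_1,\dots,Q_k$ partition the vertex sequences of $P$ and $Q$, respectively, in order, into disjoint non-empty contiguous subsequences, and for every $i$ either $|P_i|=1$ or $|Q_i|=1$. Its cost is $\max_i\max_{(p,q)\in P_i\times Q_i}\|p-q\|$. The discrete Fréchet distance $d_{dF}(P,Q)$ is the minimum cost of a paired-walk along $P$ and $Q$. $\varepsilon^*$ denotes the minimum of $d_{dF}(P,Q)$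 over all pairs of curves $P,Q$ that partition $S$. *)

(* Defs.v *)
From mathcomp Require Import all_boot all_order all_algebra.
From mathcomp Require Import finmap.
From mathcomp Require Import boolp classical_sets reals exp.

Set Implicit Arguments.
Unset Strict Implicit.
Unset Printing Implicit Defensive.

Import Order.TTheory GRing.Theory Num.Theory.

Local Open Scope ring_scope.

Section Curves.
Variable R : realType.

Definition plane : choiceType := (R * R)%type.

Implicit Types (p q : plane) (P Q : seq plane) (S : {fset plane}).

Definition dist p q : R := Num.sqrt ((p.1 - q.1) ^+ 2 + (p.2 - q.2) ^+ 2).

Definition curve_length P : R := \sum_(e <- zip P (behead P)) dist e.1 e.2.

(* [perm_eq P A] says that the vertices of [P] are the points of [A], each
   occurring exactly once. *)
Definition partitioned_by S P Q : Prop :=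
  [/\ P != [::], Q != [::] &
      exists A B : {fset plane},
        [/\ (A `|` B)%fset = S, [disjoint A & B]%fset,
            perm_eq P A & perm_eq Q B]].

Definition paired_walk P Q (w : seq (seq plane * seq plane)) : Prop :=
  [/\ flatten (unzip1 w) = P, flatten (unzip2 w) = Q &
      {in w, forall PQ,
        [/\ PQ.1 != [::], PQ.2 != [::] &
            (size PQ.1 == 1)%N || (size PQ.2 == 1)%N]}].

(* Distances are nonnegative, so starting the maxima at 0 is harmless. *)
Definition walk_cost (w : seq (seq plane * seq plane)) : R :=
  \big[Num.max/0]_(PQ <- w)
    \big[Num.max/0]_(p <- PQ.1) \big[Num.max/0]_(q <- PQ.2) dist p q.

Definition walk_costs P Q : set R :=
  [set walk_cost w | w in [set w | paired_walk P Q w]]%classic.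

(* An infimum of a finite set, hence a minimum: see [dfrechet_min]. *)
Definition dfrechet P Q : R := inf (walk_costs P Q).

Definition partition_dfrechets S : set R :=
  [set e | exists P Q, partitioned_by S P Q /\ e = dfrechet P Q]%classic.

(* Again a minimum: see [eps_star_min]. *)
Definition eps_star S : R := inf (partition_dfrechets S).

Definition frechet_optimal S P Q : Prop :=
  partitioned_by S P Q /\ dfrechet P Q = eps_star S.

Definition max_length P Q : R := Num.max (curve_length P) (curve_length Q).

Definition best_pair S Ps Qs : Prop :=
  frechet_optimal S Ps Qs /\
  forall P Q, frechet_optimal S P Q -> max_length Ps Qs <= max_length P Q.

Lemma inf_finite_min (A : set R) (s : seq R) :
  (A !=set0)%classic -> (forall x, A x -> x \in s) ->
  A (inf A) /\ lbound A (inf A).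
Proof.
move=> A0 As.
have [m Am mlb] : exists2 m, A m & lbound A m.
  have {As} : forall x, A x -> x \in [seq x <- s | `[< A x >]].
    by move=> x Ax; rewrite mem_filter (asboolT Ax) As.
  have : forall x, x \in [seq x <- s | `[< A x >]] -> A x.
    by move=> x; rewrite mem_filter => /andP[/asboolP].
  move: [seq x <- s | _] => {}s sA As.
  have sn : s != [::] by case: A0 => x /As; case: (s).
  have [m ms mle] : exists2 m, m \in s & {in s, forall x, m <= x}.
    elim: s sn {sA As} => // x [|y s] IH _.
      by exists x; rewrite ?mem_head // => z /[!inE] /eqP->.
    have [//|m ms mle] := IH; have [xm|mx] := leP x m.
      exists x; rewrite ?mem_head // => z; rewrite inE => /predU1P[->//|/mle].
      exact: le_trans.
    exists m; first by rewrite inE ms orbT.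
    by move=> z; rewrite inE => /predU1P[->|/mle//]; exact: ltW.
  by exists m; [exact: sA | move=> x /As /mle].
have infm : inf A = m.
  apply/eqP; rewrite eq_le; apply/andP; split.
    by apply: (ge_inf (ex_intro _ m mlb) Am).
  by apply: (lb_le_inf (ex_intro _ m Am) mlb).
by rewrite infm.
Qed.

Lemma bigmax_in (I : eqType) (r : seq I) (F : I -> R) (D : seq R) :
  0 \in D -> {in r, forall i, F i \in D} -> \big[Num.max/0]_(i <- r) F i \in D.
Proof.
move=> D0 FD; rewrite big_seq_cond; apply: (big_ind (fun x => x \in D)) => // [x y xD yD|i].
  by case: leP.
by rewrite andbT => /FD.
Qed.

Definition dists (L : seq plane) : seq R := 0 :: [seq dist p q | p <- L, q <- L].

Lemma walk_cost_dists P Q w :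
  paired_walk P Q w -> walk_cost w \in dists (P ++ Q).
Proof.
move=> [Pw Qw _]; have D0 : 0 \in dists (P ++ Q) by rewrite mem_head.
do 3 (apply: bigmax_in => // ? ?); rewrite inE; apply/orP; right.
apply: allpairs_f; rewrite mem_cat -?Pw -?Qw; apply/orP; [left|right].
  by apply/flattenP; eexists; [apply: map_f|]; eassumption.
by apply/flattenP; eexists; [apply: map_f|]; eassumption.
Qed.

Lemma paired_walk_ex P Q :
  P != [::] -> Q != [::] -> exists w, paired_walk P Q w.
Proof.
elim: P Q => // p [|p' P] IH [|q Q] // _ _.
  exists [:: ([:: p], q :: Q)]; split=> //=; rewrite ?cats0 //.
  by move=> PQ; rewrite inE => /eqP->.
case: Q => [|q' Q].
  exists [:: (p :: p' :: P, [:: q])]; split=> //=; rewrite ?cats0 //.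
  by move=> PQ; rewrite inE => /eqP->.
have [//|//|w [Pw Qw wok]] := IH (q' :: Q).
exists (([:: p], [:: q]) :: w); split; rewrite /= ?Pw ?Qw //.
by move=> PQ; rewrite inE => /predU1P[->//|/wok].
Qed.

Lemma dfrechet_min P Q : P != [::] -> Q != [::] ->
  walk_costs P Q (dfrechet P Q) /\ lbound (walk_costs P Q) (dfrechet P Q).
Proof.
move=> P0 Q0; apply: (@inf_finite_min _ (dists (P ++ Q))).
  by have [w Hw] := paired_walk_ex P0 Q0; exists (walk_cost w), w.
by move=> _ [w Hw <-]; exact: walk_cost_dists Hw.
Qed.

Lemma eps_star_min S : (1 < #|` S|)%N ->
  partition_dfrechets S (eps_star S) /\
  lbound (partition_dfrechets S) (eps_star S).
Proof.
move=> S1; apply: (@inf_finite_min _ (dists S)).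
  have [x xS] : exists x, x \in S by apply/fset0Pn; rewrite -cardfs_gt0 ltnW.
  exists (dfrechet [fset x]%fset (S `\ x)%fset).
  exists ([fset x]%fset : seq _), ((S `\ x)%fset : seq _); split=> //; split.
  - by rewrite -size_eq0 -/(#|` _|) cardfs1.
  - rewrite -size_eq0 -/(#|` _|) -lt0n.
    by move: S1; rewrite (cardfsD1 x) xS /= ltnS.
  exists [fset x]%fset, (S `\ x)%fset; split=> //; first by rewrite fsetD1K.
  by rewrite fdisjoint1X !inE eqxx.
move=> _ [P [Q [[P0 Q0 [A [B [<- _ PA QB]]]] ->]]].
have [[w Hw <-] _] := dfrechet_min P0 Q0.
have := walk_cost_dists Hw; rewrite !inE => /orP[->//|/allpairsP[[p q]] /=].
have PQS : P ++ Q =i (A `|` B)%fset.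
  by move=> x; rewrite mem_cat (perm_mem PA) (perm_mem QB) inE.
move=> [pL qL ->]; apply/orP; right.
by apply: allpairs_f; rewrite -PQS.
Qed.

End Curves.

(* A real RAM, presented as structured programs.  Memory consists of arrays of
   integers and arrays of real numbers; a program refers to finitely many
   arrays, whose names are literals in its text.  Integers are words smaller
   than a bound [W]; an integer operation whose result is not a word is stuck,
   so that unit-cost integer arithmetic cannot be abused.  Reals are
   manipulated exactly by the four field operations and comparisons: there is
   no root, no rounding, and no way to read the digits of a real. *)
Section RealRAM.
Variable R : realType.

Inductive iop := OAdd | OSub | OMul | ODiv | OMod.

Inductive iexp :=
| ICst (k : nat)
| IGet (a : nat) (i : iexp)
| IBin (o : iop) (x y : iexp).

Inductive rop := RAdd | RSub | RMul | RDiv.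

(* [RInt x] is the real number with the value of the integer [x]. *)
Inductive rexp :=
| RInt (x : iexp)
| RGet (a : nat) (i : iexp)
| RBin (o : rop) (x y : rexp).

Inductive test :=
| TILe (x y : iexp)
| TRLe (x y : rexp)
| TNot (b : test)
| TAnd (b c : test).

Inductive cmd :=
| Skip
| ISet (a : nat) (i x : iexp)
| RSet (a : nat) (i : iexp) (x : rexp)
| Seq (c d : cmd)
| If (b : test) (c d : cmd)
| While (b : test) (c : cmd).

Record state := State {
  imem : nat -> nat -> nat;
  rmem : nat -> nat -> R
}.

Definition upd (T : Type) (m : nat -> nat -> T) (a i : nat) (v : T) :=
  fun a' i' => if (a' == a) && (i' == i) then v else m a' i'.

Definition word (W x : nat) : option nat := if (x < W)%N then Some x else None.

(* Subtraction is truncated; [x / 0] is 0 and [x mod 0] is [x]. *)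
Definition iop_eval (o : iop) (x y : nat) : nat :=
  match o with
  | OAdd => x + y
  | OSub => x - y
  | OMul => x * y
  | ODiv => x %/ y
  | OMod => x %% y
  end%N.

(* Division by 0 yields 0. *)
Definition rop_eval (o : rop) (x y : R) : R :=
  match o with
  | RAdd => x + y
  | RSub => x - y
  | RMul => x * y
  | RDiv => x / y
  end.

Definition obind2 (X Y Z : Type) (f : X -> Y -> option Z) ox oy :=
  obind (fun x => obind (f x) oy) ox.

Fixpoint ieval (W : nat) (s : state) (e : iexp) : option nat :=
  match e with
  | ICst k => word W k
  | IGet a i => omap (imem s a) (ieval W s i)
  | IBin o x y => obind2 (fun m n => word W (iop_eval o m n))
                         (ieval W s x) (ieval W s y)
  end.

Fixpoint reval (W : nat) (s : state) (e : rexp) : option R :=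
  match e with
  | RInt x => omap (fun k => k%:R) (ieval W s x)
  | RGet a i => omap (rmem s a) (ieval W s i)
  | RBin o x y => obind2 (fun u v => Some (rop_eval o u v))
                         (reval W s x) (reval W s y)
  end.

Fixpoint teval (W : nat) (s : state) (b : test) : option bool :=
  match b with
  | TILe x y => obind2 (fun m n => Some (m <= n)%N) (ieval W s x) (ieval W s y)
  | TRLe x y => obind2 (fun u v => Some (u <= v)) (reval W s x) (reval W s y)
  | TNot b => omap negb (teval W s b)
  | TAnd b c => obind2 (fun u v => Some (u && v)) (teval W s b) (teval W s c)
  end.

Fixpoint icost (e : iexp) : nat :=
  match e with
  | ICst _ => 1
  | IGet _ i => (icost i).+1
  | IBin _ x y => (icost x + icost y).+1
  end.

Fixpoint rcost (e : rexp) : nat :=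
  match e with
  | RInt x => (icost x).+1
  | RGet _ i => (icost i).+1
  | RBin _ x y => (rcost x + rcost y).+1
  end.

Fixpoint tcost (b : test) : nat :=
  match b with
  | TILe x y => (icost x + icost y).+1
  | TRLe x y => (rcost x + rcost y).+1
  | TNot b => (tcost b).+1
  | TAnd b c => (tcost b + tcost c).+1
  end.

(* [exec W s c t s']: with word bound [W], started in [s], the program [c]
   halts in [s'] after [t] elementary operations. *)
Inductive exec (W : nat) : state -> cmd -> nat -> state -> Prop :=
| exec_skip s : exec W s Skip 1 s
| exec_iset s a i x k v :
    ieval W s i = Some k -> ieval W s x = Some v ->
    exec W s (ISet a i x) (icost i + icost x).+1
         (State (upd (imem s) a k v) (rmem s))
| exec_rset s a i x k v :
    ieval W s i = Some k -> reval W s x = Some v ->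
    exec W s (RSet a i x) (icost i + rcost x).+1
         (State (imem s) (upd (rmem s) a k v))
| exec_seq s1 s2 s3 c d t u :
    exec W s1 c t s2 -> exec W s2 d u s3 ->
    exec W s1 (Seq c d) (t + u) s3
| exec_if_true s s' b c d t :
    teval W s b = Some true -> exec W s c t s' ->
    exec W s (If b c d) (tcost b + t).+1 s'
| exec_if_false s s' b c d t :
    teval W s b = Some false -> exec W s d t s' ->
    exec W s (If b c d) (tcost b + t).+1 s'
| exec_while_true s1 s2 s3 b c t u :
    teval W s1 b = Some true -> exec W s1 c t s2 ->
    exec W s2 (While b c) u s3 ->
    exec W s1 (While b c) (tcost b + t + u).+1 s3
| exec_while_false s b c :
    teval W s b = Some false -> exec W s (While b c) (tcost b).+1 s.

(* Input: the number of points in cell 0 of integer array 0, their abscissas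
   and ordinates in real arrays 0 and 1; every other cell is 0. *)
Definition input (s : seq (plane R)) : state :=
  State (upd (fun _ _ => 0%N) 0 0 (size s))
        (fun a i => if a == 0%N then (nth (0, 0) s i).1
                    else if a == 1%N then (nth (0, 0) s i).2 else 0).

Definition read_curve (st : state) (m ax ay : nat) : seq (plane R) :=
  mkseq (fun i => (rmem st ax i, rmem st ay i)) m.

(* Output: the numbers of vertices of the two curves in cells 0 and 1 of
   integer array 0, the vertices of the first curve in real arrays 0 and 1,
   those of the second one in real arrays 2 and 3. *)
Definition output (st : state) : seq (plane R) * seq (plane R) :=
  (read_curve st (imem st 0 0) 0 1, read_curve st (imem st 0 1) 2 3).

(* Words on an input of [n] points are the integers below [n ^ c], i.e. they
   have O(log n) bits. *)
Definition computes (prog : cmd) (c : nat) (s : seq (plane R)) (t : nat)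
    (P Q : seq (plane R)) : Prop :=
  exists2 st, exec (size s ^ c) (input s) prog t st & output st = (P, Q).

(* [goal S P Q] can be achieved in O(n log n) time, by one program and with
   constants that do not depend on [S] nor on the order [s] in which its
   points are given. *)
Definition findable_in_nlogn
    (goal : {fset plane R} -> seq (plane R) -> seq (plane R) -> Prop) : Prop :=
  exists (prog : cmd) (c : nat) (K : R),
    forall (S : {fset plane R}) (s : seq (plane R)),
      perm_eq s S -> (2 < size s)%N ->
      exists (t : nat) (P Q : seq (plane R)),
        [/\ computes prog c s t P Q,
            t%:R <= K * ((size s)%:R * ln (size s)%:R) & goal S P Q].

Lemma exec_det W s c t s' t2 s2 :
  exec W s c t s' -> exec W s c t2 s2 -> t = t2 /\ s' = s2.
Proof.
move=> E; elim: E t2 s2 => {s c t s'}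
  [s|s a i x k v ? ?|s a i x k v ? ?|s1 s2 s3 c d t u _ IH1 _ IH2
  |s s' b c d t ? _ IH1|s s' b c d t ? _ IH1
  |s1 s2 s3 b c t u ? _ IH1 _ IH2|s b c ?] t2 s4 E; inversion E; subst;
  try congruence; try (split; congruence);
  repeat match goal with
  | IH : (forall _ _, exec _ ?a ?c _ _ -> _), H : exec _ ?a ?c _ _ |- _ =>
      have [? ?] := IH _ _ H; subst; clear H
  end; by [].
Qed.

End RealRAM.

(* Main.v *)
(* Write e for eps_star S.  If d_dF(P,Q) = e, every point has a partner within e, so e is
   at least the largest nearest-neighbour distance.  Conversely the nearest-neighbour
   graph is covered by disjoint stars; the centres and the leaves, listed star by star, have a paired walk whose cost is
   the longest star edge.  Hence e is the largest nearest-neighbour distance.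

   For the lengths, list the stars along a tour that doubles an L1 minimum spanning tree T;
   as the total length of the star edges is at most 4 times the tour, l(P) + l(Q) is at most
   10 times the tour.  An optimal pair P', Q' and one bridge of length at most e connect S,
   so the tour is at most 4 (l(P') + l(Q') + e).  This suffices if
   e <= 2 (l(P') + l(Q')).  Otherwise the point p with the farthest nearest neighbour is alone
   on its curve and all other points are at distance exactly e from it; one star with centre p
   is then used, and the leaves follow the tour without its two edges at p.

   T comes from Kruskal's algorithm on O(n) candidate edges, the nearest points in the octants,
   found by sweeps with a tournament tree.  Let M be the largest L1 nearest-neighbour distance.
   Since M^2 <= 2 e^2, exact Euclidean nearest neighbours are only needed at points with
   2 d^2 > M^2.  These have L1 nearest-neighbour distance above M/2, so they are alone in
   their cell of a grid of width M/4, and 81 look-ups per point find what they need. *)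

Require Import Defs.
From mathcomp Require Import all_boot all_order all_algebra all_fingroup.
From mathcomp Require Import finmap.
From mathcomp Require Import boolp reals exp.
From mathcomp Require Import zify ring lra.

Set Implicit Arguments.
Unset Strict Implicit.
Unset Printing Implicit Defensive.

Import Order.TTheory GRing.Theory Num.Theory.

Local Open Scope ring_scope.

(** * Programs *)

(** The L1 metric is used because inside an octant the L1 distance from the apex is a difference of
    two values of one linear form, so a tournament tree keyed by that form serves every apex; in
    lengths this costs only a constant factor. The Fréchet distance tolerates no such factor:
    squared Euclidean distances (the machine has no roots) must be exact wherever they can decide
    the maximum, and may stay approximate elsewhere. The obstacle for lengths is an optimum much
    larger than both curves, as for a centre and points crowded on an arc of a circle around it: the
    two tour edges at the centre can then exceed any multiple of the optimal length, so neither
    curve may traverse them. The bound is proved against every pair that attains the optimal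
    distance, so the bounds on the sum and on the maximum both follow from one statement, the latter
    with a further factor 2. The cell table has quadratically many addresses, but memory starts at
    zero and only O(n) cells are ever written, so it needs no initialisation. *)

Arguments upd {T} m a i v a' /.

Notation ivar x := (IGet x (ICst 0)).
Notation iset0 x e := (ISet x (ICst 0) e).

Section Hoare.
Variable R : realType.
Variable W : nat.
Implicit Types (s : state R) (c d : cmd) (Q : state R -> Prop).

(** Evaluation is split into a total value and a separate side condition [iok] that collects the
    word bounds, so that program states can be handled with plain functions. *)
Fixpoint iv s (e : iexp) : nat :=
  match e with
  | ICst k => k
  | IGet a i => imem s a (iv s i)
  | IBin o x y => iop_eval o (iv s x) (iv s y)
  end.

Fixpoint iok s (e : iexp) : Prop :=
  match e with
  | ICst k => (k < W)%N
  | IGet _ i => iok s i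
  | IBin o x y => [/\ iok s x, iok s y & (iop_eval o (iv s x) (iv s y) < W)%N]
  end.

Fixpoint rv s (e : rexp) : R :=
  match e with
  | RInt x => (iv s x)%:R
  | RGet a i => rmem s a (iv s i)
  | RBin o x y => rop_eval o (rv s x) (rv s y)
  end.

Fixpoint rok s (e : rexp) : Prop :=
  match e with
  | RInt x => iok s x
  | RGet _ i => iok s i
  | RBin _ x y => rok s x /\ rok s y
  end.

Fixpoint tv s (b : test) : bool :=
  match b with
  | TILe x y => (iv s x <= iv s y)%N
  | TRLe x y => rv s x <= rv s y
  | TNot b => ~~ tv s b
  | TAnd b c => tv s b && tv s c
  end.

Fixpoint tok s (b : test) : Prop :=
  match b with
  | TILe x y => iok s x /\ iok s y
  | TRLe x y => rok s x /\ rok s y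
  | TNot b => tok s b
  | TAnd b c => tok s b /\ tok s c
  end.

Lemma ievalE s e : iok s e -> ieval W s e = Some (iv s e).
Proof.
elim: e => /= [k|a i IH|o x IHx y IHy]; first by rewrite /word => ->.
  by move=> /IH ->.
by move=> [/IHx -> /IHy -> /=]; rewrite /word => ->.
Qed.

Lemma revalE s e : rok s e -> reval W s e = Some (rv s e).
Proof.
elim: e => /= [x|a i|o x IHx y IHy]; try by move=> /ievalE ->.
by move=> [/IHx -> /IHy ->].
Qed.

Lemma tevalE s b : tok s b -> teval W s b = Some (tv s b).
Proof.
elim: b => /= [x y|x y|b IH|b IHb c IHc].
- by move=> [/ievalE -> /ievalE ->].
- by move=> [/revalE -> /revalE ->].
- by move=> /IH ->.
- by move=> [/IHb -> /IHc ->].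
Qed.

Definition runs c s (b : nat) Q :=
  exists t s', [/\ exec W s c t s', (t <= b)%N & Q s'].

Lemma runs_weaken c s b b' Q Q' : runs c s b Q -> (b <= b')%N ->
  (forall s', Q s' -> Q' s') -> runs c s b' Q'.
Proof.
move=> [t [s' [E tb q]]] bb QQ; exists t, s'; split=> //; last exact: QQ.
exact: leq_trans bb.
Qed.

Lemma runs_seq c d s b1 b2 Q1 Q : runs c s b1 Q1 ->
  (forall s', Q1 s' -> runs d s' b2 Q) -> runs (Seq c d) s (b1 + b2) Q.
Proof.
move=> [t [s' [E tb q]]] /(_ _ q)[u [s2 [E2 ub q2]]].
by exists (t + u)%N, s2; split; [exact: exec_seq E E2|exact: leq_add|].
Qed.

(** The index of the invariant is fuel: it bounds the number of iterations that remain. This covers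
    counting loops as well as loops that halve an index or climb to a root. *)
Lemma runs_while b c s (I : nat -> state R -> Prop) k B Q : I k s ->
  (forall j s', I j s' -> tok s' b /\
     if tv s' b then (0 < j)%N /\ runs c s' B (I j.-1) else Q s') ->
  runs (While b c) s (k.+1 * (tcost b + B).+1) Q.
Proof.
move=> + H; elim: k s => [|k IH] s Ik; have [tk] := H _ _ Ik;
  case: ifP => tvb; [by case| | |].
- move=> q; exists (tcost b).+1, s; split=> //.
    by apply: exec_while_false; rewrite tevalE ?tvb.
  by rewrite mul1n ltnS leq_addr.
- move=> [_ [t [s' [E tb q]]]]; have [u [s2 [E2 ub q2]]] := IH _ q.
  exists (tcost b + t + u).+1, s2; split=> //.
    by apply: exec_while_true E E2; rewrite tevalE ?tvb.
  by rewrite mulSn addSn ltnS leq_add // leq_add.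
- move=> q; exists (tcost b).+1, s; split=> //.
    by apply: exec_while_false; rewrite tevalE ?tvb.
  by rewrite mulSn addSn ltnS -addnA leq_addr.
Qed.

(* Only for loop-free commands: [wp] is false on loops. *)
Fixpoint ccost c : nat :=
  match c with
  | Skip => 1
  | ISet _ i x => (icost i + icost x).+1
  | RSet _ i x => (icost i + rcost x).+1
  | Seq c d => ccost c + ccost d
  | If b c d => (tcost b + (ccost c + ccost d)).+1
  | While _ _ => 0
  end.

Fixpoint wp c Q s : Prop :=
  match c with
  | Skip => Q s
  | ISet a i x => [/\ iok s i, iok s x &
      Q (State (upd (imem s) a (iv s i) (iv s x)) (rmem s))]
  | RSet a i x => [/\ iok s i, rok s x &
      Q (State (imem s) (upd (rmem s) a (iv s i) (rv s x)))]
  | Seq c d => wp c (fun s' => wp d Q s') s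
  | If b c d => tok s b /\ if tv s b then wp c Q s else wp d Q s
  | While _ _ => False
  end.

Lemma runs_wp c s Q : wp c Q s -> runs c s (ccost c) Q.
Proof.
elim: c s Q => //= [|a i x|a i x|c IHc d IHd|b c IHc d IHd] s Q.
- by move=> q; exists 1%N, s; split=> //; exact: exec_skip.
- move=> [ik xk q]; eexists _, _; split; last exact: q; last exact: leqnn.
  by apply: exec_iset; exact: ievalE.
- move=> [ik xk q]; eexists _, _; split; last exact: q; last exact: leqnn.
  by apply: exec_rset; [exact: ievalE|exact: revalE].
- by move=> H; apply: runs_seq (IHc _ _ H) _ => s'; exact: IHd.
- move=> [tk]; case: ifP => tvb => [/IHc|/IHd] [t [s' [E tb q]]].
    exists (tcost b + t).+1, s'; split=> //.
      by apply: exec_if_true E; rewrite tevalE ?tvb.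
    by rewrite ltnS leq_add2l (leq_trans tb) ?leq_addr.
  exists (tcost b + t).+1, s'; split=> //.
    by apply: exec_if_false E; rewrite tevalE ?tvb.
  by rewrite ltnS leq_add2l (leq_trans tb) ?leq_addl.
Qed.

(** For branches that contain loops, which [wp] rejects. *)
Lemma runs_if b c d s k Q : tok s b ->
  (tv s b -> runs c s k Q) -> (~~ tv s b -> runs d s k Q) ->
  runs (If b c d) s (tcost b + k).+1 Q.
Proof.
move=> tk Hc Hd; case tvb: (tv s b).
  have [t [s' [E tb q]]] := Hc tvb.
  exists (tcost b + t).+1, s'; split=> //; last by rewrite ltnS leq_add2l.
  by apply: exec_if_true E; rewrite tevalE ?tvb.
have [t [s' [E tb q]]] := Hd (negbT tvb).
exists (tcost b + t).+1, s'; split=> //; last by rewrite ltnS leq_add2l.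
by apply: exec_if_false E; rewrite tevalE ?tvb.
Qed.

(** The arrays that may change are read off the text of the program, so that the preservation of any
    other array is settled by evaluation. *)
Fixpoint iwrites c : seq nat :=
  match c with
  | ISet a _ _ => [:: a]
  | Seq c d | If _ c d => iwrites c ++ iwrites d
  | While _ c => iwrites c
  | _ => [::]
  end.

Fixpoint rwrites c : seq nat :=
  match c with
  | RSet a _ _ => [:: a]
  | Seq c d | If _ c d => rwrites c ++ rwrites d
  | While _ c => rwrites c
  | _ => [::]
  end.

Definition frame (wi wr : seq nat) s s' :=
  (forall a, a \notin wi -> imem s' a = imem s a) /\
  (forall a, a \notin wr -> rmem s' a = rmem s a).

Lemma frame_trans wi wr s1 s2 s3 :
  frame wi wr s1 s2 -> frame wi wr s2 s3 -> frame wi wr s1 s3.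
Proof.
by move=> [F1 G1] [F2 G2]; split=> a aw; rewrite ?F2 ?G2 ?F1 ?G1.
Qed.

Lemma frame_sub (wi wr wi' wr' : seq nat) s1 s2 :
  {subset wi <= wi'} -> {subset wr <= wr'} ->
  frame wi wr s1 s2 -> frame wi' wr' s1 s2.
Proof.
move=> si sr [F1 G1]; split=> a aw; [rewrite F1|rewrite G1] => //.
  by apply: contra aw; exact: si.
by apply: contra aw; exact: sr.
Qed.

Lemma exec_frame s c t s' : exec W s c t s' -> frame (iwrites c) (rwrites c) s s'.
Proof.
elim=> {s c t s'} /=
  [s|s a i x k v _ _|s a i x k v _ _|s1 s2 s3 c d t u _ [F1 G1] _ [F2 G2]
  |s s' b c d t _ _ [F G]|s s' b c d t _ _ [F G]
  |s1 s2 s3 b c t u _ _ [F1 G1] _ [F2 G2]|s b c _]; split=> //= a'.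
- by rewrite inE => /negPf n; apply/funext => j /=; rewrite n.
- by rewrite inE => /negPf n; apply/funext => j /=; rewrite n.
- by rewrite mem_cat negb_or => /andP[/F1 <- /F2].
- by rewrite mem_cat negb_or => /andP[/G1 <- /G2].
- by rewrite mem_cat negb_or => /andP[/F].
- by rewrite mem_cat negb_or => /andP[/G].
- by rewrite mem_cat negb_or => /andP[_ /F].
- by rewrite mem_cat negb_or => /andP[_ /G].
- by move=> a'n; rewrite F2 // F1.
- by move=> a'n; rewrite G2 // G1.
Qed.

Lemma runs_frame c s b Q : runs c s b Q ->
  runs c s b (fun s' => Q s' /\ frame (iwrites c) (rwrites c) s s').
Proof.
by move=> [t [s' [E tb q]]]; exists t, s'; split=> //; split=> //; exact: exec_frame E.
Qed.


Definition For x v body :=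
  Seq (iset0 x (ICst 0))
    (While (TNot (TILe (ivar v) (ivar x)))
       (Seq body (iset0 x (IBin OAdd (ivar x) (ICst 1))))).

(** The counter is incremented after the body, so the body has to establish the next invariant in
    every state that differs from its own at the counter only. *)
Lemma runs_for x v body s B n (I : nat -> state R -> Prop) :
  imem s v 0 = n -> (n < W)%N ->
  [&& v != x, v \notin iwrites body & x \notin iwrites body] ->
  (forall s', frame [:: x] [::] s s' -> I 0 s') ->
  (forall k s', (k < n)%N -> imem s' x 0 = k -> I k s' ->
    frame (x :: iwrites body) (rwrites body) s s' -> imem s' v 0 = n ->
    runs body s' B (fun s'' => forall s3, frame [:: x] [::] s'' s3 -> I k.+1 s3)) ->
  runs (For x v body) s (n.+1 * (B + 20))
    (fun s' => I n s' /\ frame (x :: iwrites body) (rwrites body) s s').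
Proof.
move=> vn nW /and3P[vx vb xb] I0 Istep.
set fr := frame _ _ s.
have frx s' s'' : frame [:: x] [::] s' s'' ->
    frame (x :: iwrites body) (rwrites body) s' s''.
  by apply: frame_sub => // y; rewrite !inE => ->.
pose J j s' := exists k, [/\ (k + j = n)%N, imem s' x 0 = k, I k s' & fr s'].
have frv s' : fr s' -> imem s' v 0 = n.
  by move=> [F _]; rewrite F // inE negb_or vx.
(* With 0 as the only word the increment would be stuck; but then [n = 0] and it is never
   evaluated. *)
case W2: (1 < W)%N; last first.
  have n0 : n = 0%N by case: n {J} vn nW Istep frv W2 => // n; case: (W) => [|[]].
  have W1 : W = 1%N by case: (W) nW W2 => [|[|]].
  have E0 : exec W s (iset0 x (ICst 0)) 3
             (State (upd (imem s) x 0 0) (rmem s)).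
    by apply: exec_iset; rewrite /= /word W1.
  have f0 := exec_frame E0.
  exists (3 + 7)%N, (State (upd (imem s) x 0 0) (rmem s)); split.
  - apply: exec_seq E0 _.
    apply: (@exec_while_false _ _ _ (TNot (TILe (ivar v) (ivar x)))).
    by rewrite /= /word W1 /= !eqxx /= (negPf vx) /= vn n0.
  - by rewrite (@leq_trans (B + 20)) // ?leq_pmull // (@leq_trans 20) ?leq_addl.
  - by split; [rewrite n0; apply: I0 f0|exact: frx].
apply: (@runs_weaken _ _ (3 + n.+1 * (6 + (B + 6)).+1) _ (fun s1 => I n s1 /\ fr s1)).
- apply: (@runs_seq _ _ _ _ _ (J n)).
    apply: (@runs_wp (iset0 x (ICst 0))) => /=.
    split; rewrite ?(ltnW W2) //; exists 0%N; set s0 := State _ _.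
    have f0 : frame [:: x] [::] s s0.
      split=> //= a; rewrite inE => /negPf ax; apply/funext => i /=.
      by rewrite ax.
    split; rewrite ?addn0 //=; [by rewrite eqxx|exact: I0|exact: frx].
  move=> s' Js'; apply: runs_while Js' _ => j {}s' [k [kn xk Ik fk]].
  split; first by rewrite /= (ltnW W2).
  rewrite /= xk frv //; case: (leqP n k) => [nk|kn'] /=.
    have nk0 : n = k by apply/eqP; rewrite eqn_leq nk -kn leq_addr.
    by split; rewrite // nk0.
  split; first by lia.
  apply: (@runs_seq _ _ _ _ 6).
    by apply: (runs_frame (Istep _ _ kn' xk Ik fk _)); exact: frv.
  move=> s2 [I2 f2].
  have x2 : imem s2 x 0 = k by rewrite f2.1.
  have fs2 : fr s2.
    apply: frame_trans fk (frame_sub _ _ f2) => // y.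
    by rewrite inE => ->; rewrite orbT.
  apply: runs_weaken (@runs_wp (iset0 x _) _ (J j.-1) _) _ _ => //=.
  rewrite x2; split; rewrite ?(ltnW W2) //; first by split; rewrite ?(ltnW W2) //; lia.
  exists k.+1; set s3 := State _ _.
  have f3 : frame [:: x] [::] s2 s3.
    split=> //= a; rewrite inE => /negPf ax; apply/funext => i /=.
    by rewrite ax.
  split; first lia.
  - by rewrite /= eqxx /= addn1.
  - exact: I2.
  - exact: frame_trans fs2 (frx _ _ f3).
- by nia.
- by move=> s' ? .
Qed.

End Hoare.



Ltac wps := repeat match goal with
  | |- and3 _ _ _ => split
  | |- and _ _ => split
  | |- is_true (leq _ _) => lia
  end.

(** * Tournament trees *)

(* Array names: those in [r] denote real arrays, the other ones integer arrays.
   Names in [v] or [t], as well as [rbase], [rM] and [rd], are variables, kept in cell 0. *)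
Notation vn := 1%N.
Notation vi := 2%N.
Notation vm := 3%N.
Notation vN := 4%N.
Notation vj := 5%N.
Notation ti := 6%N.
Notation ta := 7%N.
Notation tb := 8%N.
Notation tr := 9%N.
Notation tL := 10%N.
Notation tV := 11%N.
Notation aT := 12%N.
Notation aSO := 13%N.
Notation rK1 := 6%N.
Notation rK2 := 7%N.

Section Lex.
Variable R : realType.

(** The lexicographic order on pairs of keys, spelled with the comparisons and connectives of the
    machine so that it is literally the value of [tle]. *)
Definition lexle (k1 k2 : nat -> R) i j :=
  (k1 i <= k1 j) && ~~ ((k1 j <= k1 i) && ~~ (k2 i <= k2 j)).

Lemma lexle_total (k1 k2 : nat -> R) i j : lexle k1 k2 i j || lexle k1 k2 j i.
Proof. by rewrite /lexle; case: (ltgtP (k1 i)); case: (leP (k2 i)) => // /ltW ->. Qed.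

Lemma lexlexx (k1 k2 : nat -> R) i : lexle k1 k2 i i.
Proof. by rewrite /lexle !lexx. Qed.

Lemma lexle_trans (k1 k2 : nat -> R) j i l :
  lexle k1 k2 i j -> lexle k1 k2 j l -> lexle k1 k2 i l.
Proof.
rewrite /lexle => /andP[ij /nandP ij2] /andP[jl /nandP jl2].
rewrite (le_trans ij jl) /=; apply/nandP.
case: ij2 => [ij2|]; first by left; apply: contra ij2; exact: le_trans.
rewrite negbK => ij2; case: jl2 => [jl2|].
  by left; apply: contra jl2 => li; exact: le_trans li ij.
by rewrite negbK => jl2; right; rewrite negbK (le_trans ij2).
Qed.

Lemma lexle1 (k1 k2 : nat -> R) i j : lexle k1 k2 i j -> k1 i <= k1 j.
Proof. by case/andP. Qed.

Lemma lexle2 (k1 k2 : nat -> R) i j : lexle k1 k2 i j -> k1 i = k1 j -> k2 i <= k2 j.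
Proof. by case/andP=> _ + e; rewrite e lexx /= negbK. Qed.

(* Table entries are indices shifted by one; 0 stands for the absence of a candidate. *)
Definition isbest (k1 k2 : nat -> R) (A : nat -> Prop) (v : nat) :=
  if v is l.+1 then A l /\ forall l', A l' -> lexle k1 k2 l l'
  else forall l, ~ A l.

Definition bst (k1 k2 : nat -> R) (a b : nat) :=
  if (a <= 0)%N then b else if (b <= 0)%N then a
  else if lexle k1 k2 (a - 1) (b - 1) then a else b.

Lemma isbest_eq (k1 k2 : nat -> R) A B v : (forall l, A l <-> B l) ->
  isbest k1 k2 A v -> isbest k1 k2 B v.
Proof.
move=> AB; case: v => [|l] /= => [H l /AB|]; first exact: H.
by move=> [/AB ? H]; split=> // l' /AB; exact: H.
Qed.

Lemma bst_isbest (k1 k2 : nat -> R) A B a b : isbest k1 k2 A a -> isbest k1 k2 B b ->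
  isbest k1 k2 (fun l => A l \/ B l) (bst k1 k2 a b).
Proof.
case: a => [|a] bA; first by apply: isbest_eq => l; split; [right|case=> // /bA].
case: b => [|b] bB.
  by apply: isbest_eq bA => l; split; [left|case=> // /bB].
case: bA bB => Aa Am [Bb Bm].
rewrite /bst /= !subn1 /=; case: ifP => ab; split; [by left| |by right|].
  by move=> l [/Am|/Bm] //; exact: lexle_trans.
have := lexle_total k1 k2 a b; rewrite ab /= => ba.
by move=> l [/Am|/Bm] //; exact: lexle_trans.
Qed.

End Lex.

Section TreeMath.
Variable R : realType.
Implicit Types (T : nat -> nat) (act bad : nat -> Prop).

(* In a binary heap with [N] leaves, leaf [l] is node [N + l] and the parent of [i] is [i %/ 2]. *)
Definition cov (N i l : nat) := (l < N)%N /\ exists d, ((N + l) %/ 2 ^ d = i)%N.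
Definition anc (i j : nat) := exists d, (i %/ 2 ^ d = j)%N.

(** The nodes in [bad] are exempt: during an update these are the ancestors that have not been
    recomputed yet. *)
Definition treeokx N (k1 k2 : nat -> R) T act bad := forall i, (0 < i < N.*2)%N -> ~ bad i ->
  isbest k1 k2 (fun l => act l /\ cov N i l) (T i).

Definition treeok N (k1 k2 : nat -> R) T act := treeokx N k1 k2 T act (fun _ => False).

Lemma cov_leaf N i l : (N <= i < N.*2)%N -> cov N i l <-> l = (i - N)%N.
Proof.
move=> /andP[Ni iN]; split; last first.
  by move=> ->; split; [lia|exists 0%N; rewrite divn1; lia].
move=> [lN [[|d]]]; first by rewrite divn1; lia.
rewrite expnS divnMA => e.
have := leq_trans (leq_div ((N + l) %/ 2) (2 ^ d)) (leqnn _); lia.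
Qed.

Lemma div2P h : (h = h %/ 2 * 2 \/ h = h %/ 2 * 2 + 1)%N.
Proof. lia. Qed.

Lemma cov_node N i l : (0 < i < N)%N ->
  cov N i l <-> cov N (2 * i) l \/ cov N (2 * i + 1) l.
Proof.
move=> /andP[i0 iN]; split.
  move=> [lN [[|d]]]; first by rewrite divn1; lia.
  rewrite expnS mulnC divnMA => e.
  have [h|h] := div2P ((N + l) %/ 2 ^ d).
    by left; split=> //; exists d; rewrite h e mulnC.
  by right; split=> //; exists d; rewrite h e mulnC.
by move=> [] [lN [d e]]; split=> //; exists d.+1;
  rewrite expnS mulnC divnMA e; lia.
Qed.

Lemma anc_half i j : anc i j <-> j = i \/ anc (i %/ 2) j.
Proof.
split=> [[[|d]]|[->|[d e]]].
- by rewrite divn1; left.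
- by rewrite expnS divnMA; right; exists d.
- by exists 0%N; rewrite divn1.
- by exists d.+1; rewrite expnS divnMA.
Qed.

Lemma anc_le i j : anc i j -> (j <= i)%N.
Proof. by move=> [d <-]; exact: leq_div. Qed.

Definition fupd (T : nat -> nat) i v := fun j => if j == i then v else T j.

(** A leaf is seen only from its ancestors, so writing it (0 to deactivate) leaves all other nodes
    correct. *)
Lemma tree_leaf N (k1 k2 : nat -> R) T act l v : (l < N)%N -> v = 0%N \/ v = l.+1 ->
  treeok N k1 k2 T act ->
  treeokx N k1 k2 (fupd T (N + l) v) (fun j => if j == l then v <> 0%N else act j)
    (anc ((N + l) %/ 2)).
Proof.
move=> lN vl ok i iN nanc; rewrite /fupd; case: eqP => [->|iNl].
  case: vl => -> /=; [move=> l' [+ c]|split; last move=> l' [_ c]].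
  - have -> : l' = l by move/cov_leaf: c; lia.
    by rewrite eqxx.
  - by rewrite eqxx; split=> //; apply/cov_leaf; lia.
  - have -> : l' = l by move/cov_leaf: c; lia.
    exact: lexlexx.
apply: isbest_eq (ok i iN id) => j; suff jl : cov N i j -> j <> l.
  by split=> -[+ c]; case: eqP (jl c).
move=> [_ [d e]] jl; apply: nanc; have /anc_half[]// : anc (N + l) i.
by exists d; rewrite -e jl.
Qed.

(** The children of [i] have larger indices than [i], so they are not among its ancestors and are
    already correct. *)
Lemma tree_step N (k1 k2 : nat -> R) T act i : (0 < i < N)%N ->
  treeokx N k1 k2 T act (anc i) ->
  treeokx N k1 k2 (fupd T i (bst k1 k2 (T (2 * i)%N) (T (2 * i + 1)%N))) act
    (anc (i %/ 2)).
Proof.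
move=> iN ok j jN nanc; rewrite /fupd; case: eqP => [->|ji].
  have H : isbest k1 k2 (fun l => (act l /\ cov N (2 * i) l) \/
      (act l /\ cov N (2 * i + 1) l)) (bst k1 k2 (T (2 * i)%N) (T (2 * i + 1)%N)).
    by apply: bst_isbest; apply: ok; try lia; move=> /anc_le; lia.
  apply: isbest_eq H => l; have := cov_node l iN; tauto.
by apply: ok => // /anc_half[].
Qed.

Lemma tree_done N (k1 k2 : nat -> R) T act : treeokx N k1 k2 T act (anc 0) -> treeok N k1 k2 T act.
Proof. by move=> ok i iN _; apply: ok => // /anc_le; lia. Qed.

Lemma tree_eq N (k1 k2 : nat -> R) T act act' : (forall l, (l < N)%N -> act l <-> act' l) ->
  treeok N k1 k2 T act -> treeok N k1 k2 T act'.
Proof.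
move=> E ok i iN nb; apply: isbest_eq (ok i iN nb) => l.
by split=> -[a c]; split=> //; apply/E => //; case: c.
Qed.

Lemma tree_empty N (k1 k2 : nat -> R) T act : (forall i, T i = 0%N) ->
  (forall l, (l < N)%N -> ~ act l) -> treeok N k1 k2 T act.
Proof. by move=> T0 a0 i iN _; rewrite T0 => l [al [lN _]]; exact: a0 al. Qed.

(** Deactivating all leaves brings back the zero array that the next sort or sweep starts from. *)
Lemma tree_zero N (k1 k2 : nat -> R) T act : treeok N k1 k2 T act ->
  (forall l, (l < N)%N -> ~ act l) -> forall i, (0 < i < N.*2)%N -> T i = 0%N.
Proof.
move=> ok a0 i iN; have := ok i iN id; case: (T i) => //= l [[al [lN _]] _].
by case: (a0 l lN).
Qed.

Lemma tree_root k N (k1 k2 : nat -> R) T act : N = (2 ^ k)%N -> treeok N k1 k2 T act ->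
  isbest k1 k2 (fun l => act l /\ (l < N)%N) (T 1%N).
Proof.
move=> Nk ok; have N0 : (0 < N)%N by rewrite Nk expn_gt0.
apply: isbest_eq (ok 1%N _ id) => [l|]; last lia.
split=> -[al lN]; split=> //; first by case: lN.
split=> //; exists k; rewrite -Nk divnDl // divnn N0 divn_small //.
Qed.

(** Siblings have the same height. All leaves have indices of the same bit length, so the height of
    an ancestor is determined by its own bit length; an even [i > 1] and [i + 1] agree in it,
    because a power of two above [i] is even and cannot be [i + 1]. *)
Lemma level_unique k d d' x y i j : (2 ^ k <= x < 2 ^ k.+1)%N ->
  (2 ^ k <= y < 2 ^ k.+1)%N -> (x %/ 2 ^ d = i)%N -> (y %/ 2 ^ d' = j)%N ->
  (1 < i)%N -> ~~ odd i -> j = i.+1 -> d = d'.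
Proof.
move=> xk yk xi yj i1 iev ji.
have lev z e h : (2 ^ k <= z < 2 ^ k.+1)%N -> (z %/ 2 ^ e = h)%N -> (0 < h)%N ->
    [/\ (e <= k)%N, (2 ^ (k - e) <= h)%N & (h < 2 ^ (k - e).+1)%N].
  move=> /andP[kz zk] zh h0.
  have ek : (e <= k)%N.
    rewrite leqNgt; apply/negP => ke; move: h0; rewrite -zh divn_small //.
    by apply: leq_trans zk _; rewrite leq_exp2l.
  split=> //; first by rewrite -zh leq_divRL ?expn_gt0 // -expnD subnK.
  by rewrite -zh ltn_divLR ?expn_gt0 // -expnD addSn subnK.
have [dk di id] := lev _ _ _ xk xi (ltnW i1).
have [dk' dj jd] := lev _ _ _ yk yj (ltac:(lia)).
have {}jd2 : (j < 2 ^ (k - d).+1)%N.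
  have ev : ~~ odd (2 ^ (k - d).+1) by rewrite oddX.
  by move: id ev iev; rewrite ji; lia.
have Eq : (k - d = k - d')%N.
  apply/eqP; rewrite eqn_leq; apply/andP; split.
    by rewrite -ltnS -(ltn_exp2l _ _ (ltnSn 1)); lia.
  by rewrite -ltnS -(ltn_exp2l _ _ (ltnSn 1)); lia.
lia.
Qed.

(* [r] is the best active leaf to the right of [l] below the ancestor [i] of [l]. *)
Definition qinv N (k1 k2 : nat -> R) act l i r := exists2 d, ((N + l) %/ 2 ^ d = i)%N &
  isbest k1 k2 (fun l' => act l' /\ (l < l' < N)%N /\ ((N + l') %/ 2 ^ d = i)%N) r.

Lemma query_init N (k1 k2 : nat -> R) act l : qinv N k1 k2 act l (N + l) 0.
Proof. by exists 0%N; rewrite ?divn1 //= => l' [_ []]; rewrite divn1; lia. Qed.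

(** Passing from [i] to its parent adds the leaves below the sibling of [i]. They lie to the right
    of [l] exactly when [i] is a left child, that is, even. *)
Lemma query_step k N (k1 k2 : nat -> R) T act l i r : N = (2 ^ k)%N -> (l < N)%N ->
  treeok N k1 k2 T act -> (1 < i)%N -> qinv N k1 k2 act l i r ->
  qinv N k1 k2 act l (i %/ 2)
    (if (i %% 2 <= 0)%N then bst k1 k2 r (T (i + 1)%N) else r).
Proof.
move=> Nk lN ok i1 [d di br]; exists d.+1.
  by rewrite expnS mulnC divnMA di.
have half l' : ((N + l') %/ 2 ^ d.+1 = ((N + l') %/ 2 ^ d) %/ 2)%N.
  by rewrite expnS mulnC divnMA.
have mono l' : (l < l' -> i <= (N + l') %/ 2 ^ d)%N.
  by move=> ll; rewrite -di leq_div2r // leq_add2l ltnW.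
case: ifP => [ev|od]; last first.
  apply: isbest_eq br => l'; rewrite half; split=> -[al [ll e]]; split=> //; split=> //.
    by rewrite e.
  have /mono : (l < l')%N by case/andP: ll.
  lia.
have iN : (0 < i + 1 < N.*2)%N.
  have : (i <= N + l)%N by rewrite -di leq_div.
  have : ~~ odd N.*2 by rewrite odd_double.
  by lia.
apply: isbest_eq (bst_isbest br (ok _ iN id)) => l'; rewrite half.
split.
  move=> [[al [ll ->]]//|[al [l'N [d' d'i]]]].
  have dd : d = d'.
    apply: (@level_unique k d d' (N + l) (N + l') i (i + 1)) => //; try lia.
      by rewrite expnS -Nk; lia.
    by rewrite expnS -Nk; lia.
  rewrite dd d'i; split=> //; split; last lia.
  rewrite l'N andbT ltnNge; apply/negP => l'l.
  have := leq_div2r (2 ^ d) (leq_add (leqnn N) l'l).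
  by rewrite dd d'i -dd di; lia.
move=> [al [ll e]].
have /mono ii : (l < l')%N by case/andP: ll.
have [->|e1] := eqVneq ((N + l') %/ 2 ^ d)%N i; first by left.
right; split=> //; split; first by case/andP: ll.
by exists d; lia.
Qed.

Lemma query_done k N (k1 k2 : nat -> R) act l i r : N = (2 ^ k)%N -> (l < N)%N -> i = 1%N ->
  qinv N k1 k2 act l i r -> isbest k1 k2 (fun l' => act l' /\ (l < l' < N)%N) r.
Proof.
move=> Nk lN -> [d d1]; apply: isbest_eq => l'; split=> [[al [ll _]]//|[al ll]].
split=> //; split=> //.
have p0 : (0 < 2 ^ d)%N by rewrite expn_gt0.
have h1 : (2 ^ d <= N + l)%N by rewrite -[leqLHS]mul1n -leq_divRL // d1.
have h2 : (N + l < 2 * 2 ^ d)%N by rewrite -ltn_divLR // d1.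
have dk : d = k.
  apply/eqP; rewrite eqn_leq; apply/andP; split.
    by rewrite -ltnS -(ltn_exp2l _ _ (ltnSn 1)) expnS -Nk; lia.
  by rewrite -ltnS -(ltn_exp2l _ _ (ltnSn 1)) expnS -Nk; lia.
by rewrite dk -Nk divnDl // divnn divn_small //; lia.
Qed.

End TreeMath.

Definition tle x y : test :=
  TAnd (TRLe (RGet rK1 x) (RGet rK1 y))
       (TNot (TAnd (TRLe (RGet rK1 y) (RGet rK1 x))
                   (TNot (TRLe (RGet rK2 x) (RGet rK2 y))))).

Definition bestc : cmd :=
  If (TILe (ivar ta) (ICst 0)) (iset0 tr (ivar tb))
    (If (TILe (ivar tb) (ICst 0)) (iset0 tr (ivar ta))
       (If (tle (IBin OSub (ivar ta) (ICst 1)) (IBin OSub (ivar tb) (ICst 1)))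
          (iset0 tr (ivar ta)) (iset0 tr (ivar tb)))).

Definition upd_loop : cmd :=
  While (TILe (ICst 1) (ivar ti))
    (Seq (iset0 ta (IGet aT (IBin OMul (ICst 2) (ivar ti))))
    (Seq (iset0 tb (IGet aT (IBin OAdd (IBin OMul (ICst 2) (ivar ti)) (ICst 1))))
    (Seq bestc
    (Seq (ISet aT (ivar ti) (ivar tr))
         (iset0 ti (IBin ODiv (ivar ti) (ICst 2))))))).

Definition updc : cmd :=
  Seq (Seq (iset0 ti (IBin OAdd (ivar vN) (ivar tL)))
      (Seq (ISet aT (ivar ti) (ivar tV))
           (iset0 ti (IBin ODiv (ivar ti) (ICst 2)))))
      upd_loop.

Definition qryc : cmd :=
  Seq (Seq (iset0 ti (IBin OAdd (ivar vN) (ivar tL))) (iset0 tr (ICst 0)))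
    (While (TILe (ICst 2) (ivar ti))
      (Seq (If (TILe (IBin OMod (ivar ti) (ICst 2)) (ICst 0))
              (Seq (iset0 ta (ivar tr))
              (Seq (iset0 tb (IGet aT (IBin OAdd (ivar ti) (ICst 1)))) bestc))
              Skip)
           (iset0 ti (IBin ODiv (ivar ti) (ICst 2))))).


Section TreeProg.
Variable R : realType.
Variable W : nat.
Implicit Types (s : state R) (Q : state R -> Prop).

Lemma wp_best Q s : (1 < W)%N -> (imem s ta 0 < W)%N -> (imem s tb 0 < W)%N ->
  Q (State (upd (imem s) tr 0
       (bst (rmem s rK1) (rmem s rK2) (imem s ta 0) (imem s tb 0))) (rmem s)) ->
  wp W bestc Q s.
Proof.
move=> W1 aW bW; rewrite /bestc /bst /lexle /=; move: (ltnW W1) => W0.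
have da : (imem s ta 0 - 1 < W)%N by lia.
have db : (imem s tb 0 - 1 < W)%N by lia.
by do !case: ifP => //= _.
Qed.

Opaque bestc.

Lemma runs_upd s k T act l v : (4 * 2 ^ k < W)%N -> (2 < W)%N ->
  imem s vN 0 = (2 ^ k)%N -> (l < 2 ^ k)%N ->
  imem s tL 0 = l -> imem s tV 0 = v -> v = 0%N \/ v = l.+1 ->
  imem s aT = T -> treeok (2 ^ k) (rmem s rK1) (rmem s rK2) T act ->
  (forall i, (T i <= 2 ^ k)%N) ->
  runs W updc s ((ccost bestc + 100) * k.+2) (fun s' =>
    [/\ (forall i, (imem s' aT i <= 2 ^ k)%N),
        (forall i, ~~ (0 < i < (2 ^ k).*2)%N -> imem s' aT i = T i) &
        treeok (2 ^ k) (rmem s rK1) (rmem s rK2) (imem s' aT)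
          (fun j => if j == l then v <> 0%N else act j)]).
Proof.
move=> kW W2 sN lN sL sV vl sT ok Tle.
set N := (2 ^ k)%N in kW sN lN ok Tle *.
set act' := (fun j => if j == l then v <> 0%N else act j).
(* The fuel bounds the bit length of the current node, which drops by one at each level. *)
pose J j s' := [/\ imem s' ti 0 < 2 ^ j, imem s' ti 0 < N,
  (forall i, (imem s' aT i <= N)%N),
  (forall i, ~~ (0 < i < N.*2)%N -> imem s' aT i = T i) &
  treeokx N (rmem s rK1) (rmem s rK2) (imem s' aT) act' (anc (imem s' ti 0)) /\
  rmem s' = rmem s]%N.
apply: runs_weaken (@runs_seq _ _ _ _ _ _ _ (J k) _ _ _) _ _; [| | |by move=> ? H; exact: H].
  apply: runs_wp => /=; rewrite sN sL sV.
  wps; split; rewrite /= ?sT; try lia.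
  - by move=> i; case: eqP => // _; lia.
  - by move=> i iN; case: eqP => // e; move: iN; lia.
  - by split=> //; apply: tree_leaf.
move=> s' Js'; apply: runs_while Js' _ => j {}s' [tj tN TN TT [tok rs]].
split; first by split=> /=; lia.
rewrite /=; case: ifP => [i0|i0]; last first.
  split=> //; move: tok; have -> : imem s' ti 0 = 0%N by lia.
  exact: tree_done.
split.
  by case: j tj => //; lia.
apply: runs_wp => /=.
wps.
have h1 := TN (2 * imem s' ti 0)%N; have h2 := TN (2 * imem s' ti 0 + 1)%N.
apply: wp_best => /=; try lia.
wps.
have bN : (bst (rmem s' rK1) (rmem s' rK2) (imem s' aT (2 * imem s' ti 0))
     (imem s' aT (2 * imem s' ti 0 + 1)) <= N)%N.
  by rewrite /bst; do !case: ifP => //.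
split=> /=; rewrite -?/N.
- case: j tj => [|j] /=; rewrite ?expnS /=; lia.
- lia.
- by move=> i; case: eqP.
- by move=> i iN; case: eqP => [e|_]; [move: iN; lia|exact: TT].
- split=> //; rewrite rs; apply: tree_step => //; lia.
rewrite /updc /=; lia.
Qed.

Lemma runs_qry s k act l : (4 * 2 ^ k < W)%N -> (2 < W)%N ->
  imem s vN 0 = (2 ^ k)%N -> (l < 2 ^ k)%N -> imem s tL 0 = l ->
  treeok (2 ^ k) (rmem s rK1) (rmem s rK2) (imem s aT) act ->
  (forall i, (imem s aT i <= 2 ^ k)%N) ->
  runs W qryc s ((ccost bestc + 100) * k.+3) (fun s' =>
     isbest (rmem s rK1) (rmem s rK2) (fun l' => act l' /\ (l < l' < 2 ^ k)%N)
       (imem s' tr 0)).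
Proof.
set N := (2 ^ k)%N => kW W2 sN lN sL ok TN.
pose J j s' := [/\ (0 < imem s' ti 0 < 2 ^ j)%N, (imem s' ti 0 < N.*2)%N,
  (imem s' tr 0 <= N)%N,
  qinv N (rmem s rK1) (rmem s rK2) act l (imem s' ti 0) (imem s' tr 0) &
  imem s' aT = imem s aT /\ rmem s' = rmem s].
apply: runs_weaken (@runs_seq _ _ _ _ _ _ _ (J k.+1) _ _ _) _ _;
  [| | |by move=> ? H; exact: H].
  apply: runs_wp => /=; rewrite sN sL.
  wps; split; rewrite /= ?expnS -?/N; try lia.
  - exact: query_init.
  - by [].
move=> s' Js'; apply: runs_while Js' _ => j {}s' [tj tN trN q [eT rs]].
split; first by split=> /=; lia.
rewrite /=; case: ifP => [i0|i0]; last first.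
  by apply: (query_done (k := k)) q => //; lia.
split; first by case: j tj => //; lia.
apply: runs_wp => /=.
have q' := query_step (erefl N) lN ok i0 q.
wps; case: ifP => ev; wps.
  have h1 := TN (imem s' ti 0 + 1)%N; rewrite -eT in h1.
  apply: wp_best => /=; try lia; wps; rewrite ev in q'.
  have bN : (bst (rmem s' rK1) (rmem s' rK2) (imem s' tr 0)
       (imem s' aT (imem s' ti 0 + 1)) <= N)%N.
    by rewrite /bst; do !case: ifP => //.
  split=> //=; rewrite ?rs ?eT // -?rs -?eT //; try lia.
  case: j tj => [|j] /=; rewrite ?expnS /=; lia.
rewrite ev in q'; split=> //=; try lia.
case: j tj => [|j] /=; rewrite ?expnS /=; lia.
rewrite /qryc /=; lia.
Qed.

Definition sorted_idx (k1 k2 : nat -> R) m (o : nat -> nat) :=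
  [/\ forall i, (i < m)%N -> (o i < m)%N,
      forall i j, (i < m)%N -> (j < m)%N -> o i = o j -> i = j &
      forall i j, (i < j < m)%N -> lexle k1 k2 (o i) (o j)].

End TreeProg.

Section IdxPerm.
Implicit Types o : nat -> nat.

(** Pigeonhole: as long as fewer than [m] indices have been extracted the tree is not empty, so its
    root minus one is a genuine index. *)
Lemma idx_missing j m o : (j < m)%N -> exists2 l, (l < m)%N &
  forall i, (i < j)%N -> o i <> l.
Proof.
move=> jm; have [/hasP[l]|/hasPn H] :=
    boolP (has (fun l => l \notin map o (iota 0 j)) (iota 0 m)).
  rewrite mem_iota /= add0n => lm lo; exists l => // i ij e.
  by move/negP: lo; apply; apply/mapP; exists i; rewrite ?mem_iota.
have /uniq_leq_size : {subset iota 0 m <= map o (iota 0 j)}.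
  by move=> l /H; rewrite negbK.
by rewrite iota_uniq size_map !size_iota => /(_ isT); lia.
Qed.

Lemma idx_onto m o : (forall i, (i < m)%N -> (o i < m)%N) ->
  (forall i j, (i < m)%N -> (j < m)%N -> o i = o j -> i = j) ->
  forall l, (l < m)%N -> exists2 i, (i < m)%N & o i = l.
Proof.
move=> om oi l lm.
have u : uniq (map o (iota 0 m)).
  rewrite map_inj_in_uniq ?iota_uniq // => i j.
  by rewrite !mem_iota => im jm; exact: oi.
have sub : {subset map o (iota 0 m) <= iota 0 m}.
  by move=> x /mapP[i]; rewrite !mem_iota => im ->; exact: om.
have [_ E] := uniq_min_size u sub (ltac:(by rewrite size_map)).
have : l \in map o (iota 0 m) by rewrite E mem_iota.
by case/mapP => i; rewrite mem_iota => im ->; exists i.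
Qed.

End IdxPerm.

(** * Sorting *)

(** Tournament sort: all indices are entered as leaves, then the winner at the root is removed [m]
    times. *)
Definition sort_insert : cmd :=
  Seq (Seq (iset0 tL (ivar vj)) (iset0 tV (IBin OAdd (ivar vj) (ICst 1)))) updc.

Definition sort_extract : cmd :=
  Seq (Seq (iset0 tL (IBin OSub (IGet aT (ICst 1)) (ICst 1)))
      (Seq (ISet aSO (ivar vj) (ivar tL)) (iset0 tV (ICst 0)))) updc.

Definition sortc : cmd :=
  Seq (Seq (iset0 vN (ICst 1))
     (While (TNot (TILe (ivar vm) (ivar vN))) (iset0 vN (IBin OMul (ICst 2) (ivar vN)))))
  (Seq (For vj vm sort_insert) (For vj vm sort_extract)).

Notation lg := (trunc_log 2).

Section SortProg.
Variable R : realType.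
Implicit Types (s : state R) (Q : state R -> Prop).

Lemma runs_pow2 W s m : (4 * m + 100 < W)%N -> imem s vm 0 = m ->
  runs W (Seq (iset0 vN (ICst 1))
    (While (TNot (TILe (ivar vm) (ivar vN))) (iset0 vN (IBin OMul (ICst 2) (ivar vN)))))
    s (20 * (lg m).+3) (fun s' => exists k, [/\ imem s' vN 0 = 2 ^ k, m <= 2 ^ k,
       2 ^ k <= 2 * m + 1 & k <= (lg m).+1]%N).
Proof.
move=> mW sm.
pose J j s' := exists e, [/\ imem s' vN 0 = 2 ^ e, e + j = (lg m).+1,
  2 ^ e <= 2 * m + 1 & imem s' vm 0 = m]%N.
apply: runs_weaken (@runs_seq _ _ _ _ _ _ _ (J (lg m).+1) _ _ _) _ _;
  [| | |by move=> ? H; exact: H].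
  by apply: runs_wp => /=; wps; exists 0%N; split=> //=; lia.
move=> s' Js'; apply: runs_while Js' _ => j {}s' [e [sN ej e2 s'm]].
split; first by split=> /=; lia.
rewrite /= sN s'm; case: (leqP m (2 ^ e)%N) => [em|em] /=.
  by exists e; split=> //; lia.
have em' : (e <= lg m)%N by apply: trunc_log_max => //; lia.
split; first lia.
apply: runs_wp => /=; rewrite sN; wps; exists e.+1; rewrite expnS; split=> //=; lia.
rewrite /=; lia.
Qed.

(** The constant is chosen before the word bound, the input and its size, here and in every later
    cost statement; only so can it end up absolute. *)
Lemma runs_sort : exists C, forall W s m, (16 * m + 100 < W)%N ->
  imem s vm 0 = m -> (forall i, imem s aT i = 0%N) ->
  runs W sortc s (C * (m.+1 * (lg m).+1)) (fun s' =>
    [/\ sorted_idx (rmem s rK1) (rmem s rK2) m (imem s' aSO),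
        (forall i, imem s' aT i = 0%N) &
        exists k, [/\ imem s' vN 0 = 2 ^ k, m <= 2 ^ k, 2 ^ k <= 2 * m + 1 &
          k <= (lg m).+1]%N]).
Proof.
have [B Bd] : exists B, B = ccost bestc by eexists.
exists (100 * B + 4000)%N => W s m mW sm T0.
pose c := (m.+1 * (50 + (B + 100) * (lg m).+3))%N.
apply: (@runs_weaken _ _ _ _ (20 * (lg m).+3 + (c + c))); last first.
- by move=> s' H; exact: H.
- by rewrite /c; lia.
apply: (runs_seq (runs_frame (runs_pow2 _ sm))); first lia.
move=> s1 [[k [s1N mk km klg]] f1].
have s1m : imem s1 vm 0 = m by rewrite f1.1.
have T1 : forall i, imem s1 aT i = 0%N by move=> i; rewrite f1.1.
have K1 : rmem s1 = rmem s by apply/funext => a; rewrite f1.2.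
rewrite -K1 => {K1 f1 T0 sm s}; set N := (2 ^ k)%N in s1N mk km *.
set k1 := rmem s1 rK1; set k2 := rmem s1 rK2.
pose I1 j (s' : state R) := [/\ (forall i, (imem s' aT i <= N)%N),
  (forall i, ~~ (0 < i < N.*2)%N -> imem s' aT i = 0%N) &
  treeok N k1 k2 (imem s' aT) (fun l => (l < j)%N)].
apply: runs_seq; first apply: runs_weaken
  (@runs_for _ _ vj vm sort_insert s1 (30 + (B + 100) * k.+2) m I1 s1m _ _ _ _) _ (fun _ => id).
- lia.
- by [].
- move=> s' f; rewrite /I1 f.1 //; split=> [i|i _|]; rewrite ?T1 //.
  exact: tree_empty.
- move=> j s' jm sj [TN T0 tok] f s'm.
  apply: (@runs_seq _ _ _ _ _ 30 _ (fun s2 => [/\ imem s2 tL 0 = j, imem s2 tV 0 = j.+1,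
     imem s2 aT = imem s' aT, imem s2 vN = imem s' vN & rmem s2 = rmem s'])).
    by apply: runs_weaken (runs_wp _) _ (fun _ => id) => //=; rewrite !sj; wps; split=> //=; lia.
  move=> s2 [s2L s2V s2T s2N s2r].
  have NE : imem s2 vN 0 = N by rewrite s2N f.1.
  have rE : rmem s2 = rmem s1 by rewrite s2r; apply/funext => a; rewrite f.2.
  have lN : (j < N)%N by lia.
  have tok2 : treeok N (rmem s2 rK1) (rmem s2 rK2) (imem s' aT) (fun l => l < j)%N.
    by rewrite rE.
  have W1 : (4 * N < W)%N by lia.
  apply: runs_weaken (runs_upd W1 _ NE lN s2L s2V _ s2T tok2 TN) _ _; [lia|by right|by rewrite Bd|].
  move=> s3 [TN3 T03 tok3] s4 f4; rewrite /I1 f4.1 //; split=> // [i iN|].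
    by rewrite T03 // T0.
  rewrite rE in tok3; apply: tree_eq tok3 => l _; case: eqP; lia.
- by rewrite /c leq_mul2l /= (addnAC 30) leq_add // leq_mul2l ltnS ltnS klg orbT.
move=> s2 [[TN2 T02 tok2] f2].
have s2m : imem s2 vm 0 = m by rewrite f2.1.
have s2N : imem s2 vN 0 = N by rewrite f2.1.
have K2 : rmem s2 = rmem s1 by apply/funext => a; rewrite f2.2.
pose I2 j (s' : state R) := [/\ (forall i, (imem s' aT i <= N)%N),
  (forall i, ~~ (0 < i < N.*2)%N -> imem s' aT i = 0%N),
  treeok N k1 k2 (imem s' aT) (fun l => (l < m)%N /\
     forall i, (i < j)%N -> imem s' aSO i <> l),
  (forall i, (i < j)%N -> (imem s' aSO i < m)%N /\
     forall l, (l < m)%N -> (forall i', (i' < i)%N -> imem s' aSO i' <> l) ->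
     lexle k1 k2 (imem s' aSO i) l) &
  (forall i i', (i < i' < j)%N -> imem s' aSO i <> imem s' aSO i')].
apply: runs_weaken (@runs_for _ _ vj vm sort_extract s2 (30 + (B + 100) * k.+2) m I2 s2m _ _ _ _) _ _.
- lia.
- by [].
- move=> s' f; rewrite /I2 f.1 //; split=> // [|i i']; last by rewrite ltn0 andbF.
  by apply: tree_eq tok2 => l; split=> // -[].
- move=> j s' jm sj [TN T0 tok om od] f s'm.
  have s'N : imem s' vN 0 = N by rewrite f.1.
  have [l [Tl lm lo lmin]] : exists l, [/\ imem s' aT 1 = l.+1, (l < m)%N,
      (forall i, (i < j)%N -> imem s' aSO i <> l) & forall l', (l' < m)%N ->
      (forall i, (i < j)%N -> imem s' aSO i <> l') -> lexle k1 k2 l l'].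
    have := tree_root (erefl _) tok; case: (imem s' aT 1) => [|l] /=.
      have [l lm lo] := idx_missing (imem s' aSO) jm.
      by move=> /(_ l); case; split=> //; lia.
    move=> [[[lm lo] lN] lmin]; exists l; split=> // l' l'm l'o.
    by apply: lmin; split=> //; lia.
  apply: (@runs_seq _ _ _ _ _ 30 _ (fun s3 => [/\ imem s3 tL 0 = l, imem s3 tV 0 = 0%N,
     imem s3 aT = imem s' aT, imem s3 vN = imem s' vN & rmem s3 = rmem s' /\
     imem s3 aSO = fupd (imem s' aSO) j l])).
    apply: runs_weaken (runs_wp _) _ (fun _ => id) => //=; rewrite !Tl !subn1 /= sj; wps.
    by split.
  move=> s3 [s3L s3V s3T s3N [s3r s3O]].
  have NE : imem s3 vN 0 = N by rewrite s3N.
  have rE : rmem s3 = rmem s1 by rewrite s3r -K2; apply/funext => a; rewrite f.2.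
  have lN : (l < N)%N by lia.
  have tok3 : treeok N (rmem s3 rK1) (rmem s3 rK2) (imem s' aT) (fun l => (l < m)%N /\
     forall i, (i < j)%N -> imem s' aSO i <> l).
    by rewrite rE.
  have W1 : (4 * N < W)%N by lia.
  apply: runs_weaken (runs_frame (runs_upd W1 _ NE lN s3L s3V _ s3T tok3 TN)) _ _;
    [lia|by left|by rewrite Bd|].
  move=> s4 [[TN4 T04 tok4] f4] s5 f5.
  have OE : imem s5 aSO = fupd (imem s' aSO) j l by rewrite f5.1 // f4.1.
  rewrite /I2 OE f5.1 //; split=> // [i iN||i ij|i i' ij].
  + by rewrite T04 // T0.
  + rewrite rE in tok4; apply: tree_eq tok4 => l' _; rewrite /fupd; case: eqP => l'l.
      by split=> // -[_ /(_ j (ltnSn j))]; rewrite eqxx l'l.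
    split=> -[l'm H]; split=> // i ij.
      by case: eqP => [_ /esym//|ij2]; apply: H; lia.
    by have := H i (ltnW ij); case: eqP ij => // ->; rewrite ltnn.
  + rewrite /fupd; case: eqP => [->|ij'].
      split=> // l' l'm H; apply: lmin => // i' i'j.
      by have := H _ i'j; case: eqP i'j => // ->; rewrite ltnn.
    have ij2 : (i < j)%N by lia.
    have [om1 om2] := om i ij2; split=> // l' l'm H; apply: om2 => // i' i'i.
    by have := H i' i'i; case: eqP i'i => // ->; lia.
  + rewrite /fupd; case: eqP => [e|_]; first by move: ij; lia.
    case: eqP => [_|e]; first by apply: lo; move: ij; lia.
    by apply: od; move: ij e; lia.
- by rewrite /c leq_mul2l /= (addnAC 30) leq_add // leq_mul2l ltnS ltnS klg orbT.
- move=> s3 [[TN T0 tok om od] f3].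
  have oi : forall i j, (i < m)%N -> (j < m)%N -> imem s3 aSO i = imem s3 aSO j -> i = j.
    move=> i j im jm e; case: (ltngtP i j) => // ij.
      by case: (od i j); rewrite ?ij.
    by case: (od j i); rewrite ?ij.
  split.
  - split=> // [i /om[]//|i j /andP[ij jm]].
    have [_ H] := om i (ltn_trans ij jm); apply: H => [|i' i'i]; first by case: (om j jm).
    by move=> e; have := oi i' j _ _ e; lia.
  - move=> i; case iN: (0 < i < N.*2)%N; last by rewrite T0 // iN.
    apply: tree_zero tok _ _ iN => l lN [lm H].
    by have [i' i'm] := idx_onto (fun i im => (om i im).1) oi lm; exact: H.
  - by exists k; split=> //; rewrite f3.1.
Qed.

End SortProg.

Notation "c ;; d" := (Seq c d) (at level 90, right associativity).
Notation iadd := (IBin OAdd).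
Notation isub := (IBin OSub).
Notation imul := (IBin OMul).
Notation idiv := (IBin ODiv).
Notation imod := (IBin OMod).
Notation radd := (RBin RAdd).
Notation rsub := (RBin RSub).
Notation rmul := (RBin RMul).
Notation rcst k := (RInt (ICst k)).
Notation rX := 4%N.
Notation rY := 5%N.
Notation rEW := 8%N.
Notation aAO := 14%N.
Notation aRK := 15%N.
Notation vp := 16%N.
Notation aEU := 17%N.
Notation aEV := 18%N.
Notation vne := 19%N.

(** The unit in which running times are counted. The successors make it positive for every [n], so
    that it absorbs additive constants. *)
Definition cx (n : nat) : nat := n.+1 * (lg n).+1.

(** * Cost accounting in multiples of n log n *)

Section Costs.
Variable R : realType.
Variable W : nat.
Implicit Types (s : state R) (Q : state R -> Prop).

(** Coefficients of a common unit add up. In the proofs below the total is left open by [eexists]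
    and is assembled by these rules. *)
Lemma runs_seqC c d s C1 C2 x Q1 Q : runs W c s (C1 * x) Q1 ->
  (forall s', Q1 s' -> runs W d s' (C2 * x) Q) -> runs W (c ;; d) s ((C1 + C2) * x) Q.
Proof. by rewrite mulnDl; exact: runs_seq. Qed.

Lemma cx_gt0 n : (0 < cx n)%N. Proof. by rewrite muln_gt0. Qed.

Lemma runs_const c s b n Q : runs W c s b Q -> runs W c s (b * cx n) Q.
Proof. by move=> H; apply: runs_weaken H _ _ => //; rewrite leq_pmulr // cx_gt0. Qed.

Lemma runs_wpC c s n Q : wp W c Q s -> runs W c s (ccost c * cx n) Q.
Proof. by move=> /(@runs_wp R W)/runs_const. Qed.

Lemma runs_forC x v body s B n (I : nat -> state R -> Prop) :
  imem s v 0 = n -> (n < W)%N ->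
  [&& v != x, v \notin iwrites body & x \notin iwrites body] ->
  (forall s', frame [:: x] [::] s s' -> I 0 s') ->
  (forall k s', (k < n)%N -> imem s' x 0 = k -> I k s' ->
    frame (x :: iwrites body) (rwrites body) s s' -> imem s' v 0 = n ->
    runs W body s' (B * (lg n).+1)
      (fun s'' => forall s3, frame [:: x] [::] s'' s3 -> I k.+1 s3)) ->
  runs W (For x v body) s ((B + 20) * cx n)
    (fun s' => I n s' /\ frame (x :: iwrites body) (rwrites body) s s').
Proof.
move=> vn0 nW H H0 Hs.
apply: runs_weaken (runs_for vn0 nW H H0 Hs) _ (fun _ => id).
by rewrite mulnCA leq_mul2l /= mulnDl leq_add2l leq_pmulr.
Qed.

Lemma runs_for_wp x v body s n (I : nat -> state R -> Prop) :
  imem s v 0 = n -> (n < W)%N ->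
  [&& v != x, v \notin iwrites body & x \notin iwrites body] ->
  (forall s', frame [:: x] [::] s s' -> I 0 s') ->
  (forall k s', (k < n)%N -> imem s' x 0 = k -> I k s' ->
    frame (x :: iwrites body) (rwrites body) s s' -> imem s' v 0 = n ->
    wp W body (fun s'' => forall s3, frame [:: x] [::] s'' s3 -> I k.+1 s3) s') ->
  runs W (For x v body) s ((ccost body + 20) * cx n)
    (fun s' => I n s' /\ frame (x :: iwrites body) (rwrites body) s s').
Proof.
move=> vn0 nW H H0 Hs; apply: runs_forC => // k s' kn xk Ik f vk.
apply: runs_weaken (runs_wp (Hs k s' kn xk Ik f vk)) _ (fun _ => id).
by rewrite leq_pmulr.
Qed.

End Costs.

(** * Cones as conditions on ranks *)

Section SweepMath.
Variable R : realType.
Variables (n : nat) (A B : nat -> R).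
Hypothesis ABinj : forall i j, (i < n)%N -> (j < n)%N -> A i = A j -> B i = B j -> i = j.

Definition cone p q := [/\ (p < n)%N, (q < n)%N, A p <= A q & B p < B q].

Variables (AO SO RK : nat -> nat).
Hypothesis sortA : sorted_idx A B n AO.
Hypothesis sortB : sorted_idx B (fun i => 0 - A i) n SO.
Hypothesis RKE : forall i, (i < n)%N -> RK (SO i) = i.

Lemma RKP p : (p < n)%N -> (RK p < n)%N /\ SO (RK p) = p.
Proof.
move=> pn; have [So Si _] := sortB; have [i im <-] := idx_onto So Si pn.
by rewrite RKE.
Qed.

(** The tie-breaking fits the half-open cone exactly. Among equal [A] a larger [B] comes later,
    hence is swept earlier; among equal [B] a larger [A] has the lower rank, so a point with
    [B q = B p] and [A p <= A q] never passes the strict test on ranks. *)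
Lemma sweep_cone a q : (a < n)%N -> (q < n)%N ->
  ((exists2 a', (a < a' < n)%N & AO a' = q) /\ (RK (AO a) < RK q)%N) <-> cone (AO a) q.
Proof.
move=> an qn; have [Ao Ai Al] := sortA; have [So Si Sl] := sortB.
set p := AO a; have pn : (p < n)%N by exact: Ao.
have [rp sp] := RKP pn; have [rq sq] := RKP qn.
have [b bn bq] := idx_onto Ao Ai qn.
split=> [[[a' aa' a'q] rr]|[_ _ Apq Bpq]].
  have /Al l1 : (a < a' < n)%N by [].
  have /Sl l2 : (RK p < RK q < n)%N by rewrite rr.
  rewrite sp sq in l2; rewrite a'q -/p in l1.
  split=> //; first exact: lexle1 l1.
  rewrite lt_neqAle (lexle1 l2) andbT; apply/eqP => Be.
  have /= Aqp := lexle2 l2 Be; have Ae : A p = A q.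
    by apply/eqP; rewrite eq_le (lexle1 l1); lra.
  by move: rr; rewrite (ABinj pn qn Ae Be) ltnn.
split.
  exists b => //; rewrite bn andbT; case: ltngtP => // [ba|e].
    have /Al l : (b < a < n)%N by rewrite ba.
    rewrite bq -/p in l; have Ae : A q = A p by apply/eqP; rewrite eq_le (lexle1 l).
    by have := lexle2 l Ae; rewrite leNgt Bpq.
  by move: Bpq; rewrite -bq -e ltxx.
case: ltngtP => // [rr|e].
  have /Sl l : (RK q < RK p < n)%N by rewrite rr.
  by rewrite sp sq in l; have := lexle1 l; rewrite leNgt Bpq.
by move: Bpq; rewrite -sp -sq e ltxx.
Qed.

End SweepMath.

(** * Nearest points in cones *)

Section SweepCmd.
Variables (eA eB eV : iexp -> rexp).

Definition fill_AB : cmd :=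
  RSet rK1 (ivar vi) (eA (ivar vi)) ;; RSet rK2 (ivar vi) (eB (ivar vi)).

Definition copy_AO : cmd := ISet aAO (ivar vi) (IGet aSO (ivar vi)).

Definition fill_BA : cmd :=
  RSet rK1 (ivar vi) (eB (ivar vi)) ;;
  RSet rK2 (ivar vi) (rsub (rcst 0) (eA (ivar vi))).

Definition fill_V : cmd :=
  ISet aRK (IGet aSO (ivar vi)) (ivar vi) ;;
  RSet rK1 (ivar vi) (eV (IGet aSO (ivar vi))) ;; RSet rK2 (ivar vi) (rcst 0).

(* Points enter the tree by decreasing [A], at their [B]-rank; the query after the rank
   of [p] finds the point of the cone of [p] with the least [V]. *)
Definition sweep_get : cmd :=
  iset0 vp (IGet aAO (isub (isub (ivar vn) (ICst 1)) (ivar vi))) ;;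
  iset0 tL (IGet aRK (ivar vp)).

Definition sweep_edge : cmd :=
  (If (TILe (ivar tr) (ICst 0)) Skip
     (ISet aEU (ivar vne) (ivar vp) ;;
      ISet aEV (ivar vne) (IGet aSO (isub (ivar tr) (ICst 1))) ;;
      RSet rEW (ivar vne) (rsub (RGet rK1 (isub (ivar tr) (ICst 1))) (eV (ivar vp))) ;;
      iset0 vne (iadd (ivar vne) (ICst 1)))) ;;
  iset0 tV (iadd (ivar tL) (ICst 1)).

Definition sweep_body : cmd := sweep_get ;; qryc ;; sweep_edge ;; updc.

Definition clear_body : cmd := (iset0 tL (ivar vi) ;; iset0 tV (ICst 0)) ;; updc.

Definition sweep_prep : cmd :=
  iset0 vm (ivar vn) ;; For vi vn fill_AB ;; sortc ;; For vi vn copy_AO ;;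
  For vi vn fill_BA ;; sortc ;; For vi vn fill_V.

Definition sweep : cmd :=
  sweep_prep ;; For vi vn sweep_body ;; For vi vn clear_body.

End SweepCmd.

Section SweepProg.
Variable R : realType.
Implicit Types (s : state R).

Definition world n (X Y : nat -> R) s :=
  [/\ imem s vn 0 = n, rmem s rX = X & rmem s rY = Y].

Lemma world_frame n X Y wi wr s s' : frame wi wr s s' ->
  [&& vn \notin wi, rX \notin wr & rY \notin wr] ->
  world n X Y s -> world n X Y s'.
Proof. by move=> [f g] /and3P[a b c] [? ? ?]; split; rewrite ?f ?g. Qed.

Definition evalsto W (X Y : nat -> R) (e : iexp -> rexp) (E : nat -> R) :=
  forall s i, rmem s rX = X -> rmem s rY = Y ->
    rv s (e i) = E (iv s i) /\ (iok W s i -> rok W s (e i)).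

Definition prep_post n (A B V : nat -> R) s :=
  [/\ sorted_idx A B n (imem s aAO), sorted_idx B (fun i => 0 - A i) n (imem s aSO),
      (forall i, (i < n)%N -> imem s aRK (imem s aSO i) = i) /\
      (forall i, (i < n)%N -> rmem s rK1 i = V (imem s aSO i) /\ rmem s rK2 i = 0),
      forall i, imem s aT i = 0%N &
      exists k, [/\ imem s vN 0 = 2 ^ k, n <= 2 ^ k, 2 ^ k <= 2 * n + 1 & k <= (lg n).+1]%N].

Lemma sorted_idx_eq (k1 k2 k1' k2' : nat -> R) m o :
  (forall i, (i < m)%N -> k1 i = k1' i /\ k2 i = k2' i) ->
  sorted_idx k1 k2 m o -> sorted_idx k1' k2' m o.
Proof.
move=> E [om oi ol]; split=> // i j ij; have /andP[ij1 jm] := ij.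
have im := ltn_trans ij1 jm; have := ol i j ij; rewrite /lexle.
by case: (E _ (om _ im)) => -> ->; case: (E _ (om _ jm)) => -> ->.
Qed.

Variables (eA eB eV : iexp -> rexp).

Definition sweep_ok W n X Y A B V := [/\ (2 < n)%N, (100 * n + 1000 < W)%N,
  [/\ evalsto W X Y eA A, evalsto W X Y eB B & evalsto W X Y eV V] &
  forall i j, (i < n)%N -> (j < n)%N -> A i = A j -> B i = B j -> i = j].

Lemma runs_prep : exists C, forall W n X Y A B V s, sweep_ok W n X Y A B V ->
  world n X Y s -> (forall i, imem s aT i = 0%N) ->
  runs W (sweep_prep eA eB eV) s (C * cx n) (prep_post n A B V).
Proof.
have [C Csort] := runs_sort R.
eexists => W n X Y A B V s [n2 nW [okA okB okV] ABinj] w T0.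
apply: runs_seqC.
  apply: (@runs_wpC _ _ _ _ _ (fun s1 => [/\ world n X Y s1, imem s1 vm 0 = n &
     forall i, imem s1 aT i = 0%N])).
  by case: w => wn wX wY /=; rewrite wn; wps.
move=> s1 [w1 s1m T1].
apply: runs_seqC.
  apply: (@runs_for_wp _ _ _ _ _ _ n (fun k s' => forall i, (i < k)%N ->
     rmem s' rK1 i = A i /\ rmem s' rK2 i = B i)) => //; [by case: w1|lia|].
  move=> k s' kn si I f s'n; have [w1n w1X w1Y] := world_frame f isT w1.
  have [vA kA] := okA s' (ivar vi) w1X w1Y.
  rewrite /= si; split; [lia|by apply: kA => /=; lia|].
  set s2 := State _ _; have [vB kB] := okB s2 (ivar vi) w1X w1Y.
  split; [lia|by apply: kB => /=; lia|].
  move=> s3 g i; rewrite !g.2 //= vB vA /= si ltnS leq_eqVlt.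
  by case: eqP => [->//|_] /I.
move=> s2 [K2 f2].
have w2 := world_frame f2 isT w1.
have s2m : imem s2 vm 0 = n by rewrite f2.1.
have T2 i : imem s2 aT i = 0%N by rewrite f2.1.
move=> {f2 s1m T1 w1 s1}.
apply: runs_seqC.
  by apply: runs_frame (Csort _ _ _ _ s2m T2); lia.
move=> s3 [[/(sorted_idx_eq K2) So T3 _] f3].
have w3 := world_frame f3 isT w2.
have s3m : imem s3 vm 0 = n by rewrite f3.1.
move=> {f3 s2m T2 K2 w2 s2}.
apply: runs_seqC.
  apply: (@runs_for_wp _ _ _ _ _ _ n (fun k s' => forall i, (i < k)%N ->
     imem s' aAO i = imem s3 aSO i)) => //; [by case: w3|lia|].
  move=> k s' kn si I f s'n; rewrite /= si; wps.
  move=> s4 g i; rewrite !g.1 //= ltnS leq_eqVlt f.1 //.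
  by case: eqP => [->//|_] /I.
move=> s4 [AOE f4].
have w4 := world_frame f4 isT w3.
have s4m : imem s4 vm 0 = n by rewrite f4.1.
have T4 i : imem s4 aT i = 0%N by rewrite f4.1.
have {AOE So} So : sorted_idx A B n (imem s4 aAO).
  case: So => So1 So2 So3; split=> [i im|i j im jm|i j ij].
  - by rewrite AOE // So1.
  - by rewrite !AOE //; exact: So2.
  - by rewrite !AOE ?So3 //; lia.
move=> {f4 w3 s3m T3 s3}.
apply: runs_seqC.
  apply: (@runs_for_wp _ _ _ _ _ _ n (fun k s' => forall i, (i < k)%N ->
     rmem s' rK1 i = B i /\ rmem s' rK2 i = 0 - A i)) => //; [by case: w4|lia|].
  move=> k s' kn si I f s'n; have [w1n w1X w1Y] := world_frame f isT w4.
  have [vB kB] := okB s' (ivar vi) w1X w1Y.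
  rewrite /= si; split; [lia|by apply: kB => /=; lia|].
  set s2 := State _ _; have [vA kA] := okA s2 (ivar vi) w1X w1Y.
  split; [lia|split; [lia|by apply: kA => /=; lia]|].
  move=> s3 g i; rewrite !g.2 //= vB vA /= si ltnS leq_eqVlt.
  by case: eqP => [->//|_] /I.
move=> s5 [K5 f5].
have w5 := world_frame f5 isT w4.
have s5m : imem s5 vm 0 = n by rewrite f5.1.
have T5 i : imem s5 aT i = 0%N by rewrite f5.1.
rewrite -[imem s4 aAO](f5.1 aAO isT) in So.
move=> {f5 s4m T4 w4 s4}.
apply: runs_seqC.
  by apply: runs_frame (Csort _ _ _ _ s5m T5); lia.
move=> s6 [[/(sorted_idx_eq K5) So' T6 kE] f6].
have w6 := world_frame f6 isT w5.
rewrite -[imem s5 aAO](f6.1 aAO isT) in So.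
have [So1 So2 _] := So'.
apply: runs_weaken (@runs_for_wp _ _ _ _ _ _ n (fun k s' => forall i, (i < k)%N ->
    imem s' aRK (imem s6 aSO i) = i /\ rmem s' rK1 i = V (imem s6 aSO i) /\
    rmem s' rK2 i = 0) _ _ _ _ _) (leqnn _) _ => //; [by case: w6|lia| |].
  move=> k s' kn si I f s'n; have [w1n w1X w1Y] := world_frame f isT w6.
  rewrite /= si; wps.
    set s2 := State _ _; have [vV kV] := okV s2 (IGet aSO (ivar vi)) w1X w1Y.
    by apply: kV => /=; lia.
  move=> s3 g i; rewrite !g.1 // !g.2 //=.
  set s2 := State _ _; have [-> _] := okV s2 (IGet aSO (ivar vi)) w1X w1Y.
  rewrite ltnS {}/s2 /= si !(f.1 aSO isT) leq_eqVlt.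
  case: eqP => [->//|_] /=; first by rewrite eqxx.
  move=> ik; case: eqP => [e|_]; last exact: I.
  by have := So2 i k (ltn_trans ik kn) kn e; lia.
move=> s7 [K7 f7]; rewrite /prep_post (f7.1 aSO isT) (f7.1 aAO isT) (f7.1 aT isT) (f7.1 vN isT).
by split=> //; split=> i /K7[? []].
Qed.

End SweepProg.

Section SweepLoop.
Variable R : realType.
Implicit Types (s : state R).

(** Here [s0] is the state before the sweep, whose edges have to survive, and [d] describes the
    points already treated. *)
Definition edges_from n (A B V : nat -> R) s0 (d : nat -> Prop) s :=
  [/\ (imem s0 vne 0 <= imem s vne 0)%N,
      forall j, (j < imem s0 vne 0)%N -> [/\ imem s aEU j = imem s0 aEU j,
        imem s aEV j = imem s0 aEV j & rmem s rEW j = rmem s0 rEW j],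
      forall j, (imem s0 vne 0 <= j < imem s vne 0)%N ->
        cone n A B (imem s aEU j) (imem s aEV j) /\
        rmem s rEW j = V (imem s aEV j) - V (imem s aEU j) &
      forall p q, d p -> cone n A B p q ->
        exists2 j, (imem s0 vne 0 <= j < imem s vne 0)%N &
        imem s aEU j = p /\ V (imem s aEV j) <= V q].

Lemma edges_from_eq n A B V s0 (d : nat -> Prop) s s' :
  imem s' vne = imem s vne -> imem s' aEU = imem s aEU ->
  imem s' aEV = imem s aEV -> rmem s' rEW = rmem s rEW ->
  edges_from n A B V s0 d s -> edges_from n A B V s0 d s'.
Proof. by rewrite /edges_from => -> -> -> ->. Qed.

Lemma edges_from_none n A B V s0 (d : nat -> Prop) s p0 :
  (forall q, ~ cone n A B p0 q) ->
  edges_from n A B V s0 d s -> edges_from n A B V s0 (fun p => d p \/ p = p0) s.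
Proof.
move=> no [e1 e2 e3 e4]; split=> // p q [dp|->]; [exact: e4|by move/no].
Qed.

Lemma edges_from_add n A B V s0 (d : nat -> Prop) s s' p0 q0 :
  cone n A B p0 q0 -> (forall q, cone n A B p0 q -> V q0 <= V q) ->
  imem s' vne 0 = (imem s vne 0).+1 ->
  imem s' aEU = fupd (imem s aEU) (imem s vne 0) p0 ->
  imem s' aEV = fupd (imem s aEV) (imem s vne 0) q0 ->
  (forall j, rmem s' rEW j = if j == imem s vne 0 then V q0 - V p0 else rmem s rEW j) ->
  edges_from n A B V s0 d s -> edges_from n A B V s0 (fun p => d p \/ p = p0) s'.
Proof.
move=> c0 cmin ne eu ev ew [e1 e2 e3 e4]; rewrite /edges_from ne eu ev.
split=> [|j je|j je|p q dp c].
- exact: leqW.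
- rewrite /fupd ew; have -> : (j == imem s vne 0) = false by apply/eqP; lia.
  exact: e2.
- rewrite /fupd ew; case: eqP => [_|je'] //; apply: e3; lia.
have old : d p -> exists2 j, (imem s0 vne 0 <= j < (imem s vne 0).+1)%N &
    fupd (imem s aEU) (imem s vne 0) p0 j = p /\
    V (fupd (imem s aEV) (imem s vne 0) q0 j) <= V q.
  move=> dp'; have [j je [ju jv]] := e4 p q dp' c.
  exists j; first lia.
  by rewrite /fupd; have -> : (j == imem s vne 0) = false by apply/eqP; lia.
case: dp => [/old //|pp]; exists (imem s vne 0); first lia.
by rewrite /fupd !eqxx pp; split=> //; apply: cmin; rewrite -pp.
Qed.

Variables (eA eB eV : iexp -> rexp).

Lemma runs_sweep_loop : exists C, forall W n X Y A B V s,
  @sweep_ok R eA eB eV W n X Y A B V -> world n X Y s -> prep_post n A B V s ->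
  (imem s vne 0 <= 3 * n)%N ->
  runs W (For vi vn (sweep_body eV)) s (C * cx n) (fun s' =>
    [/\ edges_from n A B V s (fun p => (p < n)%N) s',
        (imem s' vne 0 <= imem s vne 0 + n)%N,
        forall i, (imem s' aT i <= imem s vN 0)%N,
        (forall i, ~~ (0 < i < (imem s vN 0).*2)%N -> imem s' aT i = 0%N) &
        exists2 act : nat -> Prop, treeok (imem s vN 0) (rmem s rK1) (rmem s rK2) (imem s' aT) act &
          forall l, act l -> (l < n)%N]).
Proof.
eexists => W n X Y A B V s [n2 nW [okA okB okV] ABinj] w.
move=> [sA sB [RKE KE] T0 [k [sN nk kn klg]]] ne3.
have [Bq Bd] : exists b, b = ccost bestc by eexists.
set N := imem s vN 0 in sN *; rewrite -sN in nk kn.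
set AO := imem s aAO; set SO := imem s aSO; set RK := imem s aRK.
have [So Si _] := sB; have [Ao _ _] := sA.
have [wn wX wY] := w.
have RKP' p : (p < n)%N -> (RK p < n)%N /\ SO (RK p) = p := RKP sB RKE (p := p).
(* The active leaves are the [B]-ranks of the points treated before step [i]; [AO] is traversed
   backwards, by decreasing [A]. *)
pose act i l := exists2 i', (i' < i)%N & RK (AO (n - 1 - i'))%N = l.
pose I i s' := [/\ edges_from n A B V s
     (fun p => exists2 i', (i' < i)%N & AO (n - 1 - i')%N = p) s',
   (imem s' vne 0 <= imem s vne 0 + i)%N,
   forall l, (imem s' aT l <= N)%N,
   (forall l, ~~ (0 < l < N.*2)%N -> imem s' aT l = 0%N) &
   treeok N (rmem s rK1) (rmem s rK2) (imem s' aT) (act i)].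
apply: runs_weaken (@runs_forC _ _ vi vn (sweep_body eV) s
  (5 * ccost bestc + 1000 + ccost (sweep_edge eV)) n I _ _ _ _ _) (leqnn _) _ => //.
- lia.
- move=> s' f; rewrite /I (f.1 aT isT) (f.1 vne isT); split=> //; rewrite ?addn0 //.
  + apply: edges_from_eq (f.1 vne isT) (f.1 aEU isT) (f.1 aEV isT) (f.2 rEW isT) _.
    split=> // [j|p q [i']]; lia.
  + by move=> l; rewrite T0.
  + by apply: tree_empty => // l _ [i']; lia.
- move=> i s1 im si [E1 ne1 T1 T01 tok1] f1 s1n.
  have w1 := world_frame f1 isT w.
  set p := AO (n - 1 - i)%N.
  have pn : (p < n)%N by apply: Ao; lia.
  have [rp sp] := RKP' p pn.
  apply: (@runs_weaken _ _ _ _ (ccost sweep_get +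
     ((ccost bestc + 100) * k.+3 + (ccost (sweep_edge eV) + (ccost bestc + 100) * k.+2)))).
  2: by rewrite /sweep_get /=; nia.
  2: by move=> s' H; exact: H.
  have aE : imem s1 aAO = AO by rewrite f1.1.
  have rE : imem s1 aRK = RK by rewrite f1.1.
  have NE1 : imem s1 vN 0 = (2 ^ k)%N by rewrite f1.1.
  apply: runs_seq.
    apply: runs_frame (@runs_wp _ _ _ _ (fun s2 => imem s2 vp 0 = p /\ imem s2 tL 0 = RK p) _).
    by rewrite /= !s1n !si !aE !rE -/p; wps; split.
  move=> s2 [[s2p s2L] f2].
  have KE2 : rmem s2 = rmem s1 by apply/funext => a; rewrite f2.2.
  have KEs a : a != rEW -> rmem s1 a = rmem s a by move=> ha; rewrite f1.2 // inE.
  rewrite -(f2.1 aT isT) in T1 T01 tok1.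
  have tok2 : treeok (2 ^ k) (rmem s2 rK1) (rmem s2 rK2) (imem s2 aT) (act i).
    by rewrite KE2 !KEs // -sN.
  apply: runs_seq.
    apply: runs_frame (@runs_qry _ _ s2 k (act i) (RK p) _ _ _ _ s2L tok2 _).
    - lia.
    - lia.
    - by rewrite f2.1.
    - lia.
    - by rewrite -sN.
  move=> s3 [best3 f3].
  have w2 := world_frame f2 isT w1; have w3 := world_frame f3 isT w2.
  have K2E : rmem s2 rK1 = rmem s rK1 /\ rmem s2 rK2 = rmem s rK2.
    by rewrite KE2 !KEs.
  have bestE : isbest (rmem s rK1) (rmem s rK2) (fun l => [/\ (l < n)%N, cone n A B p (SO l) & act i l])
      (imem s3 tr 0).
    case: K2E best3 => -> ->; apply: isbest_eq => l; rewrite -sN; split.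
      move=> [[i' ii' AOl] /andP[rl lN]].
      have qn : (AO (n - 1 - i') < n)%N by apply: Ao; lia.
      have [rq sq] := RKP' _ qn; rewrite AOl in rq sq.
      split=> //; last by exists i'.
      rewrite sq; apply/(sweep_cone ABinj sA sB RKE) => //; first lia.
      split; last by rewrite -/RK -/p -/AO AOl.
      by exists (n - 1 - i')%N => //; lia.
    move=> [ln c al]; split=> //; move: c; have qn : (SO l < n)%N by exact: So.
    move=> /(sweep_cone ABinj sA sB RKE) []; [lia|by []|].
    move=> _; rewrite RKE // -/RK -/AO -/p => rl.
    lia.
  have conel q : cone n A B p q -> [/\ (RK q < n)%N, SO (RK q) = q & act i (RK q)].
    move=> c; have [_ qn _ _] := c; have [rq sq] := RKP' _ qn; split=> //.
    move: c => /(sweep_cone ABinj sA sB RKE) []; [lia|by []|].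
    move=> [a' aa' <-] _; exists (n - 1 - a')%N; first lia.
    by congr (RK (AO _)); lia.
  have trN : (imem s3 tr 0 <= n)%N.
    by case: (imem s3 tr 0) bestE => // l [[]].
  have E3 : edges_from n A B V s (fun p => exists2 i', (i' < i)%N & AO (n - 1 - i')%N = p) s3.
    by apply: edges_from_eq E1; rewrite ?f3.1 ?f2.1 ?f3.2 ?f2.2.
  apply: runs_seq.
    apply: runs_frame (@runs_wp _ _ _ _ (fun s4 =>
      [/\ edges_from n A B V s (fun q => (exists2 i', (i' < i)%N & AO (n - 1 - i')%N = q) \/ q = p) s4,
       (imem s4 vne 0 <= imem s vne 0 + i.+1)%N & imem s4 tV 0 = (RK p).+1]) _).
    have s3p : imem s3 vp 0 = p by rewrite f3.1.
    have s3L : imem s3 tL 0 = RK p by rewrite f3.1.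
    have s3e : imem s3 vne = imem s1 vne by rewrite f3.1 // f2.1.
    have s3S : imem s3 aSO = SO by rewrite f3.1 // f2.1 // f1.1.
    have s3K : rmem s3 rK1 = rmem s rK1 by rewrite f3.2 //; case: K2E.
    have [_ w3X w3Y] := w3.
    case tr0: (imem s3 tr 0) bestE => [|l] /=.
      rewrite !tr0 /= => no; wps; rewrite /= ?s3L ?s3e //; try lia.
      apply: (@edges_from_eq _ _ _ _ _ _ s3) => //.
      by apply: edges_from_none => // q c; have [rq sq aq] := conel q c;
        apply: (no (RK q)); split=> //; rewrite sq.
    rewrite !tr0 /= => -[[ln cl _] lmin]; rewrite !s3e !subSS !subn0.
    set s4 := State _ _; have [s4V ok4] := okV s4 (ivar vp) w3X w3Y.
    wps; [by apply: ok4; rewrite /=; lia| |]; rewrite /= ?s3L ?s3e //; try lia.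
    have KEl l' : (l' < n)%N -> rmem s rK1 l' = V (SO l') by move=> /KE[].
    apply: edges_from_add E3; first exact: cl.
    - move=> q c; have [rq sq aq] := conel q c.
      rewrite -sq -!KEl //; apply: lexle1 (lmin (RK q) _).
      by split=> //; rewrite sq.
    - by rewrite /= s3e addn1.
    - by rewrite /= s3e s3p.
    - by rewrite /= s3e s3S.
    - by move=> j; rewrite /= s3e s4V /= s3p s3K KEl.
  move=> s4 [[E4 ne4 s4V] f4].
  have KE4 a : a != rEW -> rmem s4 a = rmem s a.
    by move=> ha; rewrite f4.2 ?inE // f3.2 // KE2 KEs.
  have T4 : imem s4 aT = imem s2 aT by rewrite f4.1 // f3.1.
  have s4L : imem s4 tL 0 = RK p by rewrite f4.1 // f3.1.
  have tok4 : treeok (2 ^ k) (rmem s4 rK1) (rmem s4 rK2) (imem s2 aT) (act i).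
    by rewrite !KE4 // -sN.
  apply: runs_weaken (runs_frame (@runs_upd _ _ s4 k (imem s2 aT) (act i) (RK p)
     (RK p).+1 _ _ _ _ s4L s4V (or_intror erefl) T4 tok4 _)) (leqnn _) _.
  - lia.
  - lia.
  - by rewrite f4.1 // f3.1 // f2.1.
  - lia.
  - by rewrite -sN.
  move=> s5 [[T5 T05 tok5] f5] s6 f6; rewrite /I (f6.1 aT isT) (f6.1 vne isT).
  rewrite (f5.1 vne isT) sN; split=> //.
  + apply: edges_from_eq (f6.1 vne isT) (f6.1 aEU isT) (f6.1 aEV isT) (f6.2 rEW isT) _.
    apply: edges_from_eq (f5.1 vne isT) (f5.1 aEU isT) (f5.1 aEV isT) (f5.2 rEW isT) _.
    case: E4 => e1 e2 e3 e4; split=> // p' q [i' ii' pE]; apply: e4.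
    move: ii'; rewrite ltnS leq_eqVlt => /orP[/eqP e|ii']; last by left; exists i'.
    by right; rewrite -pE e.
  + by move=> l lN; rewrite T05 // T01 // sN.
  + rewrite !KE4 // in tok5; apply: tree_eq tok5 => l _; case: eqP => [->|ne].
      by split=> // _; exists i.
    split=> -[i' ii' e]; first by exists i' => //; lia.
    exists i' => //; move: ii'; rewrite ltnS leq_eqVlt => /orP[/eqP e'|//].
    by case: ne; rewrite -e e'.
move=> s' [[E ne T1 T01 tok] f]; split=> //; last first.
  exists (act n) => // l [i' i'n <-].
  by apply: (RKP' _ _).1; apply: Ao; lia.
case: E => e1 e2 e3 e4; split=> // p q pn; apply: e4.
have [Ao1 Ao2 _] := sA; have [a an <-] := idx_onto Ao1 Ao2 pn.
exists (n - 1 - a)%N; first lia.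
by congr AO; lia.
Qed.

Lemma runs_clear W n s (k1 k2 : nat -> R) N act k : (2 < n)%N -> (100 * n + 1000 < W)%N ->
  imem s vn 0 = n -> imem s vN 0 = N -> N = (2 ^ k)%N -> (n <= N)%N ->
  (N <= 2 * n + 1)%N -> (k <= (lg n).+1)%N ->
  rmem s rK1 = k1 -> rmem s rK2 = k2 ->
  (forall i, (imem s aT i <= N)%N) ->
  (forall i, ~~ (0 < i < N.*2)%N -> imem s aT i = 0%N) ->
  treeok N k1 k2 (imem s aT) act -> (forall l, act l -> (l < n)%N) ->
  runs W (For vi vn clear_body) s ((5 * ccost bestc + 1020) * cx n)
    (fun s' => forall i, imem s' aT i = 0%N).
Proof.
move=> n2 nW sn sN Nk nN Nn klg sk1 sk2 T1 T0 tok actn.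
pose I j s' := [/\ (forall i, (imem s' aT i <= N)%N),
  (forall i, ~~ (0 < i < N.*2)%N -> imem s' aT i = 0%N) &
  treeok N k1 k2 (imem s' aT) (fun l => act l /\ (j <= l)%N)].
apply: runs_weaken (@runs_forC _ _ vi vn clear_body s (5 * ccost bestc + 1000) n I sn _ _ _ _) _ _.
- lia.
- by [].
- move=> s' f; rewrite /I (f.1 aT isT); split=> //.
  by apply: tree_eq tok => l; split=> // -[].
- move=> j s1 jn sj [T1' T0' tok'] f1 s1n.
  apply: (@runs_weaken _ _ _ _ (ccost (iset0 tL (ivar vi) ;; iset0 tV (ICst 0)) +
     (ccost bestc + 100) * k.+2)); last first.
  + by move=> s' H; exact: H.
  + by rewrite /=; nia.
  apply: runs_seq.
    apply: runs_frame (@runs_wp _ _ _ _ (fun s2 => imem s2 tL 0 = j /\ imem s2 tV 0 = 0%N) _).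
    by rewrite /= sj; wps.
  move=> s2 [[s2L s2V] f2].
  have tok2 : treeok (2 ^ k) (rmem s2 rK1) (rmem s2 rK2) (imem s1 aT)
      (fun l => act l /\ (j <= l)%N).
    by rewrite !f2.2 // !f1.2 // sk1 sk2 -Nk.
  apply: runs_weaken (runs_frame (@runs_upd _ _ s2 k (imem s1 aT) _ j
     0 _ _ _ _ s2L s2V (or_introl erefl) (f2.1 aT isT) tok2 _)) (leqnn _) _.
  + lia.
  + lia.
  + by rewrite f2.1 // f1.1 // sN.
  + lia.
  + by rewrite -Nk.
  move=> s3 [[T3 T03 tok3] f3] s4 f4; rewrite -Nk in T3 T03 tok3.
  rewrite /I (f4.1 aT isT); split=> //.
    by move=> l lN; rewrite T03 // T0'.
  rewrite !f2.2 // !f1.2 // sk1 sk2 in tok3.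
  apply: tree_eq tok3 => l _; case: eqP => [->|ne]; first by split=> // -[_]; lia.
  by split=> -[al jl]; split=> //; lia.
- by rewrite leq_mul2r; apply/orP; right; lia.
move=> s' [[T1' T0' tok'] f] i; case iN: (0 < i < N.*2)%N; last by rewrite T0' // iN.
by apply: tree_zero tok' _ _ iN => l lN [/actn]; lia.
Qed.

Definition sweep_post n (A B V : nat -> R) s s' :=
  [/\ edges_from n A B V s (fun p => (p < n)%N) s',
      (imem s' vne 0 <= imem s vne 0 + n)%N & forall i, imem s' aT i = 0%N].

Lemma edges_from_start n A B V s0 s1 (d : nat -> Prop) s :
  imem s1 vne = imem s0 vne -> imem s1 aEU = imem s0 aEU ->
  imem s1 aEV = imem s0 aEV -> rmem s1 rEW = rmem s0 rEW ->
  edges_from n A B V s1 d s -> edges_from n A B V s0 d s.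
Proof. by rewrite /edges_from => -> -> -> ->. Qed.

Lemma runs_sweep : exists C, forall W n X Y A B V s,
  @sweep_ok R eA eB eV W n X Y A B V -> world n X Y s ->
  (forall i, imem s aT i = 0%N) -> (imem s vne 0 <= 3 * n)%N ->
  runs W (sweep eA eB eV) s (C * cx n) (sweep_post n A B V s).
Proof.
have [C1 H1] := runs_prep R eA eB eV; have [C2 H2] := runs_sweep_loop.
eexists => W n X Y A B V s ok w T0 ne3; have [n2 nW _ _] := ok.
apply: runs_seqC; first exact: runs_frame (H1 _ _ _ _ _ _ _ _ ok w T0).
move=> s1 [pp f1]; have w1 := world_frame f1 isT w.
have ne1 : (imem s1 vne 0 <= 3 * n)%N by rewrite f1.1.
apply: runs_seqC; first exact: runs_frame (H2 _ _ _ _ _ _ _ _ ok w1 pp ne1).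
move=> s2 [[E2 ne2 T2 T02 [act tok actn]] f2]; have [wn _ _] := world_frame f2 isT w1.
case: pp => _ _ _ _ [k [s1N nN Nn klg]].
have s2N : imem s2 vN 0 = imem s1 vN 0 by rewrite f2.1.
apply: runs_weaken (runs_frame (@runs_clear W n s2 _ _ _ _ k n2 nW wn s2N s1N _ _ klg
  (f2.2 rK1 isT) (f2.2 rK2 isT) T2 T02 tok actn)) (leqnn _) _.
- by rewrite s1N.
- by rewrite s1N.
move=> s3 [T3 f3]; split=> //.
- apply: edges_from_eq (f3.1 vne isT) (f3.1 aEU isT) (f3.1 aEV isT) (f3.2 rEW isT) _.
  exact: edges_from_start (f1.1 vne isT) (f1.1 aEU isT) (f1.1 aEV isT) (f1.2 rEW isT) E2.
- by rewrite (f3.1 vne isT) -(f1.1 vne isT).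
Qed.

End SweepLoop.

(** * Octants and the candidate edges *)

Section Octants.
Variable R : realType.
Variables (n : nat) (X Y : nat -> R).

Definition dist1 (a b : nat) : R := `|X a - X b| + `|Y a - Y b|.

(* Four octants, the other four being their opposites: [q] is in octant [k] of [p] if
   [octA k p <= octA k q] and [octB k p < octB k q], and there the L1 distance from [p] to [q]
   is [octV k q - octV k p]. *)
Definition octA (k : nat) (i : nat) : R :=
  nth 0 [:: X i; X i - Y i; 0 - Y i - X i; 0 - Y i] k.
Definition octB (k : nat) (i : nat) : R :=
  nth 0 [:: Y i - X i; Y i; X i; X i + Y i] k.
Definition octV (k : nat) (i : nat) : R :=
  nth 0 [:: X i + Y i; X i + Y i; X i - Y i; X i - Y i] k.
Definition oct k := cone n (octA k) (octB k).

Ltac norms := repeat match goal with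
  | |- context [ `| ?x | ] => case: (ger0P x) => ?
  end.

(** An octant has an opening of 45 degrees: of two points in it, the one not farther from the apex
    is nearer to the other point than the apex is. This is why one edge per point and octant
    suffices. *)
Lemma oct_near k p q r : (k < 4)%N -> oct k p q -> oct k p r ->
  octV k r <= octV k q ->
  [/\ dist1 p r = octV k r - octV k p, dist1 p r <= dist1 p q & dist1 r q < dist1 p q].
Proof.
rewrite /oct /dist1; case: k => [|[|[|[|//]]]] _ [_ _ a1 b1] [_ _ a2 b2] v;
  rewrite /octA /octB /octV /= in a1 b1 a2 b2 v *; split; norms; lra.
Qed.

Ltac oct_try k := exists k => //; first
  [by left; split => //; rewrite /octA /octB /=; lra
  |by right; split => //; rewrite /octA /octB /=; lra].

Lemma octP p q : (p < n)%N -> (q < n)%N -> (X p, Y p) <> (X q, Y q) ->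
  exists2 k, (k < 4)%N & oct k p q \/ oct k q p.
Proof.
move=> pn qn ne.
have [hx|hx|hx] := ltgtP (X p) (X q); have [hy|hy|hy] := ltgtP (Y p) (Y q);
  try (by case: ne; rewrite hx hy); clear ne;
  have [h1|h1|h1] := ltgtP (Y q - Y p) (X q - X p);
  have [h2|h2|h2] := ltgtP (Y q - Y p) (X p - X q);
  first [exfalso; lra|oct_try 0%N|oct_try 1%N|oct_try 2%N|oct_try 3%N].
Qed.

Lemma d1C a b : dist1 a b = dist1 b a.
Proof. by rewrite /dist1 distrC [X in _ + X]distrC. Qed.

End Octants.

Section Bottleneck.
Variable R : realType.
Variables (n : nat) (X Y : nat -> R).

Local Notation d1 := (dist1 X Y).
Local Notation octA := (octA X Y).
Local Notation octB := (octB X Y).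
Local Notation octV := (octV X Y).
Local Notation oct := (oct n X Y).

(** Distances are reals, so induction on them goes through the number of strictly shorter pairs. *)
Definition rank (v : R) : nat :=
  #|[set c : 'I_n * 'I_n | d1 c.1 c.2 < v]|.

Lemma rank_lt a b v : (a < n)%N -> (b < n)%N -> d1 a b < v -> (rank (d1 a b) < rank v)%N.
Proof.
move=> an bn h; apply: proper_card; apply/fintype.properP; split.
  by apply/fintype.subsetP => c; rewrite !inE => /lt_trans; exact.
by exists (Ordinal an, Ordinal bn); rewrite !inE /= ?ltxx.
Qed.

Hypothesis dst : forall i j, (i < n)%N -> (j < n)%N -> X i = X j -> Y i = Y j -> i = j.

(* Second clause: the candidate edges of weight at most [t] connect all pairs of points at L1
   distance at most [t], which is what Kruskal's algorithm needs to ignore all other pairs. *)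
Definition edges_ok m (U V : nat -> nat) (w : nat -> R) :=
  (forall j, (j < m)%N -> [/\ (U j < n)%N, (V j < n)%N, U j <> V j & w j = d1 (U j) (V j)]) /\
  forall t (g : nat -> nat), (forall j, (j < m)%N -> w j <= t -> g (U j) = g (V j)) ->
    forall a b, (a < n)%N -> (b < n)%N -> d1 a b <= t -> g a = g b.

(** Induction on the length of [a b]. The candidate edge from the apex [p] to the nearest point [r]
    of the octant of [q] is no longer than [p q], and [r q] is strictly shorter than [p q], so it is
    connected by induction. *)
Lemma bottleneck m U V w :
  (forall j, (j < m)%N -> exists2 k, (k < 4)%N & oct k (U j) (V j) /\
     w j = octV k (V j) - octV k (U j)) ->
  (forall k p q, (k < 4)%N -> oct k p q -> exists2 j, (j < m)%N &
     [/\ U j = p, oct k p (V j) & octV k (V j) <= octV k q]) ->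
  edges_ok m U V w.
Proof.
move=> Hw Hn.
have wE j : (j < m)%N -> [/\ (U j < n)%N, (V j < n)%N, U j <> V j & w j = d1 (U j) (V j)].
  move=> /Hw[k k4 [o ->]]; have [-> _ _] := oct_near k4 o o (lexx _).
  have [un vn0 _ b] := o; split=> // e.
  by rewrite e ltxx in b.
split=> // t g gE a b; have [r rab] := ubnP (rank (d1 a b)).
elim: r a b rab => [|r IH] a b rab an bn dt; first by [].
have step k p q : (k < 4)%N -> oct k p q -> d1 p q = d1 a b -> g p = g q.
  move=> k4 o dE; have [j jm [jp oj vj]] := Hn k p q k4 o.
  have [e1 e2 e3] := oct_near k4 o oj vj; rewrite dE in e2 e3.
  have [un vn0 _ wj] := wE j jm; have [_ qn _ _] := o.
  rewrite -jp gE ?wj ?jp //; last exact: le_trans dt.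
  apply: IH => //; last by rewrite (le_trans (ltW e3)).
  by apply: leq_trans (rank_lt vn0 qn e3) _; rewrite -ltnS.
have [->//|ab] := eqVneq a b.
have [|k k4 [o|o]] := @octP R n X Y a b an bn.
- by case=> eX eY; case/eqP: ab; apply: dst.
- exact: step k4 o _.
- by apply/esym; apply: step k4 o _; exact: d1C.
Qed.

End Bottleneck.

Notation ex i := (RGet rX i).
Notation ey i := (RGet rY i).

Definition all_sweeps : cmd :=
  sweep (fun i => ex i) (fun i => rsub (ey i) (ex i)) (fun i => radd (ex i) (ey i)) ;;
  sweep (fun i => rsub (ex i) (ey i)) (fun i => ey i) (fun i => radd (ex i) (ey i)) ;;
  sweep (fun i => rsub (rsub (rcst 0) (ey i)) (ex i)) (fun i => ex i)
        (fun i => rsub (ex i) (ey i)) ;;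
  sweep (fun i => rsub (rcst 0) (ey i)) (fun i => radd (ex i) (ey i))
        (fun i => rsub (ex i) (ey i)).

Section AllSweeps.
Variable R : realType.

Lemma sweeps_bottleneck n (X Y : nat -> R) s0 s1 s2 s3 s4 :
  (forall i j, (i < n)%N -> (j < n)%N -> X i = X j -> Y i = Y j -> i = j) ->
  imem s0 vne 0 = 0%N ->
  edges_from n (octA X Y 0) (octB X Y 0) (octV X Y 0) s0 (fun p => (p < n)%N) s1 ->
  edges_from n (octA X Y 1) (octB X Y 1) (octV X Y 1) s1 (fun p => (p < n)%N) s2 ->
  edges_from n (octA X Y 2) (octB X Y 2) (octV X Y 2) s2 (fun p => (p < n)%N) s3 ->
  edges_from n (octA X Y 3) (octB X Y 3) (octV X Y 3) s3 (fun p => (p < n)%N) s4 ->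
  edges_ok n X Y (imem s4 vne 0) (imem s4 aEU) (imem s4 aEV) (rmem s4 rEW).
Proof.
move=> dst z [a1 a2 a3 a4] [b1 b2 b3 b4] [c1 c2 c3 c4] [e1 e2 e3 e4].
have c2' j : (j < imem s2 vne 0)%N -> [/\ imem s4 aEU j = imem s2 aEU j,
    imem s4 aEV j = imem s2 aEV j & rmem s4 rEW j = rmem s2 rEW j].
  move=> js; have [-> -> ->] := e2 j (leq_trans js c1); exact: c2.
have b2' j : (j < imem s1 vne 0)%N -> [/\ imem s4 aEU j = imem s1 aEU j,
    imem s4 aEV j = imem s1 aEV j & rmem s4 rEW j = rmem s1 rEW j].
  move=> js; have [-> -> ->] := c2' j (leq_trans js b1); exact: b2.
apply: bottleneck => // [j jm|k p q].
  have [j1|j1] := ltnP j (imem s1 vne 0).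
    have [-> -> ->] := b2' j j1; exists 0%N => //.
    by apply: a3; rewrite z.
  have [j2|j2] := ltnP j (imem s2 vne 0).
    by have [-> -> ->] := c2' j j2; exists 1%N => //; apply: b3; rewrite j1.
  have [j3|j3] := ltnP j (imem s3 vne 0).
    by have [-> -> ->] := e2 j j3; exists 2%N => //; apply: c3; rewrite j2.
  by exists 3%N => //; apply: e3; rewrite j3.
case: k => [|[|[|[|//]]]] _ o; have [pn _ _ _] := o.
- have [j /andP[_ jm] [jp vj]] := a4 p q pn o; have [eu ev _] := b2' j jm.
  exists j; first exact: leq_trans jm (leq_trans b1 (leq_trans c1 e1)).
  by rewrite eu ev jp; split=> //; rewrite /oct -jp; apply: (a3 j _).1; rewrite z.
- have [j /andP[j0 jm] [jp vj]] := b4 p q pn o; have [eu ev _] := c2' j jm.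
  exists j; first exact: leq_trans jm (leq_trans c1 e1).
  by rewrite eu ev jp; split=> //; rewrite /oct -jp; apply: (b3 j _).1; rewrite j0.
- have [j /andP[j0 jm] [jp vj]] := c4 p q pn o; have [eu ev _] := e2 j jm.
  exists j; first exact: leq_trans jm e1.
  by rewrite eu ev jp; split=> //; rewrite /oct -jp; apply: (c3 j _).1; rewrite j0.
- have [j /andP[j0 jm] [jp vj]] := e4 p q pn o.
  exists j => //.
  by rewrite jp; split=> //; rewrite /oct -jp; apply: (e3 j _).1; rewrite j0.
Qed.

Lemma runs_all_sweeps : exists C, forall W n (X Y : nat -> R) s,
  (2 < n)%N -> (100 * n + 1000 < W)%N ->
  (forall i j, (i < n)%N -> (j < n)%N -> X i = X j -> Y i = Y j -> i = j) ->
  world n X Y s -> (forall i, imem s aT i = 0%N) -> imem s vne 0 = 0%N ->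
  runs W all_sweeps s (C * cx n) (fun s' =>
    [/\ edges_ok n X Y (imem s' vne 0) (imem s' aEU) (imem s' aEV) (rmem s' rEW),
        (imem s' vne 0 <= 4 * n)%N & forall i, imem s' aT i = 0%N]).
Proof.
have [C1 H1] := runs_sweep R (fun i => ex i) (fun i => rsub (ey i) (ex i))
   (fun i => radd (ex i) (ey i)).
have [C2 H2] := runs_sweep R (fun i => rsub (ex i) (ey i)) (fun i => ey i)
   (fun i => radd (ex i) (ey i)).
have [C3 H3] := runs_sweep R (fun i => rsub (rsub (rcst 0) (ey i)) (ex i)) (fun i => ex i)
   (fun i => rsub (ex i) (ey i)).
have [C4 H4] := runs_sweep R (fun i => rsub (rcst 0) (ey i)) (fun i => radd (ex i) (ey i))
   (fun i => rsub (ex i) (ey i)).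
eexists => W n X Y s n2 nW dst w T0 z.
have W0 : (0 < W)%N by lia.
apply: runs_seqC.
  apply: runs_frame (H1 W n X Y (octA X Y 0) (octB X Y 0) (octV X Y 0) s _ w T0 _).
    split=> //; first by split=> s' i hX hY /=; rewrite ?hX ?hY; split=> // ?; do ?split.
    by move=> i j im jm; rewrite /octA /octB /= => e1 e2; apply: dst => //; lra.
  by rewrite z.
move=> s1 [[E1 n1 T1] f1]; have w1 := world_frame f1 isT w.
apply: runs_seqC.
  apply: runs_frame (H2 W n X Y (octA X Y 1) (octB X Y 1) (octV X Y 1) s1 _ w1 T1 _).
    split=> //; first by split=> s' i hX hY /=; rewrite ?hX ?hY; split=> // ?; do ?split.
    by move=> i j im jm; rewrite /octA /octB /= => e1 e2; apply: dst => //; lra.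
  by lia.
move=> s2 [[E2 n2' T2] f2]; have w2 := world_frame f2 isT w1.
apply: runs_seqC.
  apply: runs_frame (H3 W n X Y (octA X Y 2) (octB X Y 2) (octV X Y 2) s2 _ w2 T2 _).
    split=> //; first by split=> s' i hX hY /=; rewrite ?hX ?hY; split=> // ?; do ?split.
    by move=> i j im jm; rewrite /octA /octB /= => e1 e2; apply: dst => //; lra.
  by lia.
move=> s3 [[E3 n3 T3] f3]; have w3 := world_frame f3 isT w2.
apply: runs_weaken (H4 W n X Y (octA X Y 3) (octB X Y 3) (octV X Y 3) s3 _ w3 T3 _)
  (leqnn _) _.
- split=> //; first by split=> s' i hX hY /=; rewrite ?hX ?hY; split=> // ?; do ?split.
  by move=> i j im jm; rewrite /octA /octB /= => e1 e2; apply: dst => //; lra.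
- by lia.
move=> s4 [E4 n4 T4]; split=> //; last by lia.
exact: sweeps_bottleneck dst z E1 E2 E3 E4.
Qed.

End AllSweeps.

(** * Minimum spanning trees *)

Section Metric.
Variable R : realType.
Implicit Types p q r : plane R.

Lemma dist_ge0 p q : 0 <= dist p q. Proof. exact: sqrtr_ge0. Qed.

Lemma distxx p : dist p p = 0.
Proof. by rewrite /dist !subrr expr0n addr0 sqrtr0. Qed.

Lemma dist_sqr p q : dist p q ^+ 2 = (p.1 - q.1) ^+ 2 + (p.2 - q.2) ^+ 2.
Proof. by rewrite sqr_sqrtr // addr_ge0 // sqr_ge0. Qed.

Lemma distC p q : dist p q = dist q p.
Proof. by rewrite /dist -sqrrN opprB -[X in _ + X]sqrrN opprB. Qed.

Lemma le_dist p q (t : R) : 0 <= t -> (dist p q <= t) = (dist p q ^+ 2 <= t ^+ 2).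
Proof. by move=> t0; rewrite ler_pXn2r // nnegrE ?dist_ge0. Qed.

Lemma dist_triangle q p r : dist p r <= dist p q + dist q r.
Proof.
rewrite le_dist ?addr_ge0 ?dist_ge0 // sqrrD !dist_sqr.
set a := p.1 - q.1; set b := p.2 - q.2; set c := q.1 - r.1; set d := q.2 - r.2.
have -> : p.1 - r.1 = a + c by rewrite /a /c; ring.
have -> : p.2 - r.2 = b + d by rewrite /b /d; ring.
(* Cauchy-Schwarz; the squares of its two sides differ by the square of [a * d - b * c]. *)
suff : a * c + b * d <= dist p q * dist q r by nra.
have st0 : 0 <= dist p q * dist q r by rewrite mulr_ge0 ?dist_ge0.
apply: le_trans (ler_norm _) _.
rewrite -(ler_pXn2r (n := 2)) ?nnegrE // -normrX ger0_norm ?sqr_ge0 //.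
rewrite exprMn !dist_sqr -/a -/b -/c -/d -subr_ge0.
have -> : (a ^+ 2 + b ^+ 2) * (c ^+ 2 + d ^+ 2) - (a * c + b * d) ^+ 2 =
  (a * d - b * c) ^+ 2 by ring.
exact: sqr_ge0.
Qed.

Lemma dist_le_norm1 p q : dist p q <= `|p.1 - q.1| + `|p.2 - q.2|.
Proof.
rewrite le_dist ?addr_ge0 // dist_sqr.
rewrite -(real_normK (num_real (p.1 - q.1))) -(real_normK (num_real (p.2 - q.2))).
have := normr_ge0 (p.1 - q.1); have := normr_ge0 (p.2 - q.2); nra.
Qed.

Lemma norm1_sqr_le p q :
  (`|p.1 - q.1| + `|p.2 - q.2|) ^+ 2 <= 2 * dist p q ^+ 2.
Proof.
rewrite dist_sqr -(real_normK (num_real (p.1 - q.1))) -(real_normK (num_real (p.2 - q.2))).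
have := sqr_ge0 (`|p.1 - q.1| - `|p.2 - q.2|); nra.
Qed.

(** The factor 2, in place of the sharp square root of 2, keeps the length estimates linear with
    rational coefficients. *)
Lemma norm1_le_dist p q : `|p.1 - q.1| + `|p.2 - q.2| <= 2 * dist p q.
Proof.
have h := norm1_sqr_le p q; have d0 := dist_ge0 p q.
rewrite -(ler_pXn2r (n := 2)) ?nnegrE ?addr_ge0 ?mulr_ge0 //.
apply: le_trans h _; rewrite exprMn; have := sqr_ge0 (dist p q); lra.
Qed.

End Metric.

Section KruskalMath.
Variable R : realType.
Variables (n : nat) (X Y : nat -> R).

Definition dist2 (a b : nat) : R := dist (X a, Y a) (X b, Y b).
Local Notation d2 := dist2.
Local Notation d1 := (dist1 X Y).

Lemma d2_le_d1 a b : d2 a b <= d1 a b. Proof. exact: (dist_le_norm1 (X a, Y a) (X b, Y b)). Qed.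
Lemma d1_le_d2 a b : d1 a b <= 2 * d2 a b. Proof. exact: (norm1_le_dist (X a, Y a) (X b, Y b)). Qed.
Lemma d1_ge0 a b : 0 <= d1 a b. Proof. by rewrite addr_ge0. Qed.

Implicit Types (E F H : seq (nat * nat)) (lab : nat -> nat).

Definition weight (d : nat -> nat -> R) F := \sum_(e <- F) d e.1 e.2.

Definition inrange H := all (fun e => (e.1 < n)%N && (e.2 < n)%N) H.

(* [u] and [v] are connected by [E] once each [x] is identified with [lab x]; connectivity
   is expressed by two-colourings. *)
Definition joins E (u v : nat) lab := forall g : nat -> bool,
  (forall x, (x < n)%N -> g x = g (lab x)) -> (forall e, e \in E -> g e.1 = g e.2) ->
  g u = g v.

Definition connects lab H := forall x y, (x < n)%N -> (y < n)%N -> joins H x y lab.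

(* Exchange property: any connecting graph can give up edges of total weight at least that of
   [F] and still connect the components [lab] of [F]. *)
Definition mst_inv lab F := forall H, inrange H -> connects id H ->
  exists H', [/\ inrange H', weight d1 F + weight d1 H' <= weight d1 H & connects lab H'].

Lemma joins_first E u v lab : joins E u v lab -> ~ joins [::] u v lab ->
  exists E1 f E2, [/\ E = E1 ++ f :: E2, ~ joins E1 u v lab & joins (rcons E1 f) u v lab].
Proof.
elim/last_ind: E => // E f IH Ef nE.
have [/IH[//|E1 [f' [E2 [-> n1 j1]]]]|nj] := pselect (joins E u v lab).
  by exists E1, f', (rcons E2 f); rewrite rcons_cat.
by exists E, f, [::]; rewrite cats1.
Qed.

(** The edge given up is the first one of [H'] that completes a connection between [u] and [v]. It
    joins two different components, so it weighs at least [d1 u v]; with [u] and [v] identified the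
    remaining edges still connect. *)
Lemma mst_step lab lab' F u v : (u < n)%N -> (v < n)%N -> lab u <> lab v ->
  (forall x, (x < n)%N -> (lab x < n)%N /\ lab (lab x) = lab x) ->
  (forall a b, (a < n)%N -> (b < n)%N -> lab a <> lab b -> d1 u v <= d1 a b) ->
  (forall x y, lab x = lab y -> lab' x = lab' y) ->
  lab' u = lab' v -> mst_inv lab F -> mst_inv lab' ((u, v) :: F).
Proof.
move=> un vn luv labP dmin labL lab'uv inv H Hn Hc.
have [H' [H'n wH' cH']] := inv H Hn Hc.
have [|E1 [[a b] [E2 [HE nE1 jE1]]]] := joins_first (cH' u v un vn).
  (* Colouring the component of [u] alone shows that the labels by themselves do not connect [u] to
     [v]. *)
  move=> /(_ (fun x => lab x == lab u)) h.
  have : (lab u == lab u) = (lab v == lab u).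
    by apply: h => // x xn; rewrite (labP x xn).2.
  by rewrite eqxx => /esym/eqP/esym.
have /and3P[E1n /andP[/= an bn] E2n] : [&& inrange E1, (a < n)%N && (b < n)%N & inrange E2].
  by move: H'n; rewrite HE /inrange all_cat /= => /andP[-> /andP[-> ->]].
have lab_ab : lab a <> lab b.
  move=> lab_ab; apply: nE1 => g gl gE; apply: jE1 => // e.
  rewrite mem_rcons inE => /predU1P[->/=|]; last exact: gE.
  by rewrite (gl a an) (gl b bn) lab_ab.
exists (E1 ++ E2); split; first by rewrite /inrange all_cat; apply/andP.
  apply: le_trans wH'; rewrite HE /weight !(big_cat, big_cons) /=.
  have := dmin a b an bn lab_ab; lra.
move=> x y xn yn g gl' gE.
have gl z : (z < n)%N -> g z = g (lab z).
  move=> zn; have [lz llz] := labP z zn.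
  by rewrite (gl' _ zn) (gl' _ lz) (labL _ _ llz).
have guv : g u = g v by rewrite (gl' u un) (gl' v vn) lab'uv.
suff gab : g a = g b.
  apply: cH' => // e; rewrite HE mem_cat inE => /or3P[eE|/eqP->//|eE].
    by apply: gE; rewrite mem_cat eE.
  by apply: gE; rewrite mem_cat eE orbT.
have [//|gab] := eqVneq (g a) (g b); exfalso.
(* Two labellings that both separate a from b differ by one that does not. *)
apply: nE1 => h hl hE.
have [hab|hab] := eqVneq (h a) (h b).
  apply: jE1 => // e; rewrite mem_rcons inE => /predU1P[->//|]; exact: hE.
have : h u (+) g u = h v (+) g v.
  apply: (jE1 (fun z => h z (+) g z)) => [z zn|e]; first by rewrite hl // gl.
  rewrite mem_rcons inE => /predU1P[->/=|eE].
    by move: gab hab; case: (g a); case: (g b); case: (h a); case: (h b).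
  by rewrite hE // gE // mem_cat eE.
by rewrite guv => /addIb.
Qed.

Lemma mst_init : mst_inv id [::].
Proof. by move=> H Hn Hc; exists H; split=> //; rewrite /weight big_nil add0r. Qed.

Lemma mst_done lab F H : mst_inv lab F -> inrange H -> connects id H ->
  weight d1 F <= weight d1 H.
Proof.
move=> inv Hn Hc; have [H' [_ w _]] := inv H Hn Hc.
by apply: le_trans w; rewrite lerDl sumr_ge0 // => e _; exact: d1_ge0.
Qed.

End KruskalMath.

(** * Union by size and the tour as a permutation *)

Section UnionFind.
Variable n : nat.
Implicit Types PA SZ lab : nat -> nat.

(* A parent has at least twice the size recorded at its child, so paths to roots are
   logarithmic; the size recorded at a non-root is the one it had when it was linked. *)
Definition uf_inv PA SZ lab := [/\
  forall x, (x < n)%N -> [/\ (PA x < n)%N, (0 < SZ x <= n)%N, lab (PA x) = lab x,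
    PA x = x -> lab x = x & PA x <> x -> (2 * SZ x <= SZ (PA x))%N],
  forall x, (x < n)%N -> (lab x < n)%N /\ PA (lab x) = lab x &
  (\sum_(x < n) (if PA x == x then SZ x else 0) = n)%N].

Definition relabel lab ru rv x := if lab x == ru then rv else lab x.

Lemma uf_lab PA SZ lab x : uf_inv PA SZ lab -> (x < n)%N -> lab (lab x) = lab x.
Proof.
by move=> [H1 H2 _] xn; have [ln pl] := H2 x xn; have [_ _ _ H _] := H1 _ ln; exact: H.
Qed.

Lemma uf_init PA SZ : (forall i, (i < n)%N -> PA i = i /\ SZ i = 1%N) -> uf_inv PA SZ id.
Proof.
move=> H; split=> [x xn|x xn|]; first by have [-> ->] := H x xn; split=> //; lia.
  by have [-> _] := H x xn.
rewrite (eq_bigr (fun _ => 1%N)) => [|i _]; first by rewrite sum1_card card_ord.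
by have [-> ->] := H i (ltn_ord i); rewrite eqxx.
Qed.

Lemma uf_union PA SZ lab ru rv : uf_inv PA SZ lab -> (ru < n)%N -> (rv < n)%N ->
  ru <> rv -> PA ru = ru -> PA rv = rv -> (SZ ru <= SZ rv)%N ->
  uf_inv (fupd PA ru rv) (fupd SZ rv (SZ ru + SZ rv)%N) (relabel lab ru rv).
Proof.
move=> [H1 H2 H3] run rvn ne Pu Pv szuv.
have nuv : (rv == ru) = false by apply/eqP => /esym.
have lu : lab ru = ru by have [_ _ _ H _] := H1 _ run; exact: H.
have lv : lab rv = rv by have [_ _ _ H _] := H1 _ rvn; exact: H.
have ovn : Ordinal rvn != Ordinal run by rewrite -val_eqE /= nuv.
have sumE (f : nat -> nat) :
  (\sum_(x < n) f x = f ru + (f rv + \sum_(x < n | (x != Ordinal run) && (x != Ordinal rvn)) f x))%N.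
  by rewrite (bigD1 (Ordinal run)) //= (bigD1 (Ordinal rvn)).
rewrite (sumE (fun x => if PA x == x then SZ x else 0%N)) Pu Pv !eqxx in H3.
split.
- move=> x xn; have [px sx lx px1 px2] := H1 x xn; rewrite /relabel /fupd.
  (* The sizes at the roots sum to [n], so the merged size stays within the bound that limits the
     depth. *)
  have szN : (SZ ru + SZ rv <= n)%N by rewrite -[leqRHS]H3; lia.
  have [->|xu] := eqVneq x ru; rewrite ?nuv ?lu ?lv ?nuv ?eqxx.
    by rewrite [ru == rv]eq_sym nuv; split=> //; [case: (H1 _ run)|lia].
  have [xv|xv] := eqVneq x rv.
    by rewrite xv Pv lv nuv eqxx; split=> //; have [_ h _ _ _] := H1 _ rvn; lia.
  rewrite lx; split=> //.
  + by move=> /px1 e; rewrite e (negPf xu).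
  + by move=> /px2; case: eqP => // ->; lia.
- move=> x xn; have [lx plx] := H2 x xn; rewrite /relabel /fupd.
  have [e|e] := eqVneq (lab x) ru; first by rewrite nuv.
  by rewrite (negPf e).
- rewrite (sumE (fun x => if fupd PA ru rv x == x then fupd SZ rv (SZ ru + SZ rv)%N x else 0%N)).
  rewrite /fupd !eqxx nuv Pv eqxx add0n -[RHS]H3 addnA; congr addn.
  apply: eq_bigr => x /andP[xu xv].
  by rewrite -!val_eqE /= in xu xv; rewrite (negPf xu) (negPf xv).
Qed.

(** Roots count components, to be matched with the cycles of the tour permutation. *)
Definition nroots PA := (\sum_(x < n) (PA x == x))%N.

Lemma nroots_union PA ru rv : (ru < n)%N -> ru <> rv -> PA ru = ru ->
  (nroots (fupd PA ru rv)).+1 = nroots PA.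
Proof.
move=> run ne Pu; rewrite /nroots (bigD1 (Ordinal run)) //= [RHS](bigD1 (Ordinal run)) //=.
rewrite /fupd eqxx Pu eqxx; have -> : (rv == ru) = false by apply/eqP => /esym.
rewrite add0n add1n; congr S; apply: eq_bigr => x xu.
by rewrite -val_eqE /= in xu; rewrite (negPf xu).
Qed.

End UnionFind.

Section TourPerm.
Variable R : realType.
Variables (n : nat) (X Y : nat -> R).
Local Notation d2 := (dist2 X Y).
Implicit Types (PA SZ NX lab : nat -> nat) (sp : {perm 'I_n}).

(* The successor table is a permutation with one cycle per component; composing with
   a transposition merges two cycles. *)
Definition tour_inv PA NX lab sp := [/\
  forall i : 'I_n, NX i = sp i, forall i : 'I_n, lab (sp i) = lab i &
  #|porbits sp| = nroots n PA].

Lemma tour_init PA NX : (forall i, (i < n)%N -> PA i = i /\ NX i = i) ->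
  tour_inv PA NX id 1%g.
Proof.
move=> H; split=> [i|i|]; rewrite ?perm1 //; first by case: (H i (ltn_ord i)).
rewrite /nroots (eq_bigr (fun _ => 1%N)) => [|i _]; last first.
  by have [-> _] := H i (ltn_ord i); rewrite eqxx.
rewrite sum1_card /porbits card_imset // => x y /eqP.
by rewrite eq_porbit_mem => /porbitP[i]; rewrite expg1n perm1.
Qed.

(** The edges out of [u] and [v] exchange their heads; reaching each new head by way of the other
    point costs [d2 u v] more. *)
Lemma tour_len_step sp (u v : 'I_n) : u != v ->
  \sum_(i < n) d2 i ((tperm u v * sp)%g i) <= \sum_(i < n) d2 i (sp i) + 2 * d2 u v.
Proof.
move=> uv; have vu : v != u by rewrite eq_sym.
rewrite (bigD1 u) //= (bigD1 v) //= [X in _ <= X + _](bigD1 u) //= [X in _ <= _ + X + _](bigD1 v) //=.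
rewrite !permM tpermL tpermR.
have -> : \sum_(i < n | (i != u) && (i != v)) d2 i ((tperm u v * sp)%g i) =
   \sum_(i < n | (i != u) && (i != v)) d2 i (sp i).
  by apply: eq_bigr => i /andP[iu iv]; rewrite permM tpermD // eq_sym.
have h1 := dist_triangle (X v, Y v) (X u, Y u) (X (sp v), Y (sp v)).
have h2 := dist_triangle (X u, Y u) (X v, Y v) (X (sp u), Y (sp u)).
rewrite [dist (X v, Y v) (X u, Y u)]distC in h2.
by rewrite /dist2; lra.
Qed.

Lemma tour_union PA NX lab sp (u v ru rv : nat) (un : (u < n)%N) (vn : (v < n)%N) :
  tour_inv PA NX lab sp -> lab u <> lab v -> ru <> rv ->
  (forall x y, lab x = lab y -> relabel lab ru rv x = relabel lab ru rv y) ->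
  relabel lab ru rv u = relabel lab ru rv v -> (ru < n)%N -> PA ru = ru ->
  tour_inv (fupd PA ru rv) (fupd (fupd NX u (NX v)) v (NX u)) (relabel lab ru rv)
    (tperm (Ordinal un) (Ordinal vn) * sp)%g.
Proof.
move=> [N1 N2 N3] luv ne rl rluv run Pu.
set ou := Ordinal un; set ov := Ordinal vn.
have uv : ou != ov by apply/eqP => -[] e; apply: luv; rewrite e.
have sl (i : 'I_n) : lab ((sp ^+ 0)%g i) = lab i by rewrite expg0 perm1.
(* Labels are constant along cycles, so [u] and [v] are on different ones and the transposition
   merges these. *)
have nporb : ou \notin porbit sp ov.
  apply/negP => /porbitP[i].
  have sl' j : lab ((sp ^+ j)%g ov) = lab ov.
    by elim: j => [|j IH]; rewrite ?expg0 ?perm1 // expgSr permM N2.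
  by move=> /(congr1 (fun z : 'I_n => lab z)); rewrite sl'.
split.
- move=> i; rewrite permM /fupd; have [->|iv] := eqVneq i ov.
    by rewrite /= eqxx tpermR -N1.
  have -> : (nat_of_ord i == v) = false by rewrite -val_eqE in iv; exact: negPf.
  have [->|iu] := eqVneq i ou; first by rewrite /= eqxx tpermL -N1.
  have -> : (nat_of_ord i == u) = false by rewrite -val_eqE in iu; exact: negPf.
  by rewrite tpermD 1?eq_sym.
- move=> i; rewrite permM.
  have -> : relabel lab ru rv (sp (tperm ou ov i)) = relabel lab ru rv (tperm ou ov i).
    by apply: rl; exact: N2.
  by case: tpermP => // ->.
- have /= h := porbits_mul_tperm sp ou ov; have h' := nroots_union run ne Pu.
  by move: h; rewrite nporb uv N3 -h' /=; set m := #|_|; lia.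
Qed.

End TourPerm.

Section KruskalInv.
Variable R : realType.
Variables (n : nat) (X Y : nat -> R) (m : nat) (U V o : nat -> nat) (w : nat -> R).
Local Notation d1 := (dist1 X Y).
Local Notation d2 := (dist2 X Y).
Hypothesis ok : edges_ok n X Y m U V w.
Hypothesis so : sorted_idx w (fun _ => 0) m o.

Definition spans (F : seq (nat * nat)) lab := forall g : nat -> bool,
  (forall e, e \in F -> g e.1 = g e.2) -> forall x, (x < n)%N -> g x = g (lab x).

Definition kinv_with k PA SZ NX lab (sp : {perm 'I_n}) F :=
  [/\ uf_inv n PA SZ lab, tour_inv PA NX lab sp, inrange n F /\ spans F lab,
      mst_inv n X Y lab F /\ \sum_(i < n) d2 i (sp i) <= 2 * weight d2 F &
      forall j, (j < k)%N -> lab (U (o j)) = lab (V (o j))].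

Definition kinv k PA SZ NX := exists lab sp F, kinv_with k PA SZ NX lab sp F.

Lemma kinv_init PA SZ NX :
  (forall i, (i < n)%N -> [/\ PA i = i, SZ i = 1%N & NX i = i]) -> kinv 0 PA SZ NX.
Proof.
move=> H; exists id, 1%g, [::]; split=> //.
- by apply: uf_init => i /H[-> ->].
- by apply: tour_init => i /H[-> _ ->].
split; first exact: mst_init.
by rewrite /weight big_nil mulr0 big1 // => i _; rewrite perm1 /d2 distxx.
Qed.

Lemma kinv_skip k PA SZ NX lab sp F : lab (U (o k)) = lab (V (o k)) ->
  kinv_with k PA SZ NX lab sp F -> kinv k.+1 PA SZ NX.
Proof.
move=> e [a b c d f]; exists lab, sp, F; split=> // j.
by rewrite ltnS leq_eqVlt => /predU1P[->//|/f].
Qed.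

Lemma kinv_union k PA SZ NX lab sp F ru rv u v : (k < m)%N -> u = U (o k) -> v = V (o k) ->
  kinv_with k PA SZ NX lab sp F -> (ru < n)%N -> (rv < n)%N -> ru <> rv ->
  PA ru = ru -> PA rv = rv -> (SZ ru <= SZ rv)%N ->
  (lab u = ru /\ lab v = rv) \/ (lab u = rv /\ lab v = ru) ->
  kinv k.+1 (fupd PA ru rv) (fupd SZ rv (SZ ru + SZ rv)%N)
    (fupd (fupd NX u (NX v)) v (NX u)).
Proof.
move=> km uE vE [uf tr [Fn Fs] [mst len] old] run rvn ne Pu Pv sz luv.
have [so1 so2 so3] := so; have [un vn _ wE] := ok.1 _ (so1 _ km); rewrite -uE in un wE.
rewrite -vE in vn wE.
have [H1 H2 _] := uf.
have lru : lab ru = ru by have [_ _ _ H _] := H1 _ run; exact: H.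
have lrv : lab rv = rv by have [_ _ _ H _] := H1 _ rvn; exact: H.
have luv' : lab u <> lab v by case: luv => -[-> ->]; [|move/esym].
pose lab' := relabel lab ru rv.
have lab'E x y : lab x = lab y -> lab' x = lab' y by rewrite /lab' /relabel => ->.
have nrv : (rv == ru) = false by apply/eqP => /esym.
have lab'uv : lab' u = lab' v.
  by rewrite /lab' /relabel; case: luv => -[-> ->]; rewrite eqxx nrv.
(* Greedy choice: were [a] and [b] closer than the current edge, [edges_ok] would join them by edges
   that come earlier in the order, and the ends of those already share a label. *)
have dmin a b : (a < n)%N -> (b < n)%N -> lab a <> lab b -> d1 u v <= d1 a b.
  move=> an bn lab_ab; rewrite leNgt; apply/negP => lt_ab; apply: lab_ab.
  apply: (ok.2 (d1 a b)) => // j jm wj; have [i im oi] := idx_onto so1 so2 jm.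
  rewrite -oi in wj *; apply: old; rewrite ltnNge leq_eqVlt; apply/negP => /predU1P[ki|ki].
    by rewrite -ki wE in wj; move: (le_lt_trans wj lt_ab); rewrite ltxx.
  have kim : (k < i < m)%N by rewrite ki.
  have := le_lt_trans (le_trans (lexle1 (so3 k i kim)) wj) lt_ab.
  by rewrite wE ltxx.
exists lab', (tperm (Ordinal un) (Ordinal vn) * sp)%g, ((u, v) :: F); split.
- exact: uf_union.
- exact: tour_union.
- split; first by rewrite /inrange /= un vn.
  move=> g gE x xn.
  have gF : forall e, e \in F -> g e.1 = g e.2 by move=> e eF; apply: gE; rewrite inE eF orbT.
  have guv : g u = g v by apply: (gE (u, v)); rewrite inE eqxx.
  rewrite (Fs g gF x xn) /lab' /relabel; case: eqP => // ->.
  by move: guv; rewrite (Fs g gF u un) (Fs g gF v vn); case: luv => -[-> ->].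
- split.
    apply: (mst_step un vn luv' _ dmin lab'E lab'uv mst) => x xn.
    by split; [case: (H2 x xn)|exact: uf_lab uf xn].
  rewrite /weight big_cons /= mulrDr addrC.
  apply: le_trans (tour_len_step X Y sp _) _.
    by apply/eqP => -[] e; apply: luv'; rewrite e.
  by rewrite lerD2r.
- move=> j; rewrite ltnS leq_eqVlt => /predU1P[->|jk]; first by rewrite -uE -vE.
  by apply: lab'E; exact: old.
Qed.

Definition good_tour (NX : nat -> nat) (sp : {perm 'I_n}) (F : seq (nat * nat)) :=
  [/\ (forall i : 'I_n, NX i = sp i :> nat), #|porbits sp| = 1%N,
      inrange n F /\ connects n id F, \sum_(i < n) d2 i (sp i) <= 2 * weight d2 F &
      forall H, inrange n H -> connects n id H -> weight d1 F <= weight d1 H].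

Lemma kinv_done PA SZ NX : (0 < n)%N -> kinv m PA SZ NX ->
  exists sp F, good_tour NX sp F.
Proof.
move=> n0 [lab [sp [F [uf [N1 N2 N3] [Fn Fs] [mst len] old]]]].
have [so1 so2 _] := so.
have laball a b : (a < n)%N -> (b < n)%N -> lab a = lab b.
  move=> an bn; apply: (ok.2 (d1 a b)) => // j jm _.
  by have [i im <-] := idx_onto so1 so2 jm; exact: old.
exists sp, F; split=> //.
- rewrite N3 /nroots; have [H1 H2 _] := uf.
  have [ln pl] := H2 0%N n0; rewrite (bigD1 (Ordinal ln)) //= pl eqxx big1 // => x.
  rewrite -val_eqE /= => xl; case: eqP => // /esym px.
  have [_ _ _ lx _] := H1 x (ltn_ord x); move/eqP: xl; case.
  by rewrite -(lx (esym px)); exact: laball.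
- split=> // x y xn yn g _ gE.
  by rewrite (Fs g gE x xn) (Fs g gE y yn) (laball x y xn yn).
- by move=> H Hn Hc; exact: mst_done mst Hn Hc.
Qed.

(** With edges scanned by increasing weight, the first edge met at a point leads to its L1-nearest
    neighbour, and the last such first edge has the largest nearest-neighbour distance as weight.
    Entries of [FN] are shifted by one, 0 meaning none so far; [M] is arbitrary before the first
    edge. *)
Definition near_inv k (FN : nat -> nat) (M : R) :=
  [/\ forall x, (x < n)%N -> FN x = 0%N ->
        forall j, (j < k)%N -> U (o j) <> x /\ V (o j) <> x,
      forall x y, (x < n)%N -> FN x = y.+1 -> exists j, [/\ (j < k)%N,
        (U (o j) = x /\ V (o j) = y) \/ (U (o j) = y /\ V (o j) = x) &
        forall j', (j' < j)%N -> U (o j') <> x /\ V (o j') <> x],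
      forall x y, (x < n)%N -> FN x = y.+1 -> d1 x y <= M &
      k = 0%N \/ exists x y, [/\ (x < n)%N, FN x = y.+1 & M = d1 x y]].

Lemma near_inv_eq k FN FN' M : (forall x, FN x = FN' x) ->
  near_inv k FN M -> near_inv k FN' M.
Proof. by move=> /funext ->. Qed.

Lemma near_edge k x y : (k < m)%N ->
  (U (o k) = x /\ V (o k) = y) \/ (U (o k) = y /\ V (o k) = x) -> w (o k) = d1 x y.
Proof.
have [so1 _ _] := so => km; have [_ _ _ ->] := ok.1 _ (so1 _ km).
by move=> [[-> ->]|[-> ->]] //; rewrite d1C.
Qed.

Lemma near_step k FN M u v : (k < m)%N -> u = U (o k) -> v = V (o k) ->
  near_inv k FN M ->
  near_inv k.+1
    (fun x => if FN x == 0%N then if x == u then v.+1 else if x == v then u.+1 else 0%N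
              else FN x)
    (if (FN u == 0%N) || (FN v == 0%N) then w (o k) else M).
Proof.
move=> km uE vE [na nb nc nd]; have [so1 so2 so3] := so.
have [un vn uv wE] := ok.1 _ (so1 _ km); rewrite -uE -vE in un vn uv wE.
have wmono j : (j <= k)%N -> w (o j) <= w (o k).
  rewrite leq_eqVlt => /predU1P[->//|jk].
  by have jkm : (j < k < m)%N by [rewrite jk]; exact: lexle1 (so3 j k jkm).
have nb' x y : (x < n)%N -> (if FN x == 0%N then if x == u then v.+1 else
     if x == v then u.+1 else 0%N else FN x) = y.+1 ->
   exists j, [/\ (j < k.+1)%N,
        (U (o j) = x /\ V (o j) = y) \/ (U (o j) = y /\ V (o j) = x) &
        forall j', (j' < j)%N -> U (o j') <> x /\ V (o j') <> x].
  move=> xn; case: eqP => [F0|_ /nb[//|j [jk e jmin]]]; last first.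
    by exists j; split=> //; exact: ltnW.
  case: eqP => [xu [<-]|_].
    by exists k; split=> //; [left; rewrite xu -uE -vE|exact: na].
  case: eqP => // xv [<-].
  by exists k; split=> //; [right; rewrite xv -uE -vE|exact: na].
split=> //.
- move=> x xn; case: eqP => // F0; case: eqP => // xu; case: eqP => // xv _ j.
  rewrite ltnS leq_eqVlt => /predU1P[->|]; last exact: na.
  by rewrite -uE -vE; split=> e; [case: xu|case: xv].
- move=> x y xn F'; case: ifP => [_|/norP[/negP Fu /negP Fv]].
    have [j [jk e _]] := nb' x y xn F'; have jm : (j < m)%N by exact: leq_trans jk km.
    by rewrite -(near_edge jm e); exact: wmono.
  move: F'; case: eqP => [F0|_]; last exact: nc.
  case: eqP => [xu|_]; first by case: Fu; rewrite -xu F0.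
  by case: eqP => // xv; case: Fv; rewrite -xv F0.
- right; case: ifP => [/orP[F0|F0]|].
  + by exists u, v; rewrite F0 eqxx.
  + exists v, u; rewrite F0 eqxx wE d1C.
    by have -> : (v == u) = false by apply/eqP => /esym.
  + move=> /norP[Fu Fv]; case: nd => [k0|[x [y [xn Fx ->]]]]; last first.
      by exists x, y; rewrite Fx.
    case Fue: (FN u) Fu => [//|z] _; have [j [jk _ _]] := nb u z un Fue.
    by rewrite k0 in jk.
Qed.

(** The colouring that singles out [x] shows by [edges_ok] that, for each other point [z], some
    candidate edge at [x] weighs at most [d1 x z]; the first edge at [x] is not longer than that
    one. *)
Lemma near_done FN M : (1 < n)%N ->
  near_inv m FN M ->
  (forall x, (x < n)%N -> exists y, [/\ FN x = y.+1, (y < n)%N, y <> x, d1 x y <= M &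
     forall z, (z < n)%N -> z <> x -> d1 x y <= d1 x z]) /\
  exists x y, [/\ (x < n)%N, FN x = y.+1 & M = d1 x y].
Proof.
move=> n1 [na nb nc nd]; have [so1 so2 so3] := so.
have main x z : (x < n)%N -> (z < n)%N -> z <> x ->
    exists2 j, (j < m)%N & (U (o j) = x \/ V (o j) = x) /\ w (o j) <= d1 x z.
  move=> xn zn zx; apply: contrapT => no.
  have : (fun v => (v == x) : nat) x = (fun v => (v == x) : nat) z.
    apply: (ok.2 (d1 x z) (fun v => (v == x) : nat)) => // j jm wj; have [i im oi] := idx_onto so1 so2 jm.
    have nU : U j <> x by move=> e; apply: no; exists i => //; rewrite oi; split=> //; left.
    have nV : V j <> x by move=> e; apply: no; exists i => //; rewrite oi; split=> //; right.
    by move/eqP: nU => /negPf ->; move/eqP: nV => /negPf ->.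
  by rewrite /= eqxx; move/eqP: zx => /negPf ->.
have FNs x : (x < n)%N -> exists y, FN x = y.+1.
  move=> xn; case Fx: (FN x) => [|y]; last by exists y.
  have [z zn zx] : exists2 z, (z < n)%N & z <> x.
    by case: x xn {Fx} => [|x] xn; [exists 1%N|exists 0%N => //; exact: ltnW].
  have [j jm [e _]] := main x z xn zn zx.
  by have [] := na x xn Fx j jm; case: e.
split=> [x xn|].
  have [y Fy] := FNs x xn; exists y.
  have [j [jm e jmin]] := nb x y xn Fy.
  have [un vn uv wE] := ok.1 _ (so1 _ jm).
  split=> //; first by case: e => -[e1 e2]; rewrite -?e1 -?e2.
  - by case: e => -[<- <-] //; exact: nesym.
  - exact: nc.
  move=> z zn zx; have [j' j'm [e' wj']] := main x z xn zn zx.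
  rewrite -(near_edge jm e); apply: le_trans wj'.
  have : (j <= j')%N.
    by rewrite leqNgt; apply/negP => /jmin[? ?]; case: e'.
  rewrite leq_eqVlt => /predU1P[->//|jj'].
  by have jjm : (j < j' < m)%N by [rewrite jj']; exact: lexle1 (so3 j j' jjm).
case: nd => [m0|//]; have [y Fy] := FNs 0%N (ltnW n1).
by have [j [jm _ _]] := nb _ _ (ltnW n1) Fy; rewrite m0 in jm.
Qed.

End KruskalInv.

(** * Kruskal's algorithm *)

Notation aPA := 20%N.
Notation aSZ := 21%N.
Notation aNX := 22%N.
Notation aFN := 23%N.
Notation vu := 24%N.
Notation vv := 25%N.
Notation vru := 26%N.
Notation vrv := 27%N.
Notation vt := 28%N.
Notation rM := 9%N.

Definition eqt x y : test := TAnd (TILe x y) (TILe y x).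

Definition fill_w : cmd :=
  RSet rK1 (ivar vi) (RGet rEW (ivar vi)) ;; RSet rK2 (ivar vi) (rcst 0).

Definition edge_sort : cmd := iset0 vm (ivar vne) ;; For vi vne fill_w ;; sortc.

Definition get_edge : cmd :=
  iset0 vu (IGet aEU (IGet aSO (ivar vi))) ;; iset0 vv (IGet aEV (IGet aSO (ivar vi))).

Definition near_body : cmd :=
  get_edge ;;
  If (TILe (IGet aFN (ivar vu)) (ICst 0))
     (ISet aFN (ivar vu) (iadd (ivar vv) (ICst 1)) ;;
      RSet rM (ICst 0) (RGet rEW (IGet aSO (ivar vi)))) Skip ;;
  If (TILe (IGet aFN (ivar vv)) (ICst 0))
     (ISet aFN (ivar vv) (iadd (ivar vu) (ICst 1)) ;;
      RSet rM (ICst 0) (RGet rEW (IGet aSO (ivar vi)))) Skip.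

Definition kr_init : cmd :=
  ISet aPA (ivar vi) (ivar vi) ;; ISet aSZ (ivar vi) (ICst 1) ;; ISet aNX (ivar vi) (ivar vi).

Definition findc src dst : cmd :=
  iset0 dst (ivar src) ;;
  While (TNot (eqt (IGet aPA (ivar dst)) (ivar dst))) (iset0 dst (IGet aPA (ivar dst))).

Definition union_c : cmd :=
  If (eqt (ivar vru) (ivar vrv)) Skip
    (If (TILe (IGet aSZ (ivar vru)) (IGet aSZ (ivar vrv)))
        (ISet aSZ (ivar vrv) (iadd (IGet aSZ (ivar vru)) (IGet aSZ (ivar vrv))) ;;
         ISet aPA (ivar vru) (ivar vrv))
        (ISet aSZ (ivar vru) (iadd (IGet aSZ (ivar vrv)) (IGet aSZ (ivar vru))) ;;
         ISet aPA (ivar vrv) (ivar vru)) ;;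
     iset0 vt (IGet aNX (ivar vu)) ;;
     ISet aNX (ivar vu) (IGet aNX (ivar vv)) ;;
     ISet aNX (ivar vv) (ivar vt)).

Definition kr_body : cmd := get_edge ;; findc vu vru ;; findc vv vrv ;; union_c.

Definition kruskal : cmd :=
  edge_sort ;; For vi vne near_body ;; For vi vn kr_init ;; For vi vne kr_body.

Lemma lg4 m n : (0 < n)%N -> (m <= 4 * n)%N -> (lg m <= (lg n).+2)%N.
Proof.
move=> n0 mn; rewrite -ltnS -(ltn_exp2l _ _ (ltnSn 1)).
case: m mn => [|m] mn; first by rewrite trunc_log0 expn0 -[X in (X < _)%N](expn0 2) ltn_exp2l.
apply: (@leq_ltn_trans m.+1); first by rewrite trunc_logP.
have h : (n < 2 ^ (lg n).+1)%N by exact: trunc_log_ltn.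
by rewrite !expnS in h *; lia.
Qed.

(** Allows the sort of up to [4 * n] candidate edges to be charged in the unit of [n] points. *)
Lemma cx4 m n : (0 < n)%N -> (m <= 4 * n)%N -> (cx m <= 12 * cx n)%N.
Proof.
move=> n0 mn; have := lg4 n0 mn; rewrite /cx; move: (lg m) (lg n) => a b ab.
have h : (m.+1 * a.+1 <= (4 * n).+1 * b.+3)%N by rewrite leq_mul.
apply: leq_trans h _; lia.
Qed.

Section KruskalProg.
Variable R : realType.
Implicit Types (s : state R).

Lemma runs_for4 W x v body s B m n (I : nat -> state R -> Prop) :
  (0 < n)%N -> (m <= 4 * n)%N ->
  imem s v 0 = m -> (m < W)%N ->
  [&& v != x, v \notin iwrites body & x \notin iwrites body] ->
  (forall s', frame [:: x] [::] s s' -> I 0 s') ->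
  (forall k s', (k < m)%N -> imem s' x 0 = k -> I k s' ->
    frame (x :: iwrites body) (rwrites body) s s' -> imem s' v 0 = m ->
    runs W body s' (B * (lg n).+1)
      (fun s'' => forall s3, frame [:: x] [::] s'' s3 -> I k.+1 s3)) ->
  runs W (For x v body) s ((4 * B + 80) * cx n)
    (fun s' => I m s' /\ frame (x :: iwrites body) (rwrites body) s s').
Proof.
move=> n0 mn vn0 nW H H0 Hs.
apply: runs_weaken (runs_for vn0 nW H H0 Hs) _ (fun _ => id).
have h : (m.+1 * (B * (lg n).+1 + 20) <= (4 * n).+1 * (B * (lg n).+1 + 20))%N.
  by rewrite leq_mul2r ltnS mn orbT.
by apply: leq_trans h _; rewrite /cx; lia.
Qed.

Lemma runs_edge_sort : exists C, forall W n (X Y : nat -> R) m s, (2 < n)%N ->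
  (100 * n + 1000 < W)%N -> (m <= 4 * n)%N ->
  imem s vne 0 = m -> (forall i, imem s aT i = 0%N) ->
  runs W edge_sort s (C * cx n) (fun s' =>
    sorted_idx (rmem s rEW) (fun _ => 0) m (imem s' aSO) /\ forall i, imem s' aT i = 0%N).
Proof.
have [C HC] := runs_sort R.
eexists => W n X Y m s n2 nW mn sm T0.
apply: runs_seqC.
  apply: runs_frame (runs_wpC _ (Q := fun s' => imem s' vm 0 = m) _).
  by rewrite /= sm; wps.
move=> s1 [s1m f1]; have s1e : imem s1 vne 0 = m by rewrite f1.1.
apply: runs_seqC.
  apply: (@runs_for4 _ _ _ _ _ (ccost fill_w) m n (fun k s' => forall i, (i < k)%N ->
    rmem s' rK1 i = rmem s rEW i /\ rmem s' rK2 i = 0)) => //; [lia|lia|].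
  move=> k s' km si I f s'm; apply: runs_weaken (runs_wp _) _ (fun _ => id).
    rewrite /= si; wps; move=> s3 g i.
    rewrite !g.2 //= ltnS leq_eqVlt (f.2 rEW isT) (f1.2 rEW isT).
    by case: eqP => [->//|_] /I.
  by rewrite leq_pmulr.
move=> s2 [K2 f2].
have s2m : imem s2 vm 0 = m by rewrite f2.1.
have T2 i : imem s2 aT i = 0%N by rewrite f2.1 // f1.1.
have mW : (16 * m + 100 < W)%N by lia.
apply: runs_weaken (HC W s2 m mW s2m T2) _ _; last first.
  by move=> s3 [so T3 _]; split=> //; exact: sorted_idx_eq K2 so.
apply: leq_trans (_ : C * (12 * cx n) <= _)%N; last by rewrite mulnA; exact: leqnn.
by rewrite leq_mul2l; apply/orP; right; apply: cx4 => //; lia.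
Qed.

Lemma runs_near : exists C, forall W n (X Y : nat -> R) m s, (2 < n)%N ->
  (100 * n + 1000 < W)%N -> (m <= 4 * n)%N -> imem s vne 0 = m ->
  edges_ok n X Y m (imem s aEU) (imem s aEV) (rmem s rEW) ->
  sorted_idx (rmem s rEW) (fun _ => 0) m (imem s aSO) ->
  (forall i, imem s aFN i = 0%N) ->
  runs W (For vi vne near_body) s (C * cx n) (fun s' =>
    near_inv n X Y (imem s aEU) (imem s aEV) (imem s aSO) m (imem s' aFN) (rmem s' rM 0)).
Proof.
eexists => W n X Y m s n2 nW mn sm ok so F0.
set U := imem s aEU; set V := imem s aEV; set o := imem s aSO; set w := rmem s rEW.
apply: runs_weaken (@runs_for4 W vi vne near_body s (ccost near_body) m n (fun k s' =>
    near_inv n X Y U V o k (imem s' aFN) (rmem s' rM 0)) _ mn sm _ _ _ _) (leqnn _) _.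
- lia.
- lia.
- by [].
- move=> s' f; rewrite (f.1 aFN isT); split=> //; last by left.
  + by move=> x y _; rewrite F0.
  + by move=> x y _; rewrite F0.
- move=> k s' km si I f s'm; apply: runs_weaken (runs_wp _) _ (fun _ => id); last first.
    by rewrite leq_pmulr.
  have [so1 _ _] := so; have [un vn uv wE] := ok.1 _ (so1 _ km).
  have Es a : a \notin vi :: iwrites near_body -> imem s' a = imem s a by exact: f.1.
  have H := near_step ok so km erefl erefl I.
  rewrite -/U -/V -/o in un vn uv.
  have wE' : rmem s' rEW = w by rewrite f.2.
  rewrite /= !si !(Es aSO isT) !(Es aEU isT) !(Es aEV isT) -/U -/V -/o !wE'; wps.
  have VU : (V (o k) == U (o k)) = false by apply/eqP => /esym.
  have fin s3 : (forall x, imem s3 aFN x = if imem s' aFN x == 0%N then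
        if x == U (o k) then (V (o k)).+1 else if x == V (o k) then (U (o k)).+1 else 0%N
        else imem s' aFN x) ->
      rmem s3 rM 0 = (if (imem s' aFN (U (o k)) == 0%N) || (imem s' aFN (V (o k)) == 0%N)
        then w (o k) else rmem s' rM 0) ->
      near_inv n X Y U V o k.+1 (imem s3 aFN) (rmem s3 rM 0).
    by move=> e ->; apply: near_inv_eq H => x; rewrite e.
  rewrite !VU /= in fin *.
  case: ifP => Fu; wps; case: ifP => Fv; wps => s3 g; apply: fin;
    rewrite ?(g.1 aFN isT) ?(g.2 rM isT) /= -?leqn0 ?Fu ?Fv //= => x;
    rewrite -?leqn0 ?addn1;
    case: (eqVneq x (U (o k))) => [->|_];
    rewrite ?[U (o k) == V (o k)]eq_sym ?VU ?Fu //;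
    case: (eqVneq x (V (o k))) => [->|_]; rewrite ?VU ?Fu ?Fv //;
    by case: ifP => //; rewrite leqn0 => /eqP ->.
- by move=> s' [].
Qed.

Lemma runs_kr_init W n s : (n + 10 < W)%N -> imem s vn 0 = n ->
  runs W (For vi vn kr_init) s ((ccost kr_init + 20) * cx n) (fun s' =>
    forall i, (i < n)%N -> [/\ imem s' aPA i = i, imem s' aSZ i = 1%N & imem s' aNX i = i]).
Proof.
move=> nW sn; apply: runs_weaken (@runs_for_wp _ _ vi vn kr_init s n (fun k s' =>
  forall i, (i < k)%N -> [/\ imem s' aPA i = i, imem s' aSZ i = 1%N & imem s' aNX i = i])
  sn _ _ _ _) (leqnn _) _ => //; [lia| |by move=> s' []].
move=> k s' kn si I f s'n; rewrite /= si; wps => s3 g i.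
rewrite !g.1 //= ltnS leq_eqVlt.
by case: eqP => [->//|_] /I.
Qed.

Lemma runs_find W src dst n PA SZ lab s x : (n + 10 < W)%N -> dst != aPA ->
  src != aPA -> imem s aPA = PA -> imem s src 0 = x -> (x < n)%N ->
  uf_inv n PA SZ lab ->
  runs W (findc src dst) s (60 * (lg n).+1) (fun s' => imem s' dst 0 = lab x).
Proof.
move=> nW dP sP sPA sx xn [H1 H2 _].
(* The recorded size at least doubles with each step towards the root and never exceeds [n], so
   [n < 2 ^ j * SZ] leaves at most [j] steps. *)
pose J j s' := [/\ (imem s' dst 0 < n)%N, lab (imem s' dst 0) = lab x,
  (n < 2 ^ j * SZ (imem s' dst 0))%N & imem s' aPA = PA].
have Pd : (aPA == dst) = false by rewrite eq_sym; exact: negPf.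
apply: runs_weaken (@runs_seq _ _ _ _ _ _ _ (J (lg n).+1) _ _ _) _ (fun _ => id).
- apply: runs_wp => /=; rewrite sx; wps; split; rewrite /= ?Pd ?eqxx //=.
  have := trunc_log_ltn n (ltnSn 1); have [_ h _ _ _] := H1 x xn.
  move=> h'; apply: leq_trans h' _; rewrite leq_pmulr //; lia.
- move=> s' Js'; apply: runs_while Js' _ => j {}s' [yn yl nj s'P].
  set y := imem s' dst 0 in yn yl nj *.
  split; first by rewrite /= ; wps.
  have [Pn SZn lP P1 P2] := H1 y yn.
  rewrite /= s'P -/y -eqn_leq; case: eqP => [e|e] /=.
    by rewrite -yl (P1 e).
  have SZ2 := P2 e; split.
    case: j nj => // nj; move: nj; rewrite expn0 mul1n => nj.
    by have := (H1 _ Pn); case=> _ h _ _ _; lia.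
  apply: runs_wp => /=; rewrite s'P -/y; wps; split; rewrite /= ?Pd ?eqxx //=.
    by rewrite lP.
  case: j nj => [|j] nj /=.
    by move: nj; rewrite expn0 mul1n; case/andP: SZn; lia.
  by apply: leq_trans nj _; rewrite expnS -mulnA (mulnCA 2) leq_mul2l SZ2 orbT.
- rewrite /=; lia.
Qed.

Lemma wp_union W Q s u v ru rv : (1 < W)%N ->
  imem s vu 0 = u -> imem s vv 0 = v -> imem s vru 0 = ru -> imem s vrv 0 = rv ->
  (imem s aSZ ru + imem s aSZ rv < W)%N ->
  (ru = rv -> Q s) ->
  (forall s', ru <> rv -> (imem s aSZ ru <= imem s aSZ rv)%N ->
     imem s' aPA = fupd (imem s aPA) ru rv ->
     imem s' aSZ = fupd (imem s aSZ) rv (imem s aSZ ru + imem s aSZ rv)%N ->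
     imem s' aNX = fupd (fupd (imem s aNX) u (imem s aNX v)) v (imem s aNX u) -> Q s') ->
  (forall s', rv <> ru -> (imem s aSZ rv <= imem s aSZ ru)%N ->
     imem s' aPA = fupd (imem s aPA) rv ru ->
     imem s' aSZ = fupd (imem s aSZ) ru (imem s aSZ rv + imem s aSZ ru)%N ->
     imem s' aNX = fupd (fupd (imem s aNX) u (imem s aNX v)) v (imem s aNX u) -> Q s') ->
  wp W union_c Q s.
Proof.
move=> W1 su sv sru srv szW H0 H1 H2.
rewrite /= !sru !srv !su !sv -eqn_leq; wps; case: eqP => // e; wps.
case: (leqP (imem s aSZ ru) (imem s aSZ rv)) => sz; wps; first by apply: H1.
by apply: H2 => //; [exact: nesym|exact: ltnW].
Qed.

Lemma runs_kr_loop : exists C, forall W n (X Y : nat -> R) m s, (2 < n)%N ->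
  (100 * n + 1000 < W)%N -> (m <= 4 * n)%N -> imem s vne 0 = m ->
  edges_ok n X Y m (imem s aEU) (imem s aEV) (rmem s rEW) ->
  sorted_idx (rmem s rEW) (fun _ => 0) m (imem s aSO) ->
  (forall i, (i < n)%N -> [/\ imem s aPA i = i, imem s aSZ i = 1%N & imem s aNX i = i]) ->
  runs W (For vi vne kr_body) s (C * cx n) (fun s' =>
    exists (sp : {perm 'I_n}) F, good_tour X Y (imem s' aNX) sp F).
Proof.
eexists => W n X Y m s n2 nW mn sm ok so init.
set U := imem s aEU in ok; set V := imem s aEV in ok; set o := imem s aSO in so.
apply: runs_weaken (@runs_for4 W vi vne kr_body s (200 + ccost union_c) m n (fun k s' =>
    kinv n X Y U V o k (imem s' aPA) (imem s' aSZ) (imem s' aNX)) _ mn sm _ _ _ _) (leqnn _) _.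
- lia.
- lia.
- by [].
- move=> s' f; rewrite (f.1 aPA isT) (f.1 aSZ isT) (f.1 aNX isT).
  exact: kinv_init.
- move=> k s1 km si [lab [sp [F I]]] f s1m.
  have [so1 _ _] := so; have [un vn uv wE] := ok.1 _ (so1 _ km).
  set u := U (o k) in un uv wE; set v := V (o k) in vn uv wE.
  have [uf _ _ _ _] := I; have [u1 u2 u3] := uf.
  apply: (@runs_weaken _ _ _ _ (ccost get_edge + (60 * (lg n).+1 + (60 * (lg n).+1 +
     ccost union_c)))); last first.
  + by move=> s' H; exact: H.
  + by rewrite /get_edge /=; nia.
  apply: runs_seq.
    apply: runs_frame (@runs_wp _ _ _ _ (fun s2 => imem s2 vu 0 = u /\ imem s2 vv 0 = v) _).
    by rewrite /= !si !(f.1 aSO isT) !(f.1 aEU isT) !(f.1 aEV isT) -/U -/V -/o; wps.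
  move=> s2 [[s2u s2v] f2].
  have nW' : (n + 10 < W)%N by lia.
  apply: runs_seq.
    exact: runs_frame (@runs_find W vu vru n _ _ lab s2 u nW' isT isT (f2.1 aPA isT) s2u un uf).
  move=> s3 [s3u f3].
  have P3 : imem s3 aPA = imem s1 aPA by rewrite f3.1 // f2.1.
  have s3v : imem s3 vv 0 = v by rewrite f3.1.
  apply: runs_seq.
    exact: runs_frame (@runs_find W vv vrv n _ _ lab s3 v nW' isT isT P3 s3v vn uf).
  move=> s4 [s4v f4].
  have P4 : imem s4 aPA = imem s1 aPA by rewrite f4.1.
  have S4 : imem s4 aSZ = imem s1 aSZ by rewrite f4.1 // f3.1 // f2.1.
  have N4 : imem s4 aNX = imem s1 aNX by rewrite f4.1 // f3.1 // f2.1.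
  have [lun Plu] := u2 _ un; have [lvn Plv] := u2 _ vn.
  have [_ szu _ _ _] := u1 _ lun; have [_ szv _ _ _] := u1 _ lvn.
  apply: runs_wp; apply: (@wp_union W _ s4 u v (lab u) (lab v)) => //.
  + lia.
  + by rewrite f4.1 // f3.1.
  + by rewrite f4.1.
  + by rewrite f4.1.
  + by rewrite S4; lia.
  + move=> luv s5 g; rewrite (g.1 aPA isT) (g.1 aSZ isT) (g.1 aNX isT) P4 S4 N4.
    exact: kinv_skip luv I.
  + move=> s5 ne sz P5 S5 N5 s6 g; rewrite (g.1 aPA isT) (g.1 aSZ isT) (g.1 aNX isT)
      P5 S5 N5 P4 S4 N4 in sz *.
    by apply: (kinv_union ok so km erefl erefl I); rewrite // -/u -/v; left.
  + move=> s5 ne sz P5 S5 N5 s6 g; rewrite (g.1 aPA isT) (g.1 aSZ isT) (g.1 aNX isT)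
      P5 S5 N5 P4 S4 N4 in sz *.
    by apply: (kinv_union ok so km erefl erefl I); rewrite // -/u -/v; right.
- move=> s' [I _]; apply: (kinv_done ok so _ I); lia.
Qed.

Definition near_ok n (X Y : nat -> R) (FN : nat -> nat) (M : R) :=
  (forall x, (x < n)%N -> exists y, [/\ FN x = y.+1, (y < n)%N, y <> x, dist1 X Y x y <= M &
     forall z, (z < n)%N -> z <> x -> dist1 X Y x y <= dist1 X Y x z]) /\
  exists x y, [/\ (x < n)%N, FN x = y.+1 & M = dist1 X Y x y].

Lemma runs_kruskal : exists C, forall W n (X Y : nat -> R) m s, (2 < n)%N ->
  (100 * n + 1000 < W)%N -> (m <= 4 * n)%N -> imem s vne 0 = m -> imem s vn 0 = n ->
  (forall i, imem s aT i = 0%N) -> (forall i, imem s aFN i = 0%N) ->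
  edges_ok n X Y m (imem s aEU) (imem s aEV) (rmem s rEW) ->
  runs W kruskal s (C * cx n) (fun s' =>
    (exists (sp : {perm 'I_n}) F, good_tour X Y (imem s' aNX) sp F) /\
    near_ok n X Y (imem s' aFN) (rmem s' rM 0) /\ forall i, imem s' aT i = 0%N).
Proof.
have [C1 H1] := runs_edge_sort; have [C2 H2] := runs_near; have [C3 H3] := runs_kr_loop.
eexists => W n X Y m s n2 nW mn sm sn T0 F0 ok.
apply: runs_seqC; first exact: runs_frame (H1 W n X Y m s n2 nW mn sm T0).
move=> s1 [[so T1] f1].
rewrite -(f1.1 aEU isT) -(f1.1 aEV isT) -(f1.2 rEW isT) in ok so.
have F1 i : imem s1 aFN i = 0%N by rewrite f1.1.
have s1m : imem s1 vne 0 = m by rewrite f1.1.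
apply: runs_seqC; first exact: runs_frame (H2 W n X Y m s1 n2 nW mn s1m ok so F1).
move=> s2 [nr f2].
have n1 : (1 < n)%N by lia.
have nro : near_ok n X Y (imem s2 aFN) (rmem s2 rM 0) := near_done ok so n1 nr.
have s2n : imem s2 vn 0 = n by rewrite f2.1 // f1.1.
have nW' : (n + 10 < W)%N by lia.
apply: runs_seqC; first exact: runs_frame (runs_kr_init nW' s2n).
move=> s3 [init f3].
rewrite -(f2.1 aEU isT) -(f2.1 aEV isT) -(f2.1 aSO isT) -(f2.2 rEW isT) in ok so.
rewrite -(f3.1 aEU isT) -(f3.1 aEV isT) -(f3.1 aSO isT) -(f3.2 rEW isT) in ok so.
have s3m : imem s3 vne 0 = m by rewrite f3.1 // f2.1.
apply: runs_weaken (runs_frame (H3 W n X Y m s3 n2 nW mn s3m ok so init)) (leqnn _) _.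
move=> s4 [gt f4]; split=> //; split=> [|i].
  by rewrite (f4.1 aFN isT) (f4.2 rM isT) (f3.1 aFN isT) (f3.2 rM isT).
by rewrite (f4.1 aT isT) (f3.1 aT isT) (f2.1 aT isT).
Qed.

End KruskalProg.

(** * Grid and nearest neighbours *)

Notation aCY := 29%N.
Notation aCX := 30%N.
Notation vc := 35%N.
Notation rbase := 10%N.

Definition fill_col (r : nat) : cmd :=
  RSet rK1 (ivar vi) (RGet r (ivar vi)) ;; RSet rK2 (ivar vi) (rcst 0).

Definition col_start : cmd :=
  iset0 vc (ICst 0) ;; RSet rbase (ICst 0) (RGet rK1 (IGet aSO (ICst 0))).

Definition col_body : cmd :=
  If (TRLe (RGet rK1 (IGet aSO (ivar vi)))
           (radd (RGet rbase (ICst 0)) (RBin RDiv (RGet rM (ICst 0)) (rcst 4)))) Skip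
     (iset0 vc (iadd (ivar vc) (ICst 1)) ;;
      RSet rbase (ICst 0) (RGet rK1 (IGet aSO (ivar vi)))) ;;
  ISet aCY (IGet aSO (ivar vi)) (ivar vc).

Definition columns (r : nat) : cmd :=
  iset0 vm (ivar vn) ;; For vi vn (fill_col r) ;; sortc ;; col_start ;; For vi vn col_body.

Definition copy_CX : cmd := ISet aCX (ivar vi) (IGet aCY (ivar vi)).

(* Column numbers are produced in [aCY]; those of the abscissas are then moved to [aCX]. *)
Definition grid : cmd := columns rX ;; For vi vn copy_CX ;; columns rY.

Section Columns.
Variable R : realType.
Implicit Types (s : state R).

(* Long empty gaps between columns are contracted, so that column numbers are at most [n]. *)
Definition col_ok n (r : nat -> R) (M : R) (col : nat -> nat) :=
  forall p q, (p < n)%N -> (q < n)%N ->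
    [/\ (col p <= n)%N, r q - r p <= M -> (col q <= col p + 4)%N &
        col p = col q -> `|r p - r q| <= M / 4].

(** [b k] is the left end of column [k], [c] the number of the column being filled, [base] its left
    end. *)
Definition col_inv n (r : nat -> R) (M : R) (o : nat -> nat) i (col : nat -> nat) c base :=
  exists b : nat -> R, [/\ forall k, (k < c)%N -> b k + M / 4 < b k.+1, base = b c,
    exists2 j, (j < n)%N /\ (j <= i)%N & b c = r (o j), (c <= i)%N &
    forall j, (j < i)%N -> (col (o j) <= c)%N /\ b (col (o j)) <= r (o j) <= b (col (o j)) + M / 4].

Lemma col_inv_step n r M o k2 i col c base : 0 <= M -> sorted_idx r k2 n o -> (i < n)%N ->
  col_inv n r M o i col c base ->
  if r (o i) <= base + M / 4 then col_inv n r M o i.+1 (fupd col (o i) c) c base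
  else col_inv n r M o i.+1 (fupd col (o i) c.+1) c.+1 (r (o i)).
Proof.
move=> M0 [so1 so2 so3] iN [b [b1 bE [j0 [j0n j0i] bj] ci bp]].
have rb : b c <= r (o i).
  rewrite bj; move: j0i; rewrite leq_eqVlt => /predU1P[->//|ji].
  have jin : (j0 < i < n)%N by rewrite ji.
  exact: lexle1 (so3 j0 i jin).
have ne j : (j < i)%N -> (o j == o i) = false.
  move=> ji; apply/eqP => e; have := so2 j i (ltn_trans ji iN) iN e.
  by move=> ei; rewrite ei ltnn in ji.
rewrite bE; case: ifP => h.
  exists b; split=> //; first by exists j0 => //; split=> //; exact: leqW.
    exact: leqW.
  move=> j; rewrite ltnS leq_eqVlt => /predU1P[->|ji]; first by rewrite /fupd eqxx leqnn rb.
  by rewrite /fupd ne //; exact: bp.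
have {}h : b c + M / 4 < r (o i) by rewrite ltNge h.
exists (fun k => if (k <= c)%N then b k else r (o i)); split.
- move=> k; rewrite ltnS => kc; rewrite kc; case: ifP => [kc'|kc']; first exact: b1.
  by have -> : k = c by lia.
- by rewrite ltnn.
- by exists i => //; rewrite ltnn.
- by [].
- move=> j; rewrite ltnS leq_eqVlt => /predU1P[->|ji].
    by rewrite /fupd eqxx ltnn leqnn lexx lerDl divr_ge0.
  rewrite /fupd ne //; have [h1 h2] := bp j ji; rewrite h1; split=> //.
  exact: leqW.
Qed.

Lemma col_inv_done n r M o k2 col c base : 0 <= M -> sorted_idx r k2 n o ->
  col_inv n r M o n col c base -> col_ok n r M col.
Proof.
move=> M0 [so1 so2 so3] [b [b1 bE _ cn bp]].
have mono k l : (k <= l <= c)%N -> b k + M / 4 *+ (l - k) <= b l.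
  move=> /andP[kl]; move: kl => /subnKC <-; move: (l - k)%N => {l} l.
  rewrite addKn; elim: l => [|l IH] kl; first by rewrite mulr0n addr0 addn0.
  have kl' : (k + l < c)%N by lia.
  have := IH (ltnW kl'); have := b1 _ kl'; rewrite addnS mulrSr; lra.
move=> p q pn qn; have [i im <-] := idx_onto so1 so2 pn.
have [j jm <-] := idx_onto so1 so2 qn.
have [pc /andP[p1 p2]] := bp i im; have [qc /andP[q1 q2]] := bp j jm.
split; first exact: leq_trans cn.
  move=> h; rewrite leqNgt; apply/negP => lt.
  (* Being five columns ahead means five gaps of [M / 4], one of them known to be strict: four make
     up [M] and one covers the width of the column of [p]. *)
  have /mono m1 : (col (o i) <= col (o i) + 4 <= c)%N by lia.
  have /b1 m0 : (col (o i) + 4 < c)%N by lia.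
  have /mono m2 : ((col (o i) + 4).+1 <= col (o j) <= c)%N by lia.
  have m3 : 0 <= M / 4 *+ (col (o j) - (col (o i) + 4).+1) by rewrite mulrn_wge0 // divr_ge0.
  rewrite addKn -mulr_natl in m1; lra.
move=> e; rewrite e in p1 p2; rewrite ler_norml; lra.
Qed.

Lemma col_ok_eq n r r' M col : (forall i, (i < n)%N -> r i = r' i) ->
  col_ok n r M col -> col_ok n r' M col.
Proof. by move=> E H p q pn qn; rewrite -!E //; exact: H. Qed.

Lemma runs_columns r : r != rK1 -> r != rK2 -> r != rbase ->
  exists C, forall W n s, (2 < n)%N ->
  (100 * n + 1000 < W)%N -> imem s vn 0 = n -> (forall i, imem s aT i = 0%N) ->
  0 <= rmem s rM 0 ->
  runs W (columns r) s (C * cx n) (fun s' =>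
    col_ok n (rmem s r) (rmem s rM 0) (imem s' aCY) /\ forall i, imem s' aT i = 0%N).
Proof.
move=> r1 r2 r3; have [C HC] := runs_sort R.
have rn : r \notin rwrites (fill_col r) by rewrite !inE negb_or r1 r2.
eexists => W n s n2 nW sn T0 M0; set M := rmem s rM 0.
apply: runs_seqC.
  apply: runs_frame (runs_wpC _ (Q := fun s' => imem s' vm 0 = n) _).
  by rewrite /= sn; wps.
move=> s1 [s1m f1]; have s1n : imem s1 vn 0 = n by rewrite f1.1.
apply: runs_seqC.
  apply: (@runs_for_wp _ _ _ _ (fill_col r) _ n (fun k s' => forall i, (i < k)%N ->
    rmem s' rK1 i = rmem s r i /\ rmem s' rK2 i = 0)) => //; [lia|].
  move=> k s' kn si I f s'n; rewrite /= si; wps; move=> s3 g i.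
  rewrite !g.2 //= ltnS leq_eqVlt (f.2 r rn) (f1.2 r isT).
  by case: eqP => [->//|_] /I.
move=> s2 [K2 f2].
have s2m : imem s2 vm 0 = n by rewrite f2.1.
have T2 i : imem s2 aT i = 0%N by rewrite f2.1 // f1.1.
have nW' : (16 * n + 100 < W)%N by lia.
apply: runs_seqC; first exact: runs_frame (HC W s2 n nW' s2m T2).
move=> s3 [[so T3 _] f3].
set k1 := rmem s2 rK1 in so; set k2 := rmem s2 rK2 in so.
have s3K : rmem s3 rK1 = k1 by rewrite f3.2.
set o := imem s3 aSO in so; have [so1 _ _] := so.
apply: runs_seqC.
  apply: runs_frame (runs_wpC _ (Q := fun s' => imem s' vc 0 = 0%N /\ rmem s' rbase 0 = k1 (o 0%N)) _).
  by rewrite /= s3K; wps.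
move=> s4 [[s4c s4b] f4].
have s4n : imem s4 vn 0 = n by rewrite f4.1 // f3.1 // f2.1.
have M4 : rmem s4 rM 0 = M by rewrite f4.2 // f3.2 // f2.2 // f1.2.
have K4 : rmem s4 rK1 = k1 by rewrite f4.2.
have O4 : imem s4 aSO = o by rewrite f4.1.
apply: runs_weaken (@runs_for_wp _ W vi vn col_body s4 n (fun k s' =>
   col_inv n k1 M o k (imem s' aCY) (imem s' vc 0) (rmem s' rbase 0)) s4n _ _ _ _) (leqnn _) _.
- lia.
- by [].
- move=> s' f; rewrite (f.1 aCY isT) (f.1 vc isT) (f.2 rbase isT) s4c s4b.
  exists (fun _ => k1 (o 0%N)); split=> //; exists 0%N => //; split=> //; lia.
- move=> k s' kn si I f s'n.
  have H := col_inv_step M0 so kn I.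
  have [b [_ _ _ ck _]] := I.
  rewrite /= !si !(f.1 aSO isT) O4 (f.2 rK1 isT) K4 (f.2 rM isT) M4; wps.
  by case: ifP H => h H; wps => s5 g; rewrite (g.1 aCY isT) (g.1 vc isT) (g.2 rbase isT) /=
    ?addn1.
- move=> s5 [I f5]; have H := col_inv_done M0 so I; split.
    by apply: col_ok_eq H => i /K2[].
  by move=> i; rewrite f5.1 // f4.1.
Qed.

Lemma runs_grid : exists C, forall W n (X Y : nat -> R) s, (2 < n)%N ->
  (100 * n + 1000 < W)%N -> world n X Y s -> (forall i, imem s aT i = 0%N) ->
  0 <= rmem s rM 0 ->
  runs W grid s (C * cx n) (fun s' => [/\ col_ok n X (rmem s rM 0) (imem s' aCX),
    col_ok n Y (rmem s rM 0) (imem s' aCY) & forall i, imem s' aT i = 0%N]).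
Proof.
have [C1 H1] := runs_columns (r := rX) isT isT isT.
have [C2 H2] := runs_columns (r := rY) isT isT isT.
eexists => W n X Y s n2 nW w T0 M0.
have [wn wX wY] := w.
apply: runs_seqC; first exact: runs_frame (H1 W n s n2 nW wn T0 M0).
move=> s1 [[cX T1] f1]; have [w1n w1X w1Y] := world_frame f1 isT w.
rewrite wX in cX; set M := rmem s rM 0 in M0 cX *.
apply: runs_seqC.
  apply: (@runs_for_wp _ _ _ _ copy_CX _ n (fun k s' => forall i, (i < k)%N ->
    imem s' aCX i = imem s1 aCY i)) => //; [lia|].
  move=> k s' kn si I f s'n; rewrite /= si; wps; move=> s3 g i.
  rewrite !g.1 //= ltnS leq_eqVlt (f.1 aCY isT).
  by case: eqP => [->//|_] /I.
move=> s2 [E2 f2]; have s2n : imem s2 vn 0 = n by rewrite f2.1.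
have T2 i : imem s2 aT i = 0%N by rewrite f2.1.
have M2 : rmem s2 rM 0 = M by rewrite f2.2 // f1.2.
have M20 : 0 <= rmem s2 rM 0 by rewrite M2.
apply: runs_weaken (runs_frame (H2 W n s2 n2 nW s2n T2 M20)) (leqnn _) _.
move=> s3 [[cY T3] f3]; rewrite M2 (f2.2 rY isT) w1Y in cY; split=> //.
by move=> p q pn qn; rewrite (f3.1 aCX isT) !E2 //; exact: cX.
Qed.

End Columns.

Notation aF := 32%N.
Notation aT2 := 33%N.
Notation vcell := 34%N.
Notation v81 := 36%N.
Notation vk := 37%N.
Notation vq := 38%N.
Notation rD := 11%N.
Notation rd := 12%N.

Definition sqdist_e (i j : iexp) : rexp :=
  radd (rmul (rsub (ex i) (ex j)) (rsub (ex i) (ex j)))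
       (rmul (rsub (ey i) (ey j)) (rsub (ey i) (ey j))).

Definition init_D : cmd :=
  ISet aF (ivar vi) (isub (IGet aFN (ivar vi)) (ICst 1)) ;;
  RSet rD (ivar vi) (sqdist_e (ivar vi) (IGet aF (ivar vi))) ;;
  If (TRLe (rmul (rcst 2) (RGet rD (ivar vi))) (rmul (RGet rM (ICst 0)) (RGet rM (ICst 0))))
     Skip
     (ISet aT2 (iadd (imul (iadd (IGet aCX (ivar vi)) (ICst 4)) (iadd (ivar vn) (ICst 9)))
                     (iadd (IGet aCY (ivar vi)) (ICst 4)))
               (iadd (ivar vi) (ICst 1))).

(** A probing point does not look for its own neighbour: it offers itself to the occupants of the
    cells around it. Hence only the exceptional points need to be stored, and these have their cells
    to themselves. *)
Definition probe : cmd :=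
  iset0 vcell (IGet aT2
    (iadd (imul (iadd (IGet aCX (ivar vi)) (idiv (ivar vk) (ICst 9))) (iadd (ivar vn) (ICst 9)))
          (iadd (IGet aCY (ivar vi)) (imod (ivar vk) (ICst 9))))) ;;
  If (TILe (ivar vcell) (ICst 0)) Skip
    (iset0 vq (isub (ivar vcell) (ICst 1)) ;;
     If (eqt (ivar vq) (ivar vi)) Skip
       (RSet rd (ICst 0) (sqdist_e (ivar vq) (ivar vi)) ;;
        If (TRLe (RGet rD (ivar vq)) (RGet rd (ICst 0))) Skip
          (RSet rD (ivar vq) (RGet rd (ICst 0)) ;; ISet aF (ivar vq) (ivar vi)))).

Definition nearest : cmd :=
  For vi vn init_D ;; iset0 v81 (ICst 81) ;; For vi vn (For vk v81 probe).

Section NearestMath.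
Variable R : realType.
Variables (n : nat) (X Y : nat -> R).
Local Notation d1 := (dist1 X Y).

Definition sq (a b : nat) : R :=
  (X a - X b) * (X a - X b) + (Y a - Y b) * (Y a - Y b).

Lemma sqE a b : sq a b = dist2 X Y a b ^+ 2.
Proof. by rewrite /dist2 dist_sqr !expr2. Qed.

Lemma sq_le_d1 a b : sq a b <= d1 a b ^+ 2.
Proof.
by rewrite sqE ler_pXn2r ?nnegrE ?dist_ge0 ?d1_ge0 // d2_le_d1.
Qed.

(** Column numbers are at most [n] and probes reach four columns to either side. The shift by 4
    avoids negative columns, and rows of length [n + 9] keep a probe from running into the next
    row. *)
Definition cell (CX CY : nat -> nat) p := ((CX p + 4) * (n + 9) + (CY p + 4))%N.

Definition probed (CX CY : nat -> nat) q k :=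
  ((CX q + k %/ 9) * (n + 9) + (CY q + k %% 9))%N.

Definition table_inv (D : nat -> R) M CX CY i (T2 : nat -> nat) :=
  (forall c p, T2 c = p.+1 -> [/\ (p < i)%N, M * M < 2 * D p & c = cell CX CY p]) /\
  (forall p, (p < i)%N -> M * M < 2 * D p -> T2 (cell CX CY p) = p.+1).

(** The second clause covers the probes made before the pair [(i, k)] in lexicographic order. *)
Definition exact_inv (D0 : nat -> R) CX CY (T2 : nat -> nat) i k (F : nat -> nat) (D : nat -> R) :=
  [/\ forall p, (p < n)%N -> [/\ (F p < n)%N, F p <> p, D p = sq p (F p) & D p <= D0 p] &
      forall q k' p, (q < n)%N -> (q < i)%N && (k' < 81)%N || (q == i) && (k' < k)%N ->
        T2 (probed CX CY q k') = p.+1 -> p <> q -> D p <= sq p q].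

(* Where [D p] is not the exact squared nearest-neighbour distance, it is at most half the
   square of the largest L1 nearest-neighbour distance [M], hence at most the squared optimum. *)
Definition exact_ok M (F : nat -> nat) (D : nat -> R) := forall p, (p < n)%N ->
  [/\ (F p < n)%N, F p <> p, D p = sq p (F p),
      forall z, (z < n)%N -> z <> p -> D p <= d1 p z ^+ 2 &
      2 * D p <= M * M \/ forall z, (z < n)%N -> z <> p -> D p <= sq p z].

(** Points in one cell are at L1 distance at most [M / 2]. If [p] and [q] were distinct, the nearest
    neighbour [y] of [p] would be within [M / 2] as well, so that twice its squared distance would
    be at most [M * M]. *)
Lemma table_cell (M : R) FN CX CY p q : near_ok n X Y FN M ->
  col_ok n X M CX -> col_ok n Y M CY -> (p < n)%N -> (q < n)%N ->
  M * M < 2 * sq p (FN p - 1)%N -> cell CX CY p = cell CX CY q -> p = q.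
Proof.
move=> [nr _] cX cY pn qn sp.
have [cpx _ ex] := cX p q pn qn; have [cpy _ ey] := cY p q pn qn.
have [cqx _ _] := cX q p qn pn; have [cqy _ _] := cY q p qn pn.
rewrite /cell => e.
have lt9 a : (a <= n)%N -> (a + 4 < n + 9)%N by lia.
have e1 : (CX p + 4 = CX q + 4)%N.
  have := congr1 (fun z => z %/ (n + 9))%N e.
  by rewrite !divnMDl ?addn_gt0 ?orbT // !divn_small ?lt9 // !addn0.
have {}ex := ex (ltac:(lia)); have {}ey := ey (ltac:(lia)).
have [//|pq] := eqVneq p q; exfalso.
have [y [Fy yn yp yM ymin]] := nr p pn; rewrite Fy subn1 /= in sp.
have qp : q <> p by apply/eqP; rewrite eq_sym.
have := ymin q qn qp; have := sq_le_d1 p y; have := d1_ge0 X Y p y.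
have : d1 p q <= M / 2 by rewrite /dist1; lra.
clear - sp; move: (d1 p q) (d1 p y) (sq p y) sp => u v w; nra.
Qed.

Lemma probe_hits (M : R) CX CY p q :
  col_ok n X M CX -> col_ok n Y M CY -> (p < n)%N -> (q < n)%N ->
  sq p q <= M * M -> 0 <= M ->
  exists2 k, (k < 81)%N & probed CX CY q k = cell CX CY p.
Proof.
move=> cX cY pn qn h M0.
have hx : `|X p - X q| <= M.
  rewrite -(ler_pXn2r (n := 2)) ?nnegrE // real_normK ?num_real //.
  apply: le_trans (_ : sq p q <= _); last by rewrite expr2.
  by rewrite /sq expr2 lerDl -expr2 sqr_ge0.
have hy : `|Y p - Y q| <= M.
  rewrite -(ler_pXn2r (n := 2)) ?nnegrE // real_normK ?num_real //.
  apply: le_trans (_ : sq p q <= _); last by rewrite expr2.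
  by rewrite /sq expr2 lerDr -expr2 sqr_ge0.
move: hx hy; rewrite !ler_norml => /andP[x1 x2] /andP[y1 y2].
have [_ a1 _] := cX p q pn qn; have [_ a2 _] := cX q p qn pn.
have [_ b1 _] := cY p q pn qn; have [_ b2 _] := cY q p qn pn.
have {}a1 := a1 (ltac:(lra)); have {}a2 := a2 (ltac:(lra)).
have {}b1 := b1 (ltac:(lra)); have {}b2 := b2 (ltac:(lra)).
(* The column offsets, between -4 and 4, are shifted to 0..8 and read as two digits in base 9. *)
exists ((CX p + 4 - CX q) * 9 + (CY p + 4 - CY q))%N; first by nia.
rewrite /probed /cell divnMDl // modnMDl divn_small; last lia.
rewrite modn_small; last lia.
congr (_ * _ + _)%N; lia.
Qed.

(** A point at distance greater than [M] from [p] cannot beat [D p], which is at most [M * M]; a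
    point within [M] has probed the cell of [p]. *)
Lemma exact_done (M : R) FN CX CY T2 F D : near_ok n X Y FN M ->
  col_ok n X M CX -> col_ok n Y M CY ->
  table_inv (fun p => sq p (FN p - 1)%N) M CX CY n T2 ->
  exact_inv (fun p => sq p (FN p - 1)%N) CX CY T2 n 0 F D -> exact_ok M F D.
Proof.
move=> [nr [x0 [y0 [x0n _ ME]]]] cX cY [_ tab] [ex1 ex2] p pn.
have M0 : 0 <= M by rewrite ME d1_ge0.
have [Fn Fp DE DD] := ex1 p pn.
have [y [Fy yn yp yM ymin]] := nr p pn; rewrite Fy subn1 /= in DD.
have D1 z : (z < n)%N -> z <> p -> D p <= d1 p z ^+ 2.
  move=> zn zp; apply: le_trans DD _; apply: le_trans (sq_le_d1 _ _) _.
  by rewrite ler_pXn2r ?nnegrE ?d1_ge0 //; exact: ymin.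
split=> //; have [lt|ge] := ltP (M * M) (2 * sq p y); last first.
  by left; apply: le_trans ge; rewrite ler_pM2l.
right=> z zn zp; have [h|h] := leP (sq p z) (M * M).
  have [k k81 kE] := probe_hits cX cY pn zn h M0.
  apply: (ex2 z k p zn); first by rewrite zn k81.
    by rewrite kE; apply: tab => //; rewrite Fy subn1.
  by move=> e; apply: zp.
apply: le_trans (ltW h); apply: le_trans DD _; apply: le_trans (sq_le_d1 _ _) _.
by rewrite expr2 ler_pM ?d1_ge0.
Qed.

End NearestMath.

Section NearestProg.
Variable R : realType.
Implicit Types (s : state R).

Lemma table_step n (X Y : nat -> R) (M : R) FN CX CY k T2 : near_ok n X Y FN M ->
  col_ok n X M CX -> col_ok n Y M CY -> (k < n)%N ->
  let D0 p := sq X Y p (FN p - 1) in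
  table_inv n D0 M CX CY k T2 ->
  table_inv n D0 M CX CY k.+1
    (if 2 * D0 k <= M * M then T2 else fupd T2 (cell n CX CY k) k.+1).
Proof.
move=> nr cX cY kn D0 [t1 t2]; case: ifP => h.
  split=> [c p /t1[pk ? ?]|p]; first by split=> //; exact: ltnW.
  by rewrite ltnS leq_eqVlt => /predU1P[->|]; [rewrite ltNge h|exact: t2].
have {}h : M * M < 2 * D0 k by rewrite ltNge h.
rewrite /fupd; split=> [c p|p].
  by case: eqP => [-> [<-]//|_ /t1[pk ? ?]]; split=> //; exact: ltnW.
rewrite ltnS leq_eqVlt => /predU1P[->|pk] hp; first by rewrite eqxx.
case: eqP => [e|_]; last exact: t2.
by have -> := table_cell nr cX cY (ltn_trans pk kn) kn hp e.
Qed.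

Lemma exact_skip n (X Y : nat -> R) D0 CX CY T2 i k F (D : nat -> R) :
  (forall p, T2 (probed n CX CY i k) = p.+1 -> p <> i -> D p <= sq X Y p i) ->
  exact_inv n X Y D0 CX CY T2 i k F D -> exact_inv n X Y D0 CX CY T2 i k.+1 F D.
Proof.
move=> H [e1 e2]; split=> // q k' p qn.
rewrite [(k' < k.+1)%N]ltnS [(k' <= k)%N]leq_eqVlt andb_orr => /or3P[c|/andP[/eqP-> /eqP->]|c].
- by apply: e2 => //; rewrite c.
- exact: H.
- by apply: e2 => //; rewrite c orbT.
Qed.

Lemma exact_upd n (X Y : nat -> R) D0 CX CY T2 i k F (D : nat -> R) p0 :
  (i < n)%N -> T2 (probed n CX CY i k) = p0.+1 -> p0 <> i -> sq X Y p0 i < D p0 ->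
  exact_inv n X Y D0 CX CY T2 i k F D ->
  exact_inv n X Y D0 CX CY T2 i k.+1 (fupd F p0 i)
    (fun j => if j == p0 then sq X Y p0 i else D j).
Proof.
move=> iN Tp pi lt [e1 e2].
have lower j : (if j == p0 then sq X Y p0 i else D j) <= D j.
  by case: eqP => // ->; exact: ltW.
apply: exact_skip => [p|].
  by rewrite Tp => -[<-] _; rewrite eqxx.
split=> [p pn|q k' p qn c Tc pq].
  have [Fn Fp DE DD] := e1 p pn; rewrite /fupd; case: eqP => [pp|//].
  by rewrite pp; split=> //; [exact: nesym|rewrite -pp; apply: ltW; rewrite pp;
    apply: lt_le_trans lt _; rewrite -pp].
by apply: le_trans (lower p) _; exact: e2 c Tc pq.
Qed.

Lemma exact_next n (X Y : nat -> R) D0 CX CY T2 i F (D : nat -> R) :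
  exact_inv n X Y D0 CX CY T2 i 81 F D -> exact_inv n X Y D0 CX CY T2 i.+1 0 F D.
Proof.
move=> [e1 e2]; split=> // q k' p qn; rewrite ltn0 andbF orbF => /andP[qi k81].
apply: e2 => //; rewrite k81 andbT; move: qi; rewrite ltnS leq_eqVlt.
by case/predU1P => [->|->]; rewrite ?eqxx ?orbT.
Qed.

Lemma runs_init_D : exists C, forall W n (X Y : nat -> R) s, (2 < n)%N ->
  (100 * (n * n) + 1000 < W)%N -> world n X Y s ->
  near_ok n X Y (imem s aFN) (rmem s rM 0) ->
  col_ok n X (rmem s rM 0) (imem s aCX) -> col_ok n Y (rmem s rM 0) (imem s aCY) ->
  (forall i, imem s aT2 i = 0%N) ->
  runs W (For vi vn init_D) s (C * cx n) (fun s' =>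
    table_inv n (fun p => sq X Y p (imem s aFN p - 1)) (rmem s rM 0) (imem s aCX)
      (imem s aCY) n (imem s' aT2) /\
    exact_inv n X Y (fun p => sq X Y p (imem s aFN p - 1)) (imem s aCX)
      (imem s aCY) (imem s' aT2) 0 0 (imem s' aF) (rmem s' rD)).
Proof.
eexists => W n X Y s n2 nW w nr cX cY T0; have [wn wX wY] := w.
set FN := imem s aFN in nr *; set M := rmem s rM 0 in nr cX cY *.
set CX := imem s aCX in cX *; set CY := imem s aCY in cY *.
pose D0 p := sq X Y p (FN p - 1).
apply: runs_weaken (@runs_for_wp _ W vi vn init_D s n (fun k s' =>
   table_inv n D0 M CX CY k (imem s' aT2) /\
   forall p, (p < k)%N -> imem s' aF p = (FN p - 1)%N /\ rmem s' rD p = D0 p) wn _ _ _ _)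
   (leqnn _) _.
- nia.
- by [].
- move=> s' f; rewrite (f.1 aT2 isT); split=> //.
  by split=> // c p; rewrite T0.
- move=> k s' kn si [I1 I2] f s'n; have [w1 w2 w3] := world_frame f isT w.
  have H := table_step nr cX cY kn I1.
  have [cxn _ _] := cX k k kn kn; have [cyn _ _] := cY k k kn kn.
  rewrite /= !si !s'n !(f.1 aFN isT) !(f.1 aCX isT) !(f.1 aCY isT) !(f.2 rM isT) !w2 !w3 !eqxx /=.
  rewrite -/FN -/CX -/CY -/M -/(sq X Y k (FN k - 1)) -/(D0 k).
  have c1 : ((CX k + 4) * (n + 9) <= (n + 4) * (n + 9))%N by rewrite leq_mul2r leq_add2r cxn orbT.
  have c2 : ((CX k + 4) * (n + 9) < W)%N by nia.
  have c3 : (cell n CX CY k < W)%N by rewrite /cell; nia.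
  have [y [Fy yn _ _ _]] := nr.1 k kn.
  have wok : (0 < W)%N /\ (FN k - 1 < W)%N by rewrite Fy; lia.
  have fin s3 : imem s3 aT2 = (if 2 * D0 k <= M * M then imem s' aT2
        else fupd (imem s' aT2) (cell n CX CY k) k.+1) ->
      imem s3 aF = fupd (imem s' aF) k (FN k - 1) ->
      (forall p, rmem s3 rD p = if p == k then D0 k else rmem s' rD p) ->
      table_inv n D0 M CX CY k.+1 (imem s3 aT2) /\
      forall p, (p < k.+1)%N -> imem s3 aF p = (FN p - 1)%N /\ rmem s3 rD p = D0 p.
    move=> -> -> DE; split=> // p; rewrite ltnS leq_eqVlt DE /fupd.
    by case: eqP => [-> _|_ /I2].
  wps; case: ifP fin => h fin; wps => // s3 g; apply: fin;
    rewrite ?(g.1 aT2 isT) ?(g.1 aF isT) ?(g.2 rD isT) /= ?addn1 //.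
- move=> s' [[I1 I2] _]; split=> //; split=> [p pn|q k' p qn]; last by rewrite !ltn0 !andbF.
  have [-> ->] := I2 p pn; have [y [Fy yn yp _ _]] := nr.1 p pn.
  by rewrite /D0 Fy subn1.
Qed.

Lemma runs_probe_loop : exists C, forall W n (X Y : nat -> R) D0 M s, (2 < n)%N ->
  (100 * (n * n) + 1000 < W)%N -> world n X Y s ->
  (forall p, (p < n)%N -> (imem s aCX p <= n)%N /\ (imem s aCY p <= n)%N) ->
  table_inv n D0 M (imem s aCX) (imem s aCY) n (imem s aT2) ->
  exact_inv n X Y D0 (imem s aCX) (imem s aCY) (imem s aT2) 0 0 (imem s aF) (rmem s rD) ->
  imem s v81 0 = 81%N ->
  runs W (For vi vn (For vk v81 probe)) s (C * cx n) (fun s' =>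
    exact_inv n X Y D0 (imem s aCX) (imem s aCY) (imem s aT2) n 0 (imem s' aF) (rmem s' rD)).
Proof.
eexists => W n X Y D0 M s n2 nW w cxy tab ex0 s81; have [wn wX wY] := w.
set T2 := imem s aT2 in tab ex0 *.
set CX := imem s aCX in cxy tab ex0 *; set CY := imem s aCY in cxy tab ex0 *.
pose J i k s' := exact_inv n X Y D0 CX CY T2 i k (imem s' aF) (rmem s' rD).
apply: runs_weaken (@runs_forC _ W vi vn (For vk v81 probe) s ((ccost probe + 20) * cx 81) n
  (fun i => J i 0%N) wn _ _ _ _) (leqnn _) _.
- nia.
- by [].
- by move=> s' f; rewrite /J (f.1 aF isT) (f.2 rD isT).
- move=> i s1 iN si I1 f1 s1n; have [w1 w2 w3] := world_frame f1 isT w.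
  have s181 : imem s1 v81 0 = 81%N by rewrite f1.1.
  apply: runs_weaken (@runs_for_wp _ W vk v81 probe s1 81 (J i) s181 _ _ _ _)
    _ _.
  + nia.
  + by [].
  + by move=> s' f; rewrite /J (f.1 aF isT) (f.2 rD isT).
  + move=> k s' k81 sk I f s'81.
    have E a : a != rD -> a != rd -> rmem s' a = rmem s1 a.
      by move=> h1 h2; apply: f.2; rewrite !inE /= (negPf h1) (negPf h2).
    have s'i : imem s' vi 0 = i by rewrite f.1.
    have s'n : imem s' vn 0 = n by rewrite f.1.
    have [cxi cyi] := cxy i iN.
    have c1 : ((CX i + k %/ 9) * (n + 9) <= (n + 9) * (n + 9))%N.
      by rewrite leq_mul2r leq_add // ?orbT // ltnW // ltn_divLR.
    have c2 : (k %% 9 < 9)%N by rewrite ltn_mod.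
    have c3 : ((CX i + k %/ 9) * (n + 9) < W)%N by nia.
    have c4 : (probed n CX CY i k < W)%N by rewrite /probed; nia.
    have c5 : (CX i + k %/ 9 < W)%N by nia.
    have c6 : (CY i + k %% 9 < W)%N by nia.
    have c7 : (n + 9 < W)%N by nia.
    have c8 : (k %/ 9 < W)%N by nia.
    have c9 : (k %% 9 < W)%N by nia.
    rewrite /= !s'i !sk !s'n !(f.1 aT2 isT) !(f.1 aCX isT) !(f.1 aCY isT).
    rewrite !(f1.1 aT2 isT) !(f1.1 aCX isT) !(f1.1 aCY isT) -/T2 -/CX -/CY.
    rewrite -/(probed n CX CY i k).
    wps; case T2E: (T2 (probed n CX CY i k)) => [|p] /=.
      move=> s3 g; rewrite /J (g.1 aF isT) (g.2 rD isT).
      by apply: exact_skip I => p; rewrite T2E.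
    have [pn _ _] := tab.1 _ _ T2E.
    rewrite !subSS !subn0 -eqn_leq; wps; case: eqP => pi.
      move=> s3 g; rewrite /J (g.1 aF isT) (g.2 rD isT).
      by apply: exact_skip I => p'; rewrite T2E pi => -[<-].
    rewrite !(E rX isT isT) !(E rY isT isT) !w2 !w3 -/(sq X Y p i); wps; case: ifP => h; wps => // s3 g;
      rewrite /J (g.1 aF isT) (g.2 rD isT) /= ?eqxx.
      by apply: exact_skip I => p'; rewrite T2E => -[<-].
    by apply: exact_upd I => //; rewrite ltNge h.
  + by rewrite leq_pmulr.
  + move=> s' [I f] s3 g; rewrite /J (g.1 aF isT) (g.2 rD isT).
    exact: exact_next.
- by move=> s' [].
Qed.

Lemma runs_nearest : exists C, forall W n (X Y : nat -> R) s, (2 < n)%N ->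
  (100 * (n * n) + 1000 < W)%N -> world n X Y s ->
  near_ok n X Y (imem s aFN) (rmem s rM 0) ->
  col_ok n X (rmem s rM 0) (imem s aCX) -> col_ok n Y (rmem s rM 0) (imem s aCY) ->
  (forall i, imem s aT2 i = 0%N) ->
  runs W nearest s (C * cx n) (fun s' =>
    exact_ok n X Y (rmem s rM 0) (imem s' aF) (rmem s' rD)).
Proof.
have [C1 H1] := runs_init_D; have [C2 H2] := runs_probe_loop.
eexists => W n X Y s n2 nW w nr cX cY T0.
apply: runs_seqC; first exact: runs_frame (H1 W n X Y s n2 nW w nr cX cY T0).
move=> s1 [[tab ex] f1]; have w1 := world_frame f1 isT w.
apply: runs_seqC.
  apply: runs_frame (runs_wpC _ (Q := fun s' => imem s' v81 0 = 81%N) _).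
  by rewrite /=; wps; nia.
move=> s2 [s2k f2]; have w2 := world_frame f2 isT w1.
have EX : imem s2 aCX = imem s aCX by rewrite f2.1 // f1.1.
have EY : imem s2 aCY = imem s aCY by rewrite f2.1 // f1.1.
rewrite -EX -EY -(f2.1 aT2 isT) -(f2.1 aF isT) -(f2.2 rD isT) in tab ex.
have cxy p : (p < n)%N -> (imem s2 aCX p <= n)%N /\ (imem s2 aCY p <= n)%N.
  by move=> pn; rewrite EX EY; case: (cX p p pn pn); case: (cY p p pn pn).
apply: runs_weaken (H2 W n X Y _ _ s2 n2 nW w2 cxy tab ex s2k) (leqnn _) _ => s3 ex3.
by rewrite EX EY in tab ex3; exact: exact_done nr cX cY tab ex3.
Qed.

End NearestProg.

(** * Stars *)

Section Stars.
Variables (n : nat) (F : nat -> nat).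
Hypothesis FP : forall p, (p < n)%N -> (F p < n)%N /\ F p <> p.
Implicit Types (ct cn : nat -> nat).

Definition is_leaf (t v c : nat) : bool := (t == c.+1) && (v != c).

Definition nleaves ct c := (\sum_(v < n) is_leaf (ct v) v c)%N.

Lemma fupd_eq T i v : fupd T i v i = v. Proof. by rewrite /fupd eqxx. Qed.

Lemma fupd_ne T i v j : j <> i -> fupd T i v j = T j.
Proof. by rewrite /fupd => /eqP/negPf ->. Qed.

Lemma is_leaf_self t c : is_leaf t c c = false.
Proof. by rewrite /is_leaf eqxx andbF. Qed.

Lemma is_leaf_succ v c : v <> c -> is_leaf c.+1 v c = true.
Proof. by move=> /eqP vc; rewrite /is_leaf eqxx. Qed.

Lemma is_leaf_other t v c : t <> c.+1 -> is_leaf t v c = false.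
Proof. by move=> /eqP/negPf tc; rewrite /is_leaf tc. Qed.

(* [ct v] is 0 when [v] is in no star yet, and one plus the centre of its star otherwise. *)
Definition star_inv k ct cn := [/\
  forall v c, (v < n)%N -> ct v = c.+1 -> (c < n)%N /\ ct c = c.+1,
  forall c, (c < n)%N -> ct c = c.+1 -> cn c = nleaves ct c /\ (0 < nleaves ct c)%N,
  forall v, (v < k)%N -> ct v <> 0%N &
  forall v c, (v < n)%N -> ct v = c.+1 -> v <> c -> F v = c \/ F c = v].

(** Written as a balance, since a reassignment may remove a leaf and subtraction on [nat] is
    truncated. *)
Lemma nleaves_upd ct x t c : (x < n)%N ->
  (nleaves (fupd ct x t) c + is_leaf (ct x) x c = nleaves ct c + is_leaf t x c)%N.
Proof.
move=> xn; pose S := (\sum_(v < n | v != Ordinal xn) is_leaf (ct v) v c)%N.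
have -> : nleaves ct c = (is_leaf (ct x) x c + S)%N.
  by rewrite /nleaves (bigD1 (Ordinal xn)).
have -> : nleaves (fupd ct x t) c = (is_leaf t x c + S)%N.
  rewrite /nleaves (bigD1 (Ordinal xn)) //= {1}/fupd eqxx; congr addn.
  by apply: eq_bigr => v; rewrite -val_eqE /= /fupd => /negPf ->.
exact: addnCAC.
Qed.

Lemma nleaves_max ct c : (nleaves ct c <= n)%N.
Proof.
rewrite /nleaves -[leqRHS]card_ord -sum1_card leq_sum // => v _; exact: leq_b1.
Qed.

Lemma nleaves_two ct v w c : (v < n)%N -> (w < n)%N -> v <> w -> ct v = c.+1 ->
  ct w = c.+1 -> v <> c -> w <> c -> (1 < nleaves ct c)%N.
Proof.
move=> vn wn vw ev ew /eqP vc /eqP wc; rewrite /nleaves (bigD1 (Ordinal vn)) //=.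
rewrite (bigD1 (Ordinal wn)) /=; last by rewrite -val_eqE /= eq_sym; apply/eqP.
by rewrite /is_leaf ev ew !eqxx vc wc.
Qed.

Lemma nleaves_none ct c : (forall v, (v < n)%N -> ct v <> c.+1) -> nleaves ct c = 0%N.
Proof.
move=> H; rewrite /nleaves big1 // => v _; rewrite /is_leaf.
by have /eqP/negPf -> := H v (ltn_ord v).
Qed.

Lemma nleaves_eq ct ct' c : (forall v, (v < n)%N -> ct' v <> ct v ->
  is_leaf (ct v) v c = false /\ is_leaf (ct' v) v c = false) ->
  nleaves ct' c = nleaves ct c.
Proof.
move=> H; apply: eq_bigr => v _; have [->//|/eqP ne] := eqVneq (ct' v) (ct v).
by have [-> ->] := H v (ltn_ord v) ne.
Qed.

Lemma star_skip k ct cn : ct k <> 0%N -> star_inv k ct cn -> star_inv k.+1 ct cn.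
Proof.
move=> h [a b c d]; split=> // v; rewrite ltnS leq_eqVlt => /predU1P[->//|]; exact: c.
Qed.

Variables (k : nat) (ct cn : nat -> nat).
Hypotheses (kn : (k < n)%N) (ck : ct k = 0%N) (inv : star_inv k ct cn).
Let q := F k.

Let qn : (q < n)%N. Proof. by case: (FP kn). Qed.
Let qk : q <> k. Proof. by case: (FP kn). Qed.
Let qk' : (q == k) = false. Proof. exact/eqP. Qed.

Let done ct' : (forall v, ct' v = 0%N -> ct v = 0%N) -> ct' k <> 0%N ->
  forall v, (v < k.+1)%N -> ct' v <> 0%N.
Proof.
move=> H h v; rewrite ltnS leq_eqVlt => /predU1P[->//|vk] /H.
by have [_ _ c _] := inv; exact: c.
Qed.

Lemma star_new : ct q = 0%N ->
  star_inv k.+1 (fupd (fupd ct q q.+1) k q.+1) (fupd cn q 1%N).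
Proof.
move=> cq; have [a b _ d] := inv.
have ne v c : (v < n)%N -> ct v = c.+1 -> c <> q /\ c <> k.
  by move=> vn /(a _ _ vn)[_ e]; split=> cc; rewrite cc ?cq ?ck in e.
have L c := nleaves_upd ct q.+1 c qn; have L' c := nleaves_upd (fupd ct q q.+1) q.+1 c kn.
have Lq : nleaves ct q = 0%N by apply: nleaves_none => v vn /(ne _ _ vn)[].
have L1 : nleaves (fupd ct q q.+1) q = 0%N by have := L q; rewrite !is_leaf_self !addn0 Lq.
split.
- move=> v c vn; rewrite /fupd; case: eqP => [_ [<-]|vk]; first by rewrite qk' eqxx.
  case: eqP => [_ [<-]|vq e]; first by rewrite qk' eqxx.
  have [cn' cc] := a v c vn e; have [/eqP/negPf -> /eqP/negPf ->] := ne v c vn e.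
  by [].
- move=> c cn0; rewrite -/(fupd ct q q.+1) -/(fupd (fupd ct q q.+1) k q.+1) -/(fupd cn q 1%N).
  have [->|/eqP cq'] := eqVneq c q.
    have := L' q; rewrite L1 fupd_ne; last exact: nesym.
    rewrite ck is_leaf_other // is_leaf_succ; last exact: nesym.
    by rewrite fupd_eq addn0 => -> _.
  have ck' : c <> k -> fupd (fupd ct q q.+1) k q.+1 c = ct c by move=> ?; rewrite !fupd_ne.
  have [->|/eqP ckn] := eqVneq c k; first by rewrite fupd_eq => -[] /qk.
  rewrite ck' // => /(b _ cn0)[b1 b2]; rewrite fupd_ne // b1 (nleaves_eq (ct := ct)) //.
  move=> v vn; have [->|/eqP vk] := eqVneq v k.
    by rewrite fupd_eq ck !is_leaf_other // => -[] /esym.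
  rewrite (fupd_ne _ _ vk); have [->|/eqP vq] := eqVneq v q; last by rewrite fupd_ne.
  by rewrite fupd_eq cq !is_leaf_other // => -[] /esym.
- apply: done => [v|]; rewrite /fupd ?eqxx //.
  by do 2 case: ifP => // _.
- move=> v c vn; rewrite /fupd; case: eqP => [-> [<-] _|vk]; first by left.
  by case: eqP => [-> [<-]|vq] //; exact: d.
Qed.

Lemma star_attach : ct q = q.+1 ->
  star_inv k.+1 (fupd ct k q.+1) (fupd cn q (cn q).+1).
Proof.
move=> cq; have [a b _ d] := inv.
have ne v c : (v < n)%N -> ct v = c.+1 -> c <> k.
  by move=> vn /(a _ _ vn)[_ e] cc; rewrite cc ck in e.
have L c := nleaves_upd ct q.+1 c kn.
split.
- move=> v c vn; rewrite /fupd; case: eqP => [_ [<-]|vk]; first by rewrite qk'.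
  move=> e; have [cn' cc] := a v c vn e; have /eqP/negPf -> := ne v c vn e.
  by [].
- move=> c cn0; have [->|/eqP cq'] := eqVneq c q.
    have := L q; rewrite ck is_leaf_other // is_leaf_succ; last exact: nesym.
    have [-> h] := b q qn cq.
    by rewrite fupd_eq addn0 addn1 => ->.
  have [->|/eqP ckn] := eqVneq c k; first by rewrite fupd_eq => -[] /qk.
  rewrite fupd_ne // => /(b _ cn0)[b1 b2]; rewrite fupd_ne // b1 (nleaves_eq (ct := ct)) //.
  move=> v vn; have [->|/eqP vk] := eqVneq v k; last by rewrite fupd_ne.
  by rewrite fupd_eq ck !is_leaf_other // => -[] /esym.
- apply: done => [v|]; rewrite /fupd ?eqxx //.
  by case: ifP.
- move=> v c vn; rewrite /fupd; case: eqP => [-> [<-] _|vk]; first by left.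
  exact: d.
Qed.

Variable c : nat.
Hypotheses (cq : ct q = c.+1) (cneq : c <> q).

Let cnn : (c < n)%N. Proof. by have [a _ _ _] := inv; case: (a q c qn cq). Qed.
Let cc : ct c = c.+1. Proof. by have [a _ _ _] := inv; case: (a q c qn cq). Qed.
Let ck2 : (c == k) = false. Proof. by apply/eqP => e; move: cc; rewrite e ck. Qed.
Let cq2 : (c == q) = false. Proof. exact/eqP. Qed.
Let qc2 : (q == c) = false. Proof. by rewrite eq_sym. Qed.
Let kc2 : (k == c) = false. Proof. by rewrite eq_sym. Qed.

Let ne v e : (v < n)%N -> ct v = e.+1 -> e <> q /\ e <> k.
Proof.
have [a _ _ _] := inv => vn /(a _ _ vn)[_ h]; split=> ee; rewrite ee ?ck // in h.
by rewrite cq in h; case: h.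
Qed.

Let kc : k <> c. Proof. by apply/eqP; rewrite kc2. Qed.

Let Lq : nleaves ct q = 0%N.
Proof. by apply: nleaves_none => v vn /(ne vn)[]. Qed.

(** Here [q] is the only leaf of [c], and losing it would leave [c] alone. The star is re-centred at
    [q], with leaves [c] and [k]. *)
Lemma star_swap : (cn c <= 1)%N ->
  star_inv k.+1 (fupd (fupd (fupd ct q q.+1) c q.+1) k q.+1) (fupd cn q 2%N).
Proof.
move=> c1; have [a b _ d] := inv; have [bc1 bc2] := b c cnn cc.
have L e := nleaves_upd ct q.+1 e qn.
have L2 e := nleaves_upd (fupd ct q q.+1) q.+1 e cnn.
have L3 e := nleaves_upd (fupd (fupd ct q q.+1) c q.+1) q.+1 e kn.
have onlyq v : (v < n)%N -> ct v = c.+1 -> v <> c -> v = q.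
  move=> vn vc vne; have [//|/eqP vq] := eqVneq v q.
  by have := nleaves_two vn qn vq vc cq vne (nesym cneq); lia.
split.
- move=> v e vn; rewrite /fupd; case: eqP => [_ [<-]|vk]; first by rewrite qk' qc2 eqxx.
  case: eqP => [_ [<-]|vc]; first by rewrite qk' qc2 eqxx.
  case: eqP => [_ [<-]|vq h]; first by rewrite qk' qc2 eqxx.
  have [en ee] := a v e vn h; have [/eqP/negPf -> /eqP/negPf ->] := ne vn h.
  case: eqP => // ec; case: vq; apply: onlyq => //; by rewrite -ec.
- move=> e en; have [->|/eqP eq] := eqVneq e q.
    have := L3 q; have := L2 q; have := L q; rewrite !is_leaf_self !is_leaf_succ //; last exact: nesym.
    rewrite (fupd_ne _ _ kc) (fupd_ne _ _ (nesym qk)) (fupd_ne _ _ cneq) ck cc fupd_eq.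
    rewrite (is_leaf_other (t := 0%N)) // is_leaf_other; last by case.
    by rewrite Lq; lia.
  have [->|/eqP ek] := eqVneq e k; first by rewrite fupd_eq => -[] /qk.
  rewrite (fupd_ne _ _ ek); have [->|/eqP ec] := eqVneq e c.
    by rewrite fupd_eq => -[] /nesym.
  rewrite !fupd_ne // => /(b _ en)[b1 b2]; rewrite b1 (nleaves_eq (ct := ct)) //.
  move=> v vn; have [->|/eqP vk] := eqVneq v k.
    by rewrite fupd_eq ck !is_leaf_other // => -[] /esym.
  rewrite (fupd_ne _ _ vk); have [->|/eqP vc] := eqVneq v c.
    by rewrite fupd_eq cc !is_leaf_other // => -[] /esym.
  rewrite (fupd_ne _ _ vc); have [->|/eqP vq] := eqVneq v q; last by rewrite fupd_ne.
  by rewrite fupd_eq cq !is_leaf_other // => -[] /esym.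
- apply: done => [v|]; rewrite /fupd ?eqxx //.
  by do 3 case: ifP => // _.
- move=> v e vn; rewrite /fupd; case: eqP => [-> [<-] _|vk]; first by left.
  case: eqP => [-> [<-] _|vc].
    by case: (d q c qn cq (nesym cneq)); [right|left].
  by case: eqP => [-> [<-]|vq] //; exact: d.
Qed.

(** Here [c] keeps another leaf, so [q] may leave its star and become the centre of a new one with
    leaf [k]. *)
Lemma star_steal : (1 < cn c)%N ->
  star_inv k.+1 (fupd (fupd ct q q.+1) k q.+1) (fupd (fupd cn c (cn c - 1)%N) q 1%N).
Proof.
move=> c1; have [a b _ d] := inv; have [bc1 bc2] := b c cnn cc.
have L e := nleaves_upd ct q.+1 e qn.
have L3 e := nleaves_upd (fupd ct q q.+1) q.+1 e kn.
split.
- move=> v e vn; rewrite /fupd; case: eqP => [_ [<-]|vk]; first by rewrite qk' eqxx.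
  case: eqP => [_ [<-]|vq h]; first by rewrite qk' eqxx.
  by have [en ee] := a v e vn h; have [/eqP/negPf -> /eqP/negPf ->] := ne vn h.
- move=> e en; have [->|/eqP eq] := eqVneq e q.
    have := L3 q; have := L q; rewrite !is_leaf_self !is_leaf_succ; last exact: nesym.
    rewrite (fupd_ne _ _ (nesym qk)) ck is_leaf_other // !fupd_eq Lq; lia.
  have [->|/eqP ek] := eqVneq e k; first by rewrite fupd_eq => -[] /qk.
  rewrite !(fupd_ne _ _ ek) !(fupd_ne _ _ eq); have [->|/eqP ec] := eqVneq e c.
    have := L3 c; have := L c; rewrite (fupd_ne _ _ (nesym qk)) ck cq.
    rewrite !(is_leaf_other (t := q.+1)); try by move=> -[]; apply: nesym.
    rewrite (is_leaf_other (t := 0%N)) // is_leaf_succ; last exact: nesym.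
    by rewrite fupd_eq; lia.
  move=> /(b _ en)[b1 b2]; rewrite fupd_ne // b1 (nleaves_eq (ct := ct)) //.
  move=> v vn; have [->|/eqP vk] := eqVneq v k.
    by rewrite fupd_eq ck !is_leaf_other // => -[] /esym.
  rewrite (fupd_ne _ _ vk); have [->|/eqP vq] := eqVneq v q; last by rewrite fupd_ne.
  by rewrite fupd_eq cq !is_leaf_other // => -[] /esym.
- apply: done => [v|]; rewrite /fupd ?eqxx //.
  by do 2 case: ifP => // _.
- move=> v e vn; rewrite /fupd; case: eqP => [-> [<-] _|vk]; first by left.
  by case: eqP => [-> [<-]|vq] //; exact: d.
Qed.

End Stars.

Notation vps := 40%N.
Notation vsp := 41%N.
Notation aTP := 42%N.
Notation vt2 := 43%N.
Notation aCT := 44%N.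
Notation aCN := 45%N.
Notation vF := 46%N.
Notation vC := 47%N.

Definition argmax_body : cmd :=
  If (TRLe (RGet rD (ivar vi)) (RGet rD (ivar vps))) Skip (iset0 vps (ivar vi)).

Definition special_body : cmd :=
  If (eqt (ivar vi) (ivar vps)) Skip
    (RSet rd (ICst 0) (sqdist_e (ivar vi) (ivar vps)) ;;
     If (TAnd (TRLe (RGet rd (ICst 0)) (RGet rD (ivar vps)))
              (TRLe (RGet rD (ivar vps)) (RGet rd (ICst 0)))) Skip (iset0 vsp (ICst 0))).

Definition pos_body : cmd :=
  ISet aTP (ivar vt2) (ivar vi) ;; iset0 vt2 (IGet aNX (ivar vt2)).

Definition one_star : cmd := ISet aCT (ivar vi) (iadd (ivar vps) (ICst 1)).

(** An unassigned point always joins the star of its neighbour, which becomes the centre if it is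
    not. The leaf count [aCN] tells whether the star that the neighbour leaves survives; no star is
    ever listed, so a step takes constant time. *)
Definition star_body : cmd :=
  If (TILe (ICst 1) (IGet aCT (ivar vi))) Skip
    (iset0 vF (IGet aF (ivar vi)) ;;
     If (TILe (IGet aCT (ivar vF)) (ICst 0))
       (ISet aCT (ivar vF) (iadd (ivar vF) (ICst 1)) ;;
        ISet aCT (ivar vi) (iadd (ivar vF) (ICst 1)) ;;
        ISet aCN (ivar vF) (ICst 1))
       (iset0 vC (isub (IGet aCT (ivar vF)) (ICst 1)) ;;
        If (eqt (ivar vC) (ivar vF))
          (ISet aCT (ivar vi) (iadd (ivar vF) (ICst 1)) ;;
           ISet aCN (ivar vF) (iadd (IGet aCN (ivar vF)) (ICst 1)))
          (If (TILe (IGet aCN (ivar vC)) (ICst 1))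
             (ISet aCT (ivar vF) (iadd (ivar vF) (ICst 1)) ;;
              ISet aCT (ivar vC) (iadd (ivar vF) (ICst 1)) ;;
              ISet aCT (ivar vi) (iadd (ivar vF) (ICst 1)) ;;
              ISet aCN (ivar vF) (ICst 2))
             (ISet aCN (ivar vC) (isub (IGet aCN (ivar vC)) (ICst 1)) ;;
              ISet aCT (ivar vF) (iadd (ivar vF) (ICst 1)) ;;
              ISet aCT (ivar vi) (iadd (ivar vF) (ICst 1)) ;;
              ISet aCN (ivar vF) (ICst 1))))).

Definition assign_stars : cmd :=
  If (TILe (ICst 1) (ivar vsp)) (For vi vn one_star) (For vi vn star_body).

(** The tour is numbered from the point with the largest neighbour distance. Should that point be
    the only centre, its two tour edges are the first and the last one and drop out of the curve of
    the leaves. *)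
Definition choose_stars : cmd :=
  iset0 vps (ICst 0) ;; For vi vn argmax_body ;;
  iset0 vsp (ICst 1) ;; For vi vn special_body ;;
  iset0 vt2 (ivar vps) ;; For vi vn pos_body ;; assign_stars.

Section TourEnum.
Variable R : realType.
Variables (n : nat) (X Y : nat -> R) (NX : nat -> nat) (sp : {perm 'I_n}).
Hypothesis NXE : forall i : 'I_n, NX i = sp i :> nat.
Hypothesis one : #|porbits sp| = 1%N.

Lemma iter_tour i (p : 'I_n) : iter i NX p = iter i sp p :> nat.
Proof. by elim: i => //= i ->. Qed.

Lemma porbit_full p : #|porbit sp p| = n.
Proof.
have /eqP/cards1P[O OE] := one.
have full x : porbit sp x = O.
  by apply/set1P; rewrite -OE; exact: imset_f.
rewrite -[RHS]card_ord -cardsT; congr #|pred_of_set _|; apply/setP => x.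
by rewrite inE -eq_porbit_mem !full eqxx.
Qed.

Lemma tour_lt i p : (p < n)%N -> (iter i NX p < n)%N.
Proof. by move=> pn; rewrite (iter_tour i (Ordinal pn)). Qed.

Lemma tour_inj i j p : (p < n)%N -> (i < n)%N -> (j < n)%N ->
  iter i NX p = iter j NX p -> i = j.
Proof.
move=> pn iN jn; rewrite !(iter_tour _ (Ordinal pn)) => /ord_inj e.
have u := uniq_traject_porbit sp (Ordinal pn); rewrite porbit_full in u.
apply/eqP; rewrite -(nth_uniq (Ordinal pn) _ _ u) ?size_traject //.
by rewrite !nth_traject // e.
Qed.

Lemma tour_close p : (p < n)%N -> iter n NX p = p.
Proof.
move=> pn; rewrite (iter_tour n (Ordinal pn)).
by rewrite -[X in iter X](porbit_full (Ordinal pn)) iter_porbit.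
Qed.

Lemma tour_sum p (f : nat -> nat -> R) : (p < n)%N ->
  \sum_(i < n) f i (sp i) = \sum_(i < n) f (iter i NX p) (iter i.+1 NX p).
Proof.
move=> pn; pose h (i : 'I_n) := iter i sp (Ordinal pn).
have hi : injective h.
  move=> i j e; apply: ord_inj; apply: (tour_inj (p := p)) => //.
  by rewrite !(iter_tour _ (Ordinal pn)); congr (nat_of_ord _).
rewrite (reindex h) /=; last by exists (invF hi) => i _; rewrite ?f_invF ?invF_f.
by apply: eq_bigr => i _; rewrite !(iter_tour _ (Ordinal pn)) /= NXE.
Qed.

End TourEnum.

Section StarProg.
Variable R : realType.
Implicit Types (s : state R).

Definition star_ok n (F ct : nat -> nat) :=
  (forall v, (v < n)%N -> exists c, [/\ ct v = c.+1, (c < n)%N, ct c = c.+1 &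
     v <> c -> F v = c \/ F c = v]) /\
  (forall c, (c < n)%N -> ct c = c.+1 -> exists v, [/\ (v < n)%N, v <> c & ct v = c.+1]).

Lemma star_done n F ct cn : star_inv n F n ct cn -> star_ok n F ct.
Proof.
move=> [a b c d]; split=> [v vn|e en ee].
  case cv: (ct v) (c v vn) => [//|e] _; have [en ee] := a v e vn cv.
  by exists e; split=> //; exact: d.
have [_ pos] := b e en ee; apply: contrapT => no.
suff z : nleaves n ct e = 0%N by rewrite z in pos.
rewrite /nleaves big1 // => v _; rewrite /is_leaf; case: eqP => // ce.
have [//|/eqP ve] := eqVneq (nat_of_ord v) e.
by case: no; exists v.
Qed.

Lemma runs_star_loop : exists C, forall W n s, (2 < n)%N -> (100 * n + 1000 < W)%N ->
  imem s vn 0 = n ->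
  (forall p, (p < n)%N -> (imem s aF p < n)%N /\ imem s aF p <> p) ->
  (forall i, imem s aCT i = 0%N) ->
  runs W (For vi vn star_body) s (C * cx n) (fun s' => star_ok n (imem s aF) (imem s' aCT)).
Proof.
eexists => W n s n2 nW sn FP CT0; set F := imem s aF in FP *.
have star0 ct cn : (forall i, ct i = 0%N) -> star_inv n F 0 ct cn.
  by move=> h; split=> // [v c _|c _|v c _]; rewrite h.
apply: runs_weaken (@runs_for_wp _ W vi vn star_body s n (fun k s' =>
  star_inv n F k (imem s' aCT) (imem s' aCN)) sn _ _ _ _) (leqnn _) _.
- lia.
- by [].
- by move=> s' f; rewrite (f.1 aCT isT); exact: star0.
- move=> k s' kn si I f s'n; rewrite /= !si.
  set ct := imem s' aCT in I *; set cn := imem s' aCN in I *.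
  have FE : imem s' aF = F by rewrite f.1.
  have [qn qk] := FP k kn; rewrite !FE.
  wps; case: ifP => ck /=.
    by move=> s3 g; rewrite (g.1 aCT isT) (g.1 aCN isT); apply: star_skip I; lia.
  have {}ck : ct k = 0%N by lia.
  have ctb : (ct (F k) - 1 < W)%N.
    case e: (ct (F k)) => [|c]; first by lia.
    by have [ia _ _ _] := I; have [] := ia _ _ qn e; lia.
  wps; case: ifP => cq; wps.
    move=> s3 g; rewrite (g.1 aCT isT) (g.1 aCN isT) /= !addn1.
    by apply: (star_new FP kn ck I); lia.
  case cqE: (ct (F k)) cq => [|c] cq; first by rewrite leqnn in cq.
  have [ia ib _ _] := I.
  have [cnn cc] := ia _ _ qn cqE; have [bc _] := ib _ cnn cc.
  have bq : (cn (F k) <= n)%N \/ c <> F k.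
    by have [e|/eqP] := eqVneq c (F k); [left; rewrite -e bc nleaves_max|right].
  have bcn : (cn c <= n)%N by rewrite bc nleaves_max.
  rewrite !subSS !subn0 -eqn_leq; wps; case: eqP => cF.
    have {}bq : (cn (F k) <= n)%N by case: bq.
    wps => s3 g; rewrite (g.1 aCT isT) (g.1 aCN isT) /= !addn1.
    by apply: (star_attach FP kn ck I); rewrite cqE cF.
  wps; case: ifP => c1; wps => s3 g; rewrite (g.1 aCT isT) (g.1 aCN isT) /= !addn1.
    exact: (star_swap FP kn ck I cqE cF).
  by apply: (star_steal FP kn ck I cqE cF); rewrite ltnNge c1.
- by move=> s' [I _]; exact: star_done I.
Qed.

Lemma runs_argmax W n s : (n + 10 < W)%N -> (0 < n)%N -> imem s vn 0 = n -> imem s vps 0 = 0%N ->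
  runs W (For vi vn argmax_body) s ((ccost argmax_body + 20) * cx n) (fun s' =>
    (imem s' vps 0 < n)%N /\ forall v, (v < n)%N -> rmem s rD v <= rmem s rD (imem s' vps 0)).
Proof.
move=> nW n0 sn sp0.
apply: runs_weaken (@runs_for_wp _ W vi vn argmax_body s n (fun k s' =>
  (imem s' vps 0 < n)%N /\ forall v, (v < k)%N -> rmem s rD v <= rmem s rD (imem s' vps 0))
  sn _ _ _ _) (leqnn _) _ => //.
- lia.
- by move=> s' f; rewrite (f.1 vps isT) sp0.
- move=> k s' kn si [I1 I2] f s'n; rewrite /= !si !(f.2 rD isT).
  wps; case: ifP => h; wps => s3 g; rewrite (g.1 vps isT) /=; split=> // v;
    rewrite ltnS leq_eqVlt => /predU1P[->//|vk].
  + exact: I2.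
  + by apply: le_trans (I2 v vk) _; apply: ltW; rewrite ltNge h.
- by move=> s' [].
Qed.

Lemma runs_special W n (X Y : nat -> R) s p : (n + 10 < W)%N -> world n X Y s ->
  imem s vps 0 = p -> imem s vsp 0 = 1%N ->
  runs W (For vi vn special_body) s ((ccost special_body + 20) * cx n) (fun s' =>
    if (0 < imem s' vsp 0)%N then
      forall v, (v < n)%N -> v <> p -> sq X Y v p = rmem s rD p
    else exists v, [/\ (v < n)%N, v <> p & sq X Y v p <> rmem s rD p]).
Proof.
move=> nW w sp s1; have [wn wX wY] := w.
apply: runs_weaken (@runs_for_wp _ W vi vn special_body s n (fun k s' =>
    if (0 < imem s' vsp 0)%N then
      forall v, (v < k)%N -> v <> p -> sq X Y v p = rmem s rD p
    else exists v, [/\ (v < n)%N, v <> p & sq X Y v p <> rmem s rD p])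
  wn _ _ _ _) (leqnn _) _ => //.
- lia.
- by move=> s' f; rewrite (f.1 vsp isT) s1.
- move=> k s' kn si I f s'n; have [_ w2 w3] := world_frame f isT w.
  rewrite /= !si !(f.2 rD isT) !(f.1 vps isT) sp -eqn_leq !w2 !w3 -/(sq X Y k p) -eq_le.
  wps; case: eqP => kp; wps.
    move=> s3 g; rewrite (g.1 vsp isT) /=; case: ifP I => // _ I v.
    by rewrite ltnS leq_eqVlt => /predU1P[->|/I].
  case: eqP => e; wps => s3 g; rewrite (g.1 vsp isT) /=.
    by case: ifP I => // _ I v; rewrite ltnS leq_eqVlt => /predU1P[->|/I].
  by exists k.
- by move=> s' [].
Qed.

Lemma runs_pos W n (sp : {perm 'I_n}) s p : (n + 10 < W)%N ->
  imem s vn 0 = n -> imem s vt2 0 = p -> (p < n)%N ->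
  (forall i : 'I_n, imem s aNX i = sp i :> nat) -> #|porbits sp| = 1%N ->
  runs W (For vi vn pos_body) s ((ccost pos_body + 20) * cx n) (fun s' =>
    forall i, (i < n)%N -> imem s' aTP (iter i (imem s aNX) p) = i).
Proof.
move=> nW sn st pn NXE one; set NX := imem s aNX in NXE *.
apply: runs_weaken (@runs_for_wp _ W vi vn pos_body s n (fun k s' =>
    imem s' vt2 0 = iter k NX p /\
    forall i, (i < k)%N -> imem s' aTP (iter i NX p) = i)
  sn _ _ _ _) (leqnn _) _ => //.
- lia.
- by move=> s' f; rewrite (f.1 vt2 isT).
- move=> k s' kn si [I1 I2] f s'n; rewrite /= !si !I1 (f.1 aNX isT) -/NX.
  wps => s3 g; rewrite (g.1 vt2 isT) (g.1 aTP isT) /=.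
  split=> // i ik; case: eqP => [e|ne].
    by rewrite (tour_inj NXE one pn _ kn e) //; lia.
  by apply: I2; move: ik; rewrite ltnS leq_eqVlt => /predU1P[e|//]; case: ne; rewrite e.
- by move=> s' [[]].
Qed.

Definition plan_ok n (X Y : nat -> R) (F NX : nat -> nat) (D : nat -> R) p (TP ct : nat -> nat) :=
  [/\ (p < n)%N, forall v, (v < n)%N -> D v <= D p,
      forall i, (i < n)%N -> TP (iter i NX p) = i &
      ((forall v, (v < n)%N -> v <> p -> sq X Y v p = D p) /\
        forall v, (v < n)%N -> ct v = p.+1) \/
      ((exists v, [/\ (v < n)%N, v <> p & sq X Y v p <> D p]) /\ star_ok n F ct)].

Lemma runs_one_star W n s : (n + 10 < W)%N -> imem s vn 0 = n ->
  (imem s vps 0 < n)%N ->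
  runs W (For vi vn one_star) s ((ccost one_star + 20) * cx n) (fun s' =>
    forall v, (v < n)%N -> imem s' aCT v = (imem s vps 0).+1).
Proof.
move=> nW sn sp.
apply: runs_weaken (@runs_for_wp _ W vi vn one_star s n (fun k s' =>
    forall v, (v < k)%N -> imem s' aCT v = (imem s vps 0).+1)
  sn _ _ _ _) (leqnn _) _ => //.
- lia.
- move=> k s' kn si I f s'n; rewrite /= !si (f.1 vps isT) addn1.
  wps => s3 g v; rewrite (g.1 aCT isT) /= ltnS leq_eqVlt.
  by case: eqP => [->//|_] /I.
- by move=> s' [].
Qed.

Lemma runs_choose_stars : exists C, forall W n (X Y : nat -> R) (sp : {perm 'I_n}) M s,
  (2 < n)%N -> (100 * n + 1000 < W)%N -> world n X Y s ->
  (forall i : 'I_n, imem s aNX i = sp i :> nat) -> #|porbits sp| = 1%N ->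
  exact_ok n X Y M (imem s aF) (rmem s rD) -> (forall i, imem s aCT i = 0%N) ->
  runs W choose_stars s (C * cx n) (fun s' =>
    plan_ok n X Y (imem s aF) (imem s aNX) (rmem s rD) (imem s' vps 0) (imem s' aTP)
      (imem s' aCT)).
Proof.
have [C HC] := runs_star_loop.
eexists => W n X Y sp M s n2 nW w NXE one ex CT0; have [wn _ _] := w.
have nW' : (n + 10 < W)%N by lia.
have n0 : (0 < n)%N by lia.
apply: runs_seqC.
  apply: runs_frame (runs_wpC _ (Q := fun s' => imem s' vps 0 = 0%N) _).
  by rewrite /=; wps.
move=> s1 [s1p f1]; have w1 := world_frame f1 isT w; have [w1n _ _] := w1.
apply: runs_seqC; first exact: runs_frame (runs_argmax nW' n0 w1n s1p).
move=> s2 [[s2p mx] f2]; have w2 := world_frame f2 isT w1.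
set p := imem s2 vps 0 in s2p mx.
rewrite (f1.2 rD isT) in mx.
apply: runs_seqC.
  apply: runs_frame (runs_wpC _ (Q := fun s' => imem s' vsp 0 = 1%N) _).
  by rewrite /=; wps.
move=> s3 [s3s f3]; have w3 := world_frame f3 isT w2.
have s3p : imem s3 vps 0 = p by rewrite f3.1.
apply: runs_seqC; first exact: runs_frame (runs_special nW' w3 s3p s3s).
move=> s4 [spc f4]; have w4 := world_frame f4 isT w3.
have s4p : imem s4 vps 0 = p by rewrite f4.1.
have D3 : rmem s3 rD = rmem s rD by rewrite f3.2 // f2.2 // f1.2.
rewrite D3 in spc.
apply: runs_seqC.
  apply: runs_frame (runs_wpC _ (Q := fun s' => imem s' vt2 0 = p) _).
  by rewrite /= s4p; wps.
move=> s5 [s5t f5]; have w5 := world_frame f5 isT w4; have [w5n _ _] := w5.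
have N5 : imem s5 aNX = imem s aNX by rewrite f5.1 // f4.1 // f3.1 // f2.1 // f1.1.
have NXE5 : forall i : 'I_n, imem s5 aNX i = sp i :> nat by move=> i; rewrite N5.
apply: runs_seqC; first exact: runs_frame (runs_pos nW' w5n s5t s2p NXE5 one).
move=> s6 [tp f6]; have w6 := world_frame f6 isT w5; have [w6n _ _] := w6.
rewrite N5 in tp.
have s6p : imem s6 vps 0 = p by rewrite f6.1 // f5.1.
have s6s : imem s6 vsp 0 = imem s4 vsp 0 by rewrite f6.1 // f5.1.
have F6 : imem s6 aF = imem s aF.
  by rewrite f6.1 // f5.1 // f4.1 // f3.1 // f2.1 // f1.1.
have CT6 i : imem s6 aCT i = 0%N.
  by rewrite f6.1 // f5.1 // f4.1 // f3.1 // f2.1 // f1.1.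
have FP v : (v < n)%N -> (imem s6 aF v < n)%N /\ imem s6 aF v <> v.
  by move=> vn; rewrite F6; case: (ex v vn).
have s6p' : (imem s6 vps 0 < n)%N by rewrite s6p.
apply: runs_weaken (runs_frame (@runs_if _ _ _ _ _ s6
  ((ccost one_star + 20 + C) * cx n) (fun s' => ((0 < imem s6 vsp 0)%N /\
     forall v, (v < n)%N -> imem s' aCT v = p.+1) \/
     (imem s6 vsp 0 = 0%N /\ star_ok n (imem s aF) (imem s' aCT))) _ _ _)) _ _.
- by rewrite /=; wps.
- rewrite /= => spos; apply: runs_weaken (runs_one_star nW' w6n s6p') _ _.
    by rewrite leq_mul2r leq_addr orbT.
  by move=> s' H; left; split=> // v vn; rewrite H // s6p.
- rewrite /= -ltnNge => szero; apply: runs_weaken (HC W n s6 n2 nW w6n FP CT6) _ _.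
    by rewrite leq_mul2r leq_addl orbT.
  by move=> s' H; right; rewrite -F6; split=> //; lia.
- apply: leq_trans (_ : (tcost (TILe (ICst 1) (ivar vsp)) + (ccost one_star + 20 + C)).+1 * cx n <= _)%N;
    last exact: leqnn.
  rewrite mulSn mulnDl; have := cx_gt0 n; move: (tcost _) => t; nia.
move=> s7 [H f7]; rewrite (f7.1 vps isT) s6p (f7.1 aTP isT).
split=> //.
case: H => [[spos H]|[szero H]]; [left|right]; split=> //.
  by move: spc; rewrite -s6s spos.
by move: spc; rewrite -s6s szero.
Qed.

End StarProg.

(** * Output *)

(** The first key lists the stars by the tour positions of their centres. The second one orders the
    leaves of a star along the tour, as the case of a single star requires. *)
Definition fill_key : cmd :=
  RSet rK1 (ivar vi) (RInt (IGet aTP (isub (IGet aCT (ivar vi)) (ICst 1)))) ;;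
  RSet rK2 (ivar vi) (RInt (IGet aTP (ivar vi))).

Definition out_body : cmd :=
  iset0 vu (IGet aSO (ivar vi)) ;;
  If (eqt (IGet aCT (ivar vu)) (iadd (ivar vu) (ICst 1)))
    (RSet 0 (IGet 0 (ICst 0)) (ex (ivar vu)) ;;
     RSet 1 (IGet 0 (ICst 0)) (ey (ivar vu)) ;;
     ISet 0 (ICst 0) (iadd (IGet 0 (ICst 0)) (ICst 1)))
    (RSet 2 (IGet 0 (ICst 1)) (ex (ivar vu)) ;;
     RSet 3 (IGet 0 (ICst 1)) (ey (ivar vu)) ;;
     ISet 0 (ICst 1) (iadd (IGet 0 (ICst 1)) (ICst 1))).

Definition write_curves : cmd :=
  iset0 vm (ivar vn) ;; For vi vn fill_key ;; sortc ;;
  (ISet 0 (ICst 0) (ICst 0) ;; ISet 0 (ICst 1) (ICst 0)) ;; For vi vn out_body.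

Section Output.
Variable R : realType.
Implicit Types (s : state R).

Definition centre (ct : nat -> nat) v : bool := ct v == v.+1.

Definition point (X Y : nat -> R) v : plane R := (X v, Y v).

Definition curves (X Y : nat -> R) (ct : nat -> nat) (L : seq nat) : seq (plane R) * seq (plane R) :=
  ([seq point X Y v | v <- L & centre ct v], [seq point X Y v | v <- L & ~~ centre ct v]).

Lemma read_curve_eq s s' m ax ay : (forall i, (i < m)%N ->
    rmem s ax i = rmem s' ax i /\ rmem s ay i = rmem s' ay i) ->
  read_curve s m ax ay = read_curve s' m ax ay.
Proof.
move=> H; apply/eq_in_map => i; rewrite mem_iota add0n => /andP[_ im].
by have [-> ->] := H i im.
Qed.

Lemma runs_write_curves : exists C, forall W n (X Y : nat -> R) ct TP s, (2 < n)%N ->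
  (100 * n + 1000 < W)%N -> world n X Y s -> imem s aCT = ct -> imem s aTP = TP ->
  (forall v, (v < n)%N -> (ct v <= n)%N) -> (forall i, imem s aT i = 0%N) ->
  runs W write_curves s (C * cx n) (fun s' => exists o,
    sorted_idx (fun v => (TP (ct v - 1)%N)%:R : R) (fun v => (TP v)%:R) n o /\
    output s' = curves X Y ct (map o (iota 0 n))).
Proof.
have [C HC] := runs_sort R.
eexists => W n X Y ct TP s n2 nW w CTE TPE ctn T0.
apply: runs_seqC.
  apply: runs_frame (runs_wpC _ (Q := fun s' => imem s' vm 0 = n) _).
  by have [wn _ _] := w; rewrite /= wn; wps.
move=> s1 [s1m f1]; have w1 := world_frame f1 isT w; have [w1n _ _] := w1.
apply: runs_seqC.
  apply: (@runs_for_wp _ _ _ _ fill_key _ n (fun k s' => forall i, (i < k)%N ->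
    rmem s' rK1 i = (TP (ct i - 1)%N)%:R /\ rmem s' rK2 i = (TP i)%:R)) => //; [lia|].
  move=> k s' kn si I f s'n.
  have cE : imem s' aCT = ct by rewrite f.1 // f1.1.
  have tE : imem s' aTP = TP by rewrite f.1 // f1.1.
  have := ctn k kn => ck.
  rewrite /= si cE tE; wps; move=> s3 g i.
  rewrite !g.2 //= ltnS leq_eqVlt.
  by case: eqP => [->//|_] /I.
move=> s2 [K2 f2]; have w2 := world_frame f2 isT w1.
have s2m : imem s2 vm 0 = n by rewrite f2.1.
have T2 i : imem s2 aT i = 0%N by rewrite f2.1 // f1.1.
have nW' : (16 * n + 100 < W)%N by lia.
apply: runs_seqC; first exact: runs_frame (HC W s2 n nW' s2m T2).
move=> s3 [[so _ _] f3]; have w3 := world_frame f3 isT w2.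
have {}so := sorted_idx_eq K2 so; set o := imem s3 aSO in so.
apply: runs_seqC.
  apply: runs_frame (runs_wpC _ (Q := fun s' => imem s' 0 0 = 0%N /\ imem s' 0 1 = 0%N) _).
  by rewrite /=; wps.
move=> s4 [[s40 s41] f4]; have w4 := world_frame f4 isT w3; have [w4n _ _] := w4.
have [so1 _ _] := so.
apply: runs_weaken (@runs_for_wp _ W vi vn out_body s4 n (fun k s' =>
   [/\ output s' = curves X Y ct (map o (iota 0 k)), (imem s' 0 0 <= k)%N & (imem s' 0 1 <= k)%N])
   w4n _ _ _ _) (leqnn _) _.
- lia.
- by [].
- move=> s' f; rewrite (f.1 0%N isT) s40 s41; split=> //.
  by rewrite /output (f.1 0%N isT) s40 s41.
- move=> k s' kn si [I I0 I1] f s'n; have [_ w5 w6] := world_frame f isT w4.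
  have cE : imem s' aCT = ct by rewrite f.1 // f4.1 // f3.1 // f2.1 // f1.1.
  have oE : imem s' aSO = o by rewrite f.1 // f4.1.
  have on : (o k < n)%N by exact: so1.
  have IE : map o (iota 0 k.+1) = rcons (map o (iota 0 k)) (o k).
    by rewrite -[k.+1]addn1 iotaD map_cat cats1.
  rewrite IE /= !si !cE !oE !w5 !w6 -eqn_leq addn1.
  move: I; rewrite /output /curves => -[IP IQ].
  wps; case: eqP => ck; wps => s5 g; rewrite (g.1 0%N isT) /=; split; try lia.
  + rewrite !filter_rcons /centre ck eqxx /= map_rcons -IP -IQ addn1.
    congr (_, _); last by apply: read_curve_eq => i _; rewrite !g.2.
    rewrite /read_curve mkseqS; congr rcons.
      by apply: read_curve_eq => i im; rewrite !g.2 //= (ltn_eqF im).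
    by rewrite !g.2 //= eqxx.
  + rewrite !filter_rcons /centre (introF eqP ck) /= map_rcons -IP -IQ addn1.
    congr (_, _); first by apply: read_curve_eq => i _; rewrite !g.2.
    rewrite /read_curve mkseqS; congr rcons.
      by apply: read_curve_eq => i im; rewrite !g.2 //= (ltn_eqF im).
    by rewrite !g.2 //= eqxx.
- by move=> s' [[I _ _] _]; exists o.
Qed.

End Output.

(** * The whole program *)

Definition copy_input : cmd :=
  RSet rX (ivar vi) (RGet 0 (ivar vi)) ;; RSet rY (ivar vi) (RGet 1 (ivar vi)).

Definition main_prog : cmd :=
  iset0 vn (IGet 0 (ICst 0)) ;; For vi vn copy_input ;; all_sweeps ;; kruskal ;; grid ;;
  nearest ;; choose_stars ;; write_curves.

Section Main.
Variable R : realType.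

Definition algo_post n (X Y : nat -> R) (PQ : seq (plane R) * seq (plane R)) :=
  exists FN M NX (sp : {perm 'I_n}) T F D p TP ct o,
  [/\ near_ok n X Y FN M, good_tour X Y NX sp T,
      exact_ok n X Y M F D, plan_ok n X Y F NX D p TP ct &
      sorted_idx (fun v => (TP (ct v - 1)%N)%:R : R) (fun v => (TP v)%:R) n o /\
      PQ = curves X Y ct (map o (iota 0 n))].

Lemma distinct_input (s : seq (plane R)) (X Y : nat -> R) : uniq s ->
  (forall i, (i < size s)%N -> (X i, Y i) = nth (0, 0) s i) ->
  forall i j, (i < size s)%N -> (j < size s)%N -> X i = X j -> Y i = Y j -> i = j.
Proof.
move=> us E i j im jm eX eY; apply/eqP; rewrite -(nth_uniq (0, 0) im jm us).
by rewrite -!E // eX eY.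
Qed.

Lemma runs_main : exists C, forall W (s : seq (plane R)), uniq s -> (2 < size s)%N ->
  (100 * (size s * size s) + 1000 < W)%N ->
  runs W main_prog (input s) (C * cx (size s)) (fun st => exists X Y,
    (forall i, (i < size s)%N -> (X i, Y i) = nth (0, 0) s i) /\
    algo_post (size s) X Y (output st)).
Proof.
have [C1 H1] := runs_all_sweeps R; have [C2 H2] := runs_kruskal R.
have [C3 H3] := runs_grid R; have [C4 H4] := runs_nearest R.
have [C5 H5] := runs_choose_stars R; have [C6 H6] := runs_write_curves R.
eexists => W s us; set n := size s => n2 nW.
have nW1 : (100 * n + 1000 < W)%N by nia.
pose s0 := input s.
have z0 a i : (0 < a)%N -> imem s0 a i = 0%N by case: a.
apply: runs_seqC.
  apply: runs_frame (runs_wpC _ (Q := fun s' => imem s' vn 0 = n) _).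
  by rewrite /=; wps.
move=> s1 [s1n f1].
apply: runs_seqC.
  apply: (@runs_for_wp _ _ _ _ copy_input _ n (fun k s' => forall i, (i < k)%N ->
    (rmem s' rX i, rmem s' rY i) = nth (0, 0) s i)) => //; [lia|].
  move=> k s' kn si I f s'n.
  rewrite /= si; wps; move=> s3 g i.
  rewrite !g.2 //= (f.2 0%N isT) (f.2 1%N isT) !f1.2 //= ltnS leq_eqVlt.
  case: eqP => [->|_] /=; last exact: I.
  by case: (nth _ s k).
move=> s2 [XYE f2]; set X := rmem s2 rX in XYE; set Y := rmem s2 rY in XYE.
have s2n : imem s2 vn 0 = n by rewrite f2.1.
have w2 : world n X Y s2 by [].
have z2 a i : a \notin [:: 0%N; vn; vi] -> imem s2 a i = 0%N.
  rewrite !inE !negb_or => /and3P[h0 h1 h2].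
  rewrite f2.1; last by rewrite !inE negb_or h2.
  by rewrite f1.1 ?inE // z0 // lt0n.
have T2 i : imem s2 aT i = 0%N by exact: z2.
have dst := distinct_input us XYE.
apply: runs_seqC; first exact: runs_frame (H1 W n X Y s2 n2 nW1 dst w2 T2 (z2 vne 0%N isT)).
move=> s3 [[eok e4 T3] f3]; have w3 := world_frame f3 isT w2; have [w3n _ _] := w3.
have FN3 i : imem s3 aFN i = 0%N by rewrite f3.1 // z2.
apply: runs_seqC.
  exact: runs_frame (H2 W n X Y _ s3 n2 nW1 e4 erefl w3n T3 FN3 eok).
move=> s4 [[[sp [T gt]] [nr T4]] f4]; have w4 := world_frame f4 isT w3.
have M0 : 0 <= rmem s4 rM 0 by have [_ [x [y [_ _ ->]]]] := nr; exact: d1_ge0.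
apply: runs_seqC; first exact: runs_frame (H3 W n X Y s4 n2 nW1 w4 T4 M0).
move=> s5 [[cX cY T5] f5]; have w5 := world_frame f5 isT w4.
rewrite -(f5.1 aFN isT) -(f5.2 rM isT) in nr.
rewrite -(f5.2 rM isT) in cX cY.
rewrite -(f5.1 aNX isT) in gt.
have T25 i : imem s5 aT2 i = 0%N by rewrite f5.1 // f4.1 // f3.1 // z2.
apply: runs_seqC; first exact: runs_frame (H4 W n X Y s5 n2 nW w5 nr cX cY T25).
move=> s6 [ex f6]; have w6 := world_frame f6 isT w5.
have CT6 i : imem s6 aCT i = 0%N by rewrite f6.1 // f5.1 // f4.1 // f3.1 // z2.
rewrite -(f6.1 aNX isT) in gt; have [NXE one _ _ _] := gt.
apply: runs_seqC; first exact: runs_frame (H5 W n X Y sp _ s6 n2 nW1 w6 NXE one ex CT6).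
move=> s7 [plan f7]; have w7 := world_frame f7 isT w6.
have ctn v : (v < n)%N -> (imem s7 aCT v <= n)%N.
  move=> vn; have [pn _ _ [[_ ->//]|[_ [so _]]]] := plan.
  by have [c [-> cn _ _]] := so v vn.
have T7 i : imem s7 aT i = 0%N by rewrite f7.1 // f6.1.
apply: runs_weaken (H6 W n X Y _ _ s7 n2 nW1 w7 erefl erefl ctn T7) (leqnn _) _.
move=> s8 [o [so oE]]; exists X, Y; split=> //.
by do 11 eexists; split; [exact: nr|exact: gt|exact: ex|exact: plan|split; [exact: so|exact: oE]].
Qed.

End Main.

(** * Walks and lengths *)

Section Walks.
Variable R : realType.
Implicit Types (P Q : seq (plane R)) (x y : plane R) (w : seq (seq (plane R) * seq (plane R))).

Lemma bigmax_ge (I : eqType) (r : seq I) (f : I -> R) i : i \in r ->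
  f i <= \big[Num.max/0]_(j <- r) f j.
Proof.
elim: r => // j r IH; rewrite inE big_cons => /predU1P[->|/IH h].
  by rewrite le_max lexx.
by rewrite le_max h orbT.
Qed.

Lemma bigmax_le (I : eqType) (r : seq I) (f : I -> R) t : 0 <= t ->
  (forall i, i \in r -> f i <= t) -> \big[Num.max/0]_(j <- r) f j <= t.
Proof.
move=> t0; elim: r => [|i r IH] H; first by rewrite big_nil.
rewrite big_cons ge_max H ?mem_head //= IH // => j jr.
by apply: H; rewrite inE jr orbT.
Qed.

Lemma walk_cost_ge w P' Q' x y : (P', Q') \in w -> x \in P' -> y \in Q' ->
  dist x y <= walk_cost w.
Proof.
move=> PQ xP yQ; apply: le_trans (bigmax_ge _ PQ) => /=.
by apply: le_trans (bigmax_ge _ xP) => /=; exact: (bigmax_ge (dist x) yQ).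
Qed.

Lemma walk_cost_le w t : 0 <= t -> (forall PQ x y, PQ \in w -> x \in PQ.1 -> y \in PQ.2 ->
  dist x y <= t) -> walk_cost w <= t.
Proof.
move=> t0 H; apply: bigmax_le => // PQ PQw; apply: bigmax_le => // x xP.
by apply: bigmax_le => // y yQ; exact: H PQw xP yQ.
Qed.

Lemma walk_partner1 P Q w x : paired_walk P Q w -> x \in P ->
  exists2 y, y \in Q & dist x y <= walk_cost w.
Proof.
move=> [<- <- ok] /flattenP[_ /mapP[PQ PQw ->] xP].
have [_ + _] := ok PQ PQw; case E: PQ.2 => [//|y l] _.
have yQ : y \in PQ.2 by rewrite E mem_head.
exists y; last by apply: walk_cost_ge xP yQ; case: (PQ) PQw.
by apply/flattenP; exists PQ.2 => //; apply: map_f.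
Qed.

Lemma walk_partner2 P Q w y : paired_walk P Q w -> y \in Q ->
  exists2 x, x \in P & dist x y <= walk_cost w.
Proof.
move=> [<- <- ok] /flattenP[_ /mapP[PQ PQw ->] yQ].
have [+ _ _] := ok PQ PQw; case E: PQ.1 => [//|x l] _.
have xP : x \in PQ.1 by rewrite E mem_head.
exists x; last by apply: walk_cost_ge xP yQ; case: (PQ) PQw.
by apply/flattenP; exists PQ.1 => //; apply: map_f.
Qed.

Lemma partition_mem S P Q x : partitioned_by S P Q -> (x \in S) = (x \in P) || (x \in Q).
Proof.
move=> [_ _ [A [B [<- _ PA QB]]]].
by rewrite inE (perm_mem PA) (perm_mem QB).
Qed.

Lemma partition_disj S P Q x y : partitioned_by S P Q -> x \in P -> y \in Q -> x <> y.
Proof.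
move=> [_ _ [A [B [_ /fdisjointP d PA QB]]]]; rewrite (perm_mem PA) => /d xB yQ e.
by move: xB; rewrite e -(perm_mem QB) yQ.
Qed.

Lemma partition_sym S P Q : partitioned_by S P Q -> partitioned_by S Q P.
Proof.
move=> [P0 Q0 [A [B [AB d PA QB]]]]; split=> //; exists B, A; split=> //.
  by rewrite fsetUC.
by rewrite fdisjoint_sym.
Qed.

Lemma partition_uniq S P Q : partitioned_by S P Q -> uniq P.
Proof. by move=> [_ _ [A [B [_ _ PA _]]]]; rewrite (perm_uniq PA) fset_uniq. Qed.

Lemma partition_partner S P Q : partitioned_by S P Q ->
  (forall x, x \in P -> exists2 y, y \in Q & dist x y <= dfrechet P Q) /\
  (forall y, y \in Q -> exists2 x, x \in P & dist y x <= dfrechet P Q).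
Proof.
move=> [P0 Q0 _]; have [[w Hw <-] _] := dfrechet_min P0 Q0.
split=> z zin; first exact: walk_partner1 Hw zin.
by have [x xP h] := walk_partner2 Hw zin; exists x => //; rewrite distC.
Qed.

Lemma eps_star_partner S x : (1 < #|` S|)%N -> x \in S ->
  exists y, [/\ y \in S, y <> x & dist x y <= eps_star S].
Proof.
move=> S1 xS; have [[P [Q [part ->]]] _] := eps_star_min S1.
have [h1 h2] := partition_partner part.
move: (xS); rewrite (partition_mem x part) => /orP[xP|xQ].
  have [y yQ d] := h1 x xP; exists y; split=> //.
    by rewrite (partition_mem y part) yQ orbT.
  by apply/nesym; exact: partition_disj part xP yQ.
have [y yP d] := h2 x xQ; exists y; split=> //.
  by rewrite (partition_mem y part) yP.
exact: partition_disj part yP xQ.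
Qed.

Lemma curve_length_cons x y P : curve_length (x :: y :: P) = dist x y + curve_length (y :: P).
Proof. by rewrite /curve_length /= big_cons. Qed.

Lemma curve_length1 x : curve_length [:: x] = 0.
Proof. by rewrite /curve_length /= big_nil. Qed.

Lemma curve_length_ge0 P : 0 <= curve_length P.
Proof. by apply: sumr_ge0 => e _; exact: dist_ge0. Qed.

Lemma neighbour_le_length P x : uniq P -> x \in P -> (1 < size P)%N ->
  exists y, [/\ y \in P, y <> x & dist x y <= curve_length P].
Proof.
elim: P => // a [|b P] IH //= /andP[+ u] + _; rewrite !inE negb_or => /andP[/eqP ab _].
have h0 : 0 <= dist a b by exact: dist_ge0.
have h1 := curve_length_ge0 (b :: P); rewrite curve_length_cons.
case/or3P => [/eqP->|/eqP->|xP].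
- exists b; split; [by rewrite !inE eqxx orbT|exact: nesym|lra].
- by exists a; split; [rewrite !inE eqxx|by []|rewrite distC; lra].
have Pn : (0 < size P)%N by case: (P) xP.
have [|y [yP yx d]] := IH u _ Pn; first by rewrite inE xP orbT.
by exists y; split=> //; [rewrite inE yP orbT|lra].
Qed.

Lemma max_length_ge P Q : curve_length P + curve_length Q <= 2 * max_length P Q.
Proof.
have h1 : curve_length P <= max_length P Q by rewrite le_max lexx.
have h2 : curve_length Q <= max_length P Q by rewrite le_max lexx orbT.
lra.
Qed.

Lemma max_length_le P Q : max_length P Q <= curve_length P + curve_length Q.
Proof.
have := curve_length_ge0 P; have := curve_length_ge0 Q.
by move=> h1 h2; rewrite /max_length ge_max; apply/andP; split; lra.
Qed.

End Walks.

Section Regroup.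
Variables (T : eqType).
Implicit Types (s : seq T) (a : pred T).

Lemma filter_prefix a s : pairwise (fun x y => a y ==> a x) s ->
  [seq x <- s | a x] ++ [seq x <- s | ~~ a x] = s.
Proof.
elim: s => //= x s IH /andP[xs ps]; case ax: (a x) => /=; first by rewrite IH.
have na : all (predC a) s by apply/allP => y /(allP xs); rewrite ax /=; case: (a y).
rewrite (all_filterP na); have -> : [seq y <- s | a y] = [::]; last by [].
by apply/eqP; rewrite -[_ == _]negbK -has_filter -all_predC na.
Qed.

(** Cuts the sorted list of leaves into one block per star, which the walk pairs with the centre.
    Sortedness makes equal classes contiguous, as the key [g] separates them. *)
Lemma regroup (K : eqType) (f : T -> K) (g : K -> nat) (ks : seq K) s :
  {in ks &, injective g} -> uniq ks -> pairwise (fun k k' => g k <= g k')%N ks ->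
  pairwise (fun x y => g (f x) <= g (f y))%N s -> (forall x, x \in s -> f x \in ks) ->
  flatten [seq [seq x <- s | f x == k] | k <- ks] = s.
Proof.
elim: ks s => [|k ks IH] s gi /=; first by case: s => // x s _ _ _ /(_ x (mem_head _ _)).
move=> /andP[kks uks] /andP[kmin pks] ps fs.
have gi' : {in ks &, injective g} by move=> a b ak bk; apply: gi; rewrite inE ?ak ?bk orbT.
have ps' : pairwise (fun x y => (f y == k) ==> (f x == k)) s.
  apply: sub_in_pairwise ps; last by apply/allP => x; exact: id.
  move=> x y xs ys /= le; apply/implyP => /eqP yk; apply/eqP.
  rewrite yk in le; apply: gi; rewrite ?mem_head ?fs //.
  apply/eqP; rewrite eqn_leq le /=; move: (fs x xs); rewrite inE => /predU1P[->//|].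
  exact: (allP kmin).
rewrite -[RHS](filter_prefix ps'); congr cat.
rewrite -[RHS](IH _ gi' uks pks).
- congr flatten; apply/eq_in_map => k' kk'; rewrite -filter_predI; apply: eq_filter => x /=.
  case: eqP => //= ->; apply/esym; apply/negP => /eqP e.
  by move: kks; rewrite -e kk'.
- exact: pairwise_filter.
- by move=> x; rewrite mem_filter => /andP[/negPf fk /fs]; rewrite inE fk.
Qed.

End Regroup.

(** * Optimality and length of the output curves *)

Lemma lt_of_double (R : realFieldType) (a b c d e : R) :
  0 <= d -> a <= 2 * b -> b <= c -> 2 * (c + d) < e -> a < e.
Proof. by move=> *; lra. Qed.

Lemma double_absurd (R : realFieldType) (a b : R) : 0 <= a -> b < a -> 2 * a <= b -> False.
Proof. by move=> *; lra. Qed.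

Section Optimal.
Variable R : realType.
Variables (n : nat) (X Y : nat -> R) (S : {fset plane R}).
Local Notation pt := (point X Y).
Local Notation d1 := (dist1 X Y).
Local Notation d2 := (dist2 X Y).
Hypothesis n2 : (2 < n)%N.
Hypothesis dst : forall i j, (i < n)%N -> (j < n)%N -> X i = X j -> Y i = Y j -> i = j.
Hypothesis HS : perm_eq (map pt (iota 0 n)) S.
Local Notation eps := (eps_star S).

Lemma ptS v : (v < n)%N -> pt v \in S.
Proof. by move=> vn; rewrite -(perm_mem HS) map_f // mem_iota. Qed.

Lemma Spt x : x \in S -> exists2 v, (v < n)%N & pt v = x.
Proof.
by rewrite -(perm_mem HS) => /mapP[v]; rewrite mem_iota => vn ->; exists v.
Qed.

Lemma pt_inj v u : (v < n)%N -> (u < n)%N -> pt v = pt u -> v = u.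
Proof. by move=> vn un [eX eY]; exact: dst. Qed.

Lemma cardS : #|` S| = n.
Proof. by rewrite -(perm_size HS) size_map size_iota. Qed.

Lemma partner v : (v < n)%N -> exists z, [/\ (z < n)%N, z <> v & d2 v z <= eps].
Proof.
move=> vn; have S1 : (1 < #|` S|)%N by rewrite cardS; lia.
have [y [yS yx d]] := eps_star_partner S1 (ptS vn).
have [z zn zy] := Spt yS; exists z; split=> //; last by rewrite -zy in d.
by move=> e; apply: yx; rewrite -zy e.
Qed.

Lemma eps_ge0 : 0 <= eps.
Proof. by have [z [_ _ d]] := @partner 0%N (ltac:(lia)); apply: le_trans d; exact: dist_ge0. Qed.

Variables (FN F TP ct o NX : nat -> nat) (M : R) (sp : {perm 'I_n})
  (T : seq (nat * nat)) (D : nat -> R) (p : nat).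
Hypotheses (nr : near_ok n X Y FN M) (gt : good_tour X Y NX sp T)
  (ex : exact_ok n X Y M F D) (plan : plan_ok n X Y F NX D p TP ct)
  (so : sorted_idx (fun v => (TP (ct v - 1)%N)%:R : R) (fun v => (TP v)%:R) n o).

Let L := map o (iota 0 n).
Let cf v := (ct v - 1)%N.
Let PL := [seq v <- L | centre ct v].
Let QL := [seq v <- L | ~~ centre ct v].

(** At a point where [M] is attained some other point lies within [eps], and a squared L1 distance
    is at most twice the squared Euclidean one. *)
Lemma M_le_eps : M ^+ 2 <= 2 * eps ^+ 2.
Proof.
have [nr1 [x [y [xn Fx ->]]]] := nr; have [y' [Fx' yn yx _ ymin]] := nr1 x xn.
move: Fx; rewrite Fx' => -[<-]; have [z [zn zx dz]] := partner xn.
apply: le_trans (_ : d1 x z ^+ 2 <= _).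
  by rewrite ler_pXn2r ?nnegrE ?d1_ge0 //; exact: ymin.
apply: le_trans (norm1_sqr_le (pt x) (pt z)) _.
by rewrite ler_pM2l // ler_pXn2r ?nnegrE ?dist_ge0 ?eps_ge0.
Qed.

(** Either [D v] does not exceed the squared distance to the partner of [v], or
    [2 * D v <= M ^+ 2 <= 2 * eps ^+ 2]. *)
Lemma D_le_eps v : (v < n)%N -> D v <= eps ^+ 2.
Proof.
move=> vn; have [_ _ _ _ [h|h]] := ex vn; first by have := M_le_eps; rewrite expr2; lra.
have [z [zn zv dz]] := partner vn; apply: le_trans (h z zn zv) _.
by rewrite sqE ler_pXn2r ?nnegrE ?dist_ge0 ?eps_ge0.
Qed.

Lemma d2_F v : (v < n)%N -> d2 v (F v) ^+ 2 = D v.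
Proof. by move=> vn; have [_ _ -> _ _] := ex vn; rewrite sqE. Qed.

Let r := Num.sqrt (D p).

Lemma D_ge0 v : (v < n)%N -> 0 <= D v.
Proof. by move=> vn; rewrite -d2_F // sqr_ge0. Qed.

Lemma r_sqr : r ^+ 2 = D p.
Proof. by have [pn _ _ _] := plan; rewrite sqr_sqrtr // D_ge0. Qed.

Lemma r_ge0 : 0 <= r. Proof. exact: sqrtr_ge0. Qed.

Lemma r_le_eps : r <= eps.
Proof.
have [pn _ _ _] := plan.
by rewrite -(ler_pXn2r (n := 2)) ?nnegrE ?r_ge0 ?eps_ge0 // r_sqr D_le_eps.
Qed.

Lemma star_edge v : (v < n)%N -> [/\ (cf v < n)%N, ct v = (cf v).+1, ct (cf v) = (cf v).+1 &
  d2 v (cf v) <= r].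
Proof.
have le u z : (u < n)%N -> d2 u z ^+ 2 = D u -> d2 u z <= r.
  move=> un e; rewrite -(ler_pXn2r (n := 2)) ?nnegrE ?r_ge0 ?dist_ge0 // e r_sqr.
  by have [_ mx _ _] := plan; exact: mx.
have xx u : d2 u u <= r by rewrite /d2 distxx r_ge0.
have [pn mx _ [[spc cE]|[_ [so1 _]]]] := plan => vn; rewrite /cf.
  rewrite !cE ?subn1 //=; split=> //; have [->//|/eqP vp] := eqVneq v p.
  by rewrite /d2 distC; apply: le => //; rewrite /d2 distC -[_ ^+ 2](sqE X Y); exact: spc.
have [c [-> cn cc H]] := so1 v vn; rewrite subn1 /=; split=> //.
have [->//|/eqP vc] := eqVneq v c.
have [<-|Fc] := H vc; first by apply: le => //; exact: d2_F.
by rewrite /d2 distC; apply: le => //; rewrite -Fc; exact: d2_F.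
Qed.

Lemma centreE v : (v < n)%N -> centre ct v = (cf v == v).
Proof. by move=> vn; rewrite /centre; have [_ -> _ _] := star_edge vn; rewrite eqSS. Qed.

Lemma centre_leaf c : (c < n)%N -> centre ct c -> exists v, [/\ (v < n)%N, v <> c & ct v = c.+1].
Proof.
move=> cn /eqP cc; have [pn _ _ [[_ cE]|[_ [_ so2]]]] := plan; last exact: so2.
have cp : c = p by move: cc; rewrite cE // => -[].
have n1 : (1 < n)%N by lia.
have n0 : (0 < n)%N by lia.
have [p0|p0] := eqVneq p 0%N; first by exists 1%N; rewrite cE // cp p0.
by exists 0%N; rewrite cE // cp; split=> //; apply/nesym/eqP.
Qed.

Lemma L_perm : perm_eq L (iota 0 n).
Proof.
have [so1 so2 _] := so.
apply: uniq_perm; rewrite ?iota_uniq //.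
  rewrite map_inj_in_uniq ?iota_uniq // => i j; rewrite !mem_iota => im jm; exact: so2.
move=> v; rewrite mem_iota add0n; apply/mapP/idP => [[i]|vn].
  by rewrite mem_iota => im ->; exact: so1.
by have [i im <-] := idx_onto so1 so2 vn; exists i; rewrite ?mem_iota.
Qed.

Lemma mem_L v : (v \in L) = (v < n)%N.
Proof. by rewrite (perm_mem L_perm) mem_iota. Qed.

Lemma L_uniq : uniq L. Proof. by rewrite (perm_uniq L_perm) iota_uniq. Qed.

Lemma L_sorted : pairwise (fun u v => lexle (fun v => (TP (cf v))%:R : R) (fun v => (TP v)%:R) u v) L.
Proof.
have [_ _ so3] := so; rewrite /L pairwise_map.
apply/(pairwiseP 0%N) => i j; rewrite !inE size_iota => im jm ij.
by rewrite /= !nth_iota // !add0n; apply: so3; rewrite ij.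
Qed.

Lemma L_sorted1 : pairwise (fun u v => TP (cf u) <= TP (cf v))%N L.
Proof. by apply: sub_pairwise L_sorted => u v /lexle1; rewrite ler_nat. Qed.

Lemma tour_p i : (iter i NX p < n)%N.
Proof. by have [NE one _ _ _] := gt; have [pn _ _ _] := plan; exact: tour_lt NE _ _ pn. Qed.

Lemma tour_TP v : (v < n)%N -> (TP v < n)%N /\ iter (TP v) NX p = v.
Proof.
have [NE one _ _ _] := gt; have [pn _ tp _] := plan => vn.
have inj i j : (i < n)%N -> (j < n)%N -> iter i NX p = iter j NX p -> i = j.
  exact: (tour_inj NE one pn).
have [i im <-] := idx_onto (fun i _ => tour_p i) inj vn.
by rewrite tp.
Qed.

Lemma TP_inj u v : (u < n)%N -> (v < n)%N -> TP u = TP v -> u = v.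
Proof.
by move=> un vn e; have [_ <-] := tour_TP un; have [_ <-] := tour_TP vn; rewrite e.
Qed.

Lemma mem_PL v : v \in PL -> (v < n)%N /\ cf v = v.
Proof.
by rewrite mem_filter mem_L => /andP[c vn]; split=> //; apply/eqP; rewrite -centreE.
Qed.

Lemma mem_QL v : v \in QL -> [/\ (v < n)%N, cf v <> v & cf v \in PL].
Proof.
rewrite !mem_filter !mem_L => /andP[c vn]; have [cn e1 e2 _] := star_edge vn.
by split=> //; [apply/eqP; rewrite -centreE|rewrite cn /centre e2 eqxx].
Qed.

Let P := map pt PL.
Let Q := map pt QL.

Definition star_walk :=
  [seq ([:: pt c], [seq pt v | v <- QL & cf v == c]) | c <- PL].

Lemma star_walkP : paired_walk P Q star_walk.
Proof.
split.
- by rewrite /P /star_walk; elim: PL => //= c l ->.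
- rewrite /unzip2 -map_comp /=.
  have <- : map pt (flatten [seq [seq v <- QL | cf v == c] | c <- PL]) = Q.
    rewrite (regroup (g := TP)) //.
    + by move=> u v /mem_PL[un _] /mem_PL[vn _]; exact: TP_inj.
    + by rewrite filter_uniq // L_uniq.
    + apply: sub_in_pairwise (pairwise_filter _ L_sorted1); last by apply/allP => x; exact: id.
      by move=> u v /mem_PL[_ eu] /mem_PL[_ ev] /=; rewrite eu ev.
    + exact: pairwise_filter L_sorted1.
    + by move=> v /mem_QL[].
  by rewrite map_flatten -map_comp.
- move=> _ /mapP[c cP ->] /=; split=> //.
  have [cn cc] := mem_PL cP; have cen : centre ct c by rewrite centreE // cc.
  have [v [vn vc e]] := centre_leaf cn cen.
  have cfv : cf v = c by rewrite /cf e subn1.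
  have vQ : v \in [seq v <- QL | cf v == c].
    rewrite mem_filter cfv eqxx mem_filter mem_L vn andbT centreE // cfv.
    by apply/eqP => ?; case: vc.
  by case: [seq _ <- QL | _] vQ.
Qed.

Lemma star_walk_cost : walk_cost star_walk <= r.
Proof.
apply: walk_cost_le => [|PQ x y /mapP[c cP ->] /=]; first exact: r_ge0.
rewrite inE => /eqP -> /mapP[v]; rewrite mem_filter => /andP[/eqP cv /mem_QL[vn _ _]] ->.
by have [_ _ _] := star_edge vn; rewrite cv /d2 distC.
Qed.

Lemma output_partition : partitioned_by S P Q.
Proof.
have n0 : (0 < n)%N by lia.
have [cn e1 e2 _] := star_edge n0; set c := cf 0 in cn e1 e2.
have cen : centre ct c by rewrite /centre e2.
have uP : uniq P.
  rewrite map_inj_in_uniq; first by rewrite filter_uniq // L_uniq.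
  by move=> u v /mem_PL[un _] /mem_PL[vn _]; exact: pt_inj.
have uQ : uniq Q.
  rewrite map_inj_in_uniq; first by rewrite filter_uniq // L_uniq.
  by move=> u v /mem_QL[un _ _] /mem_QL[vn _ _]; exact: pt_inj.
split.
- have : c \in PL by rewrite mem_filter cen mem_L.
  by rewrite /P; case: PL.
- have [v [vn vc e]] := centre_leaf cn cen.
  have : v \in QL.
    by rewrite mem_filter mem_L vn andbT /centre e eqSS; apply/eqP => ?; case: vc.
  by rewrite /Q; case: QL.
exists [fset x in P]%fset, [fset x in Q]%fset; split.
- apply/fsetP => x; rewrite !inE; apply/orP/idP.
    by case=> /mapP[v]; [move=> /mem_PL[vn _]|move=> /mem_QL[vn _ _]] => ->; exact: ptS.
  move=> /Spt[v vn <-]; case cv: (centre ct v); [left|right]; apply: map_f;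
    by rewrite mem_filter cv mem_L.
- apply/fdisjointP => x; rewrite !inE => /mapP[u uP' ->]; apply/negP => /mapP[v vQ e].
  have [un _] := mem_PL uP'; have [vn _ _] := mem_QL vQ.
  have uv := pt_inj un vn e; move: uP' vQ; rewrite uv !mem_filter.
  by move=> /andP[-> _].
- by apply: uniq_perm => // x; rewrite inE.
- by apply: uniq_perm => // x; rewrite inE.
Qed.

(** A squeeze: [eps <= dfrechet P Q <= r <= eps]. *)
Lemma output_optimal : frechet_optimal S P Q /\ r = eps.
Proof.
have part := output_partition; have [P0 Q0 _] := part.
have [_ lb1] := dfrechet_min P0 Q0.
have S1 : (1 < #|` S|)%N by rewrite cardS; lia.
have [_ lb2] := eps_star_min S1.
have h1 : dfrechet P Q <= r.
  by apply: le_trans star_walk_cost; apply: lb1; exists star_walk => //; exact: star_walkP.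
have h2 : eps <= dfrechet P Q by apply: lb2; exists P, Q.
have h3 := r_le_eps.
split; first split=> //; apply/eqP; rewrite eq_le.
  by rewrite h2 andbT (le_trans h1).
by rewrite h3 (le_trans h2).
Qed.

Let t i := iter i NX p.
(** The tour length up to position [i] acts as a potential: the lengths of curves that follow the
    tour telescope to its differences. *)
Let pre i : R := \sum_(j < i) d2 (t j) (t j.+1).
Let tour := pre n.
Let lenI l := curve_length (map pt l).

Lemma pre_step i : pre i.+1 = pre i + d2 (t i) (t i.+1).
Proof. by rewrite /pre big_ord_recr. Qed.

Lemma pre_dist i j : (i <= j)%N -> d2 (t i) (t j) <= pre j - pre i.
Proof.
move=> /subnKC <-; elim: (j - i)%N => [|k IH]; first by rewrite addn0 subrr /d2 distxx.
rewrite addnS pre_step.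
by have := dist_triangle (pt (t (i + k))) (pt (t i)) (pt (t (i + k).+1)); move: IH; rewrite /d2 /point; lra.
Qed.

Lemma pre_le i j : (i <= j)%N -> pre i <= pre j.
Proof. by move=> /pre_dist; have := dist_ge0 (pt (t i)) (pt (t j)); rewrite /d2 /point; lra. Qed.

Lemma d2_pre u v : (u < n)%N -> (v < n)%N -> (TP u <= TP v)%N ->
  d2 u v <= pre (TP v) - pre (TP u).
Proof.
move=> un vn /pre_dist; rewrite /t.
by have [_ ->] := tour_TP un; have [_ ->] := tour_TP vn.
Qed.

Lemma pre_bound u v : (u < n)%N -> (v < n)%N -> pre (TP v) - pre (TP u) <= tour.
Proof.
move=> un vn; have [un' _] := tour_TP un; have [vn' _] := tour_TP vn.
have h1 : pre (TP v) <= tour by apply: pre_le; exact: ltnW.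
have h2 : pre 0 <= pre (TP u) by exact: pre_le.
have h3 : pre 0 = 0 by rewrite /pre big_ord0.
lra.
Qed.

Lemma len_sorted x l : all (fun v => v < n)%N (x :: l) ->
  path (fun u v => TP u <= TP v)%N x l -> lenI (x :: l) <= pre (TP (last x l)) - pre (TP x).
Proof.
elim: l x => [|y l IH] x /=; first by rewrite subrr /lenI /= curve_length1.
move=> /and3P[xn yn ln] /andP[xy yl].
have h1 : lenI (y :: l) <= pre (TP (last y l)) - pre (TP y) by apply: IH => //=; rewrite yn.
have h2 := d2_pre xn yn xy.
by rewrite /lenI /= curve_length_cons; move: h1 h2; rewrite /lenI /= /d2 /point; lra.
Qed.

(** Each edge is replaced by a detour through the centres of its two ends, so a point pays its star
    edge at most twice. The subtracted term says that the first point pays only once, which the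
    induction needs. *)
Lemma len_by_star x l : all (fun v => v < n)%N (x :: l) ->
  path (fun u v => TP (cf u) <= TP (cf v))%N x l ->
  lenI (x :: l) <= pre (TP (cf (last x l))) - pre (TP (cf x)) +
    2 * \sum_(v <- x :: l) d2 v (cf v) - d2 x (cf x).
Proof.
elim: l x => [|y l IH] x /=.
  rewrite /lenI /= curve_length1 subrr big_seq1; have := dist_ge0 (pt x) (pt (cf x)).
  by rewrite /d2 /point; lra.
move=> /and3P[xn yn ln] /andP[xy yl].
have h1 : lenI (y :: l) <= pre (TP (cf (last y l))) - pre (TP (cf y)) +
    2 * \sum_(v <- y :: l) d2 v (cf v) - d2 y (cf y) by apply: IH => //=; rewrite yn.
have [cxn _ _ _] := star_edge xn; have [cyn _ _ _] := star_edge yn.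
have h2 := d2_pre cxn cyn xy.
have h3 := dist_triangle (pt (cf x)) (pt x) (pt y).
have h4 := dist_triangle (pt (cf y)) (pt (cf x)) (pt y).
have h5 : dist (pt (cf y)) (pt y) = d2 y (cf y) by rewrite distC.
rewrite big_cons /lenI /= curve_length_cons.
by move: h1 h2 h3 h4 h5; rewrite /lenI /= /d2 /point; lra.
Qed.

Lemma tourE : tour = \sum_(i < n) d2 i (sp i).
Proof.
have [NE one _ _ _] := gt; have [pn _ _ _] := plan.
by rewrite (tour_sum NE one d2 pn).
Qed.

Lemma next_ne v : (v < n)%N -> (NX v < n)%N /\ NX v <> v.
Proof.
have [NE one _ _ _] := gt => vn; split; first exact: (tour_lt NE 1 vn).
move=> e; have n0 : (0 < n)%N by lia.
by have := tour_inj NE one vn (ltac:(lia) : (1 < n)%N) n0 e.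
Qed.

(** [D v] is at most the squared L1 distance from [v] to any other point, in particular to its
    successor on the tour. *)
Lemma near_next v : (v < n)%N -> d2 v (F v) <= 2 * d2 v (NX v).
Proof.
move=> vn; have [Nn Nv] := next_ne vn; have [_ _ _ h _] := ex vn.
apply: le_trans (d1_le_d2 X Y v (NX v)).
by rewrite -(ler_pXn2r (n := 2)) ?nnegrE ?d1_ge0 ?dist_ge0 // d2_F // h.
Qed.

Lemma sum_near : \sum_(v < n) d2 v (F v) <= 2 * tour.
Proof.
rewrite tourE mulr_sumr; apply: ler_sum => v _.
by have [NE _ _ _ _] := gt; rewrite -NE; exact: near_next.
Qed.

Lemma sum_QL (f : nat -> R) : (forall v, 0 <= f v) -> \sum_(v <- QL) f v <= \sum_(v < n) f v.
Proof.
move=> f0; rewrite -(big_mkord xpredT) /index_iota subn0 -(perm_big _ L_perm) /QL big_filter.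
by rewrite [leRHS](bigID (centre ct)) /= lerDr sumr_ge0.
Qed.

Lemma sum_star : star_ok n F ct -> \sum_(v < n) d2 v (cf v) <= 2 * \sum_(v < n) d2 v (F v).
Proof.
move=> [so1 _].
have dist0 a b : 0 <= d2 a b by exact: dist_ge0.
(* [ch v] collects the neighbour edges that point to [v]. A star edge is the neighbour edge of its
   leaf or of its centre, so each neighbour edge is charged at most once at either end; hence the
   factor 2. *)
pose ch v := \sum_(c < n) (if F c == v then d2 c (F c) else 0).
have ch0 v : 0 <= ch v by apply: sumr_ge0 => c _; case: ifP.
have le v : (v < n)%N -> d2 v (cf v) <= d2 v (F v) + ch v.
  move=> vn; have [c [cE cn _ H]] := so1 v vn; rewrite /cf cE subn1 /=.
  have [<-|/eqP vc] := eqVneq v c; first by rewrite {1}/d2 distxx addr_ge0.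
  have [->|Fc] := H vc; first by rewrite lerDl.
  apply: le_trans (_ : ch v <= _); last by rewrite lerDr.
  rewrite /ch (bigD1 (Ordinal cn)) //= Fc eqxx {1}/d2 distC lerDl.
  by apply: sumr_ge0 => i _; case: ifP.
apply: le_trans (_ : \sum_(v < n) (d2 v (F v) + ch v) <= _).
  by apply: ler_sum => v _; exact: le.
rewrite big_split /= mulr_natl mulr2n lerD2l /ch exchange_big /=.
apply: ler_sum => c _; have [Fn _ _ _ _] := ex (ltn_ord c).
rewrite (bigD1 (Ordinal Fn)) //= eqxx big1 ?addr0 // => v.
by rewrite -val_eqE /= eq_sym => /negPf ->.
Qed.

Lemma len_PL : lenI PL <= tour.
Proof.
have srt : pairwise (fun u v => TP u <= TP v)%N PL.
  apply: sub_in_pairwise (pairwise_filter _ L_sorted1); last by apply/allP => x; exact: id.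
  by move=> u v /mem_PL[_ eu] /mem_PL[_ ev] /=; rewrite eu ev.
have lt : all (fun v => v < n)%N PL by apply/allP => v /mem_PL[].
move: srt lt; case: PL => [_ _|x l /pairwise_sorted srt lt].
  by have := pre_le (leq0n n); rewrite /lenI /curve_length /= big_nil /pre big_ord0.
apply: le_trans (len_sorted lt srt) _.
have xn : (x < n)%N by apply: (allP lt x); exact: mem_head.
have ln : (last x l < n)%N by apply: (allP lt (last x l)); exact: mem_last.
exact: pre_bound.
Qed.

(** Here 9 is 1 + 2 * 4: one tour for the centres, and star edges of total length at most 4 tours,
    paid twice. *)
Lemma len_QL_star : star_ok n F ct -> lenI QL <= 9 * tour.
Proof.
move=> sok; have h1 := sum_star sok; have h2 := sum_near.
have h3 : \sum_(v <- QL) d2 v (cf v) <= \sum_(v < n) d2 v (cf v).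
  by apply: sum_QL => v; exact: dist_ge0.
have t0 : 0 <= tour by have := pre_le (leq0n n); rewrite [pre 0]big_ord0.
have srt : sorted (fun u v => TP (cf u) <= TP (cf v))%N QL.
  by apply: pairwise_sorted; apply: pairwise_filter; exact: L_sorted1.
have lt : all (fun v => v < n)%N QL by apply/allP => v /mem_QL[].
move: srt lt h3; case: QL => [_ _ _|x l srt lt h3].
  by rewrite /lenI /curve_length /= big_nil mulr_ge0.
have h4 := len_by_star lt srt.
have xn : (x < n)%N by apply: (allP lt x); exact: mem_head.
have ln : (last x l < n)%N by apply: (allP lt (last x l)); exact: mem_last.
have [cxn _ _ _] := star_edge xn; have [cln _ _ _] := star_edge ln.
have h5 := pre_bound cxn cln; have h6 : 0 <= d2 x (cf x) by exact: dist_ge0.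
move: h1 h2 h3 h4 h5 h6 t0; move: (lenI _) (\sum_(v <- _) _) (\sum_(v < n) _) (\sum_(v < n) _).
by move: (pre _) (pre _) (d2 _ _) tour => a b c d e f g h; lra.
Qed.

Lemma QL_sorted_one : (forall v, (v < n)%N -> ct v = p.+1) ->
  sorted (fun u v => TP u <= TP v)%N QL.
Proof.
move=> cE; apply: pairwise_sorted.
apply: sub_in_pairwise (pairwise_filter _ L_sorted); last by apply/allP => x; exact: id.
move=> u v /mem_QL[un _ _] /mem_QL[vn _ _] /= /lexle2.
by rewrite /cf !cE // ler_nat; exact.
Qed.

Lemma len_QL_one : (forall v, (v < n)%N -> ct v = p.+1) -> lenI QL <= tour.
Proof.
move=> /QL_sorted_one srt.
have lt : all (fun v => v < n)%N QL by apply/allP => v /mem_QL[].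
move: srt lt; case: QL => [_ _|x l srt lt].
  by have := pre_le (leq0n n); rewrite /lenI /curve_length /= big_nil /pre big_ord0.
apply: le_trans (len_sorted lt srt) _.
have xn : (x < n)%N by apply: (allP lt x); exact: mem_head.
have ln : (last x l < n)%N by apply: (allP lt (last x l)); exact: mem_last.
exact: pre_bound.
Qed.

Lemma len_tour : lenI PL + lenI QL <= 10 * tour.
Proof.
have h1 := len_PL; have [_ _ _ [[_ cE]|[_ sok]]] := plan.
  have h2 := len_QL_one cE.
  have t0 : 0 <= tour by have := pre_le (leq0n n); rewrite [pre 0]big_ord0.
  lra.
have h2 := len_QL_star sok; lra.
Qed.

Lemma lenI_ge0 l : 0 <= lenI l. Proof. exact: curve_length_ge0. Qed.

Definition edges (l : seq nat) := zip l (behead l).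

Lemma length_edges l : lenI l = weight d2 (edges l).
Proof.
elim: l => [|x [|y l] IH]; rewrite /lenI ?curve_length1 /weight /=.
- by rewrite /curve_length /= !big_nil.
- by rewrite big_nil.
by rewrite curve_length_cons -/(lenI (y :: l)) IH big_cons.
Qed.

Lemma edges_const (T' : eqType) (g : nat -> T') l : (forall e, e \in edges l -> g e.1 = g e.2) ->
  forall u v, u \in l -> v \in l -> g u = g v.
Proof.
case: l => // x l H; suff E u : u \in x :: l -> g u = g x by move=> u v /E -> /E ->.
elim: l x H u => [|y l IH] x H u; first by rewrite inE => /eqP ->.
rewrite inE => /predU1P[->//|ul]; rewrite (H (x, y)) ?mem_head //=.
by apply: IH ul => e el; apply: H; rewrite inE el orbT.
Qed.

Lemma edges_inrange l : all (fun v => v < n)%N l -> inrange n (edges l).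
Proof.
elim: l => // x [|y l] IH // /andP[xn ln]; rewrite /inrange /= xn /=.
by have /andP[-> _] := ln; exact: IH.
Qed.

Lemma weight_d1_d2 l : weight d1 l <= 2 * weight d2 l.
Proof. by rewrite /weight mulr_sumr; apply: ler_sum => e _; exact: d1_le_d2. Qed.

Lemma index_list (Ps : seq (plane R)) : {subset Ps <= S} ->
  exists2 l, Ps = map pt l & all (fun v => v < n)%N l.
Proof.
elim: Ps => [|x Ps IH] sub; first by exists [::].
have [v vn <-] := Spt (sub x (mem_head _ _)).
have [y yP|l -> ln] := IH; first by apply: sub; rewrite inE yP orbT.
by exists (v :: l); rewrite //= vn.
Qed.

Section Pair.
Variables (pI qI : seq nat).
Hypotheses (pn' : all (fun v => v < n)%N pI) (qn' : all (fun v => v < n)%N qI).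
Hypothesis cover : forall v, (v < n)%N -> (v \in pI) || (v \in qI).
Let ls := lenI pI + lenI qI.

Lemma mst_bound a b : a \in pI -> b \in qI -> weight d1 T <= 2 * ls + d1 a b.
Proof.
move=> aP bQ; have [_ _ _ _ mst] := gt.
have := mst (edges pI ++ edges qI ++ [:: (a, b)]).
have h1 := weight_d1_d2 (edges pI); have h2 := weight_d1_d2 (edges qI).
rewrite {2 3}/weight !big_cat /= big_seq1 /= -!/(weight _ _) => /(_ _ _) H.
apply: le_trans (H _ _) _; last by rewrite /ls !length_edges; lra.
  rewrite /inrange !all_cat /= (allP pn' a aP) (allP qn' b bQ) /= andbT.
  by apply/andP; split; exact: edges_inrange.
move=> x y xn yn g _ gE.
have gab : g a = g b by apply: (gE (a, b)); rewrite !mem_cat mem_head !orbT.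
have gP u v : u \in pI -> v \in pI -> g u = g v.
  by apply: edges_const => e el; apply: gE; rewrite mem_cat el.
have gQ u v : u \in qI -> v \in qI -> g u = g v.
  by apply: edges_const => e el; apply: gE; rewrite !mem_cat el orbT.
have ga z : (z < n)%N -> g z = g a.
  by move=> /cover/orP[zP|zQ]; [exact: gP|rewrite gab; exact: gQ].
by rewrite !ga.
Qed.

Lemma tour_weight : tour <= 2 * weight d2 T.
Proof. by have [_ _ _ h _] := gt; rewrite tourE. Qed.

(** Here 12 is 2 * (2 + 4): the tree is doubled, the L1 length of the curves is at most [2 * ls],
    and the bridge has L1 length at most [4 * ls]. *)
Lemma close_pair a b : a \in pI -> b \in qI -> d2 a b <= 2 * ls -> tour <= 12 * ls.
Proof.
move=> aP bQ h; have h1 := mst_bound aP bQ; have h2 := tour_weight.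
have h3 := d1_le_d2 X Y a b.
have h4 : weight d2 T <= weight d1 T by apply: ler_sum => e _; exact: d2_le_d1.
by move: h h1 h2 h3 h4; move: (d1 a b) (d2 a b) (weight _ _) (weight _ _) => *; lra.
Qed.

Lemma neighbour l v : all (fun v => v < n)%N l -> uniq l -> v \in l -> (1 < size l)%N ->
  exists z, [/\ (z < n)%N, z <> v & d2 v z <= lenI l].
Proof.
move=> ln ul vl sl.
have ul' : uniq (map pt l).
  rewrite map_inj_in_uniq // => u u' /(allP ln) un /(allP ln) un'; exact: pt_inj.
have [|y [/mapP[z zl ->] ne d]] := neighbour_le_length ul' (map_f pt vl); first by rewrite size_map.
by exists z; split=> //; [exact: (allP ln)|move=> e; rewrite e in ne].
Qed.

(* When the optimum exceeds twice the lengths of a competing pair, one of the competing curves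
   is [p] alone, all other points are at distance [eps_star] from [p], and the tour makes
   exactly two edges of that length. *)
Section Far.
Hypotheses (up : uniq pI) (uq : uniq qI) (pP : p \in pI).
Hypothesis pq : forall v, v \in qI -> exists2 u, u \in pI & d2 v u <= eps.
Hypothesis far : 2 * ls < eps.
Hypothesis r_eps : r = eps.

Let Dp : D p = eps ^+ 2. Proof. by rewrite -r_sqr r_eps. Qed.
Let pn : (p < n)%N. Proof. by have [] := plan. Qed.
Let lp0 : 0 <= lenI pI. Proof. exact: lenI_ge0. Qed.
Let lq0 : 0 <= lenI qI. Proof. exact: lenI_ge0. Qed.

Lemma far_d1 z : (z < n)%N -> z <> p -> eps <= d1 p z.
Proof.
move=> zn zp; have [_ _ _ H _] := ex pn.
by rewrite -(ler_pXn2r (n := 2)) ?nnegrE ?d1_ge0 ?eps_ge0 // -Dp H.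
Qed.

(** A second vertex on the curve of [p] would be within [lenI pI] of it, hence at L1 distance less
    than [eps], whereas [D p = eps ^+ 2] is a lower bound for the squared L1 distances at [p]. *)
Lemma far_single : pI = [:: p].
Proof.
have [sz|sz] := leqP (size pI) 1.
  by case: (pI) pP sz => [//|a [|//]]; rewrite inE => /eqP ->.
have [z [zn zp d]] := neighbour pn' up pP sz.
have h1 := far_d1 zn zp; have h2 := d1_le_d2 X Y p z.
by have := lt_of_double lq0 h2 d far; rewrite ltNge h1.
Qed.

Lemma far_others v : (v < n)%N -> v <> p -> v \in qI /\ d2 v p <= eps.
Proof.
move=> vn vp; have := cover vn; rewrite far_single inE => /orP[/eqP//|vQ].
by split=> //; have [u] := pq vQ; rewrite far_single inE => /eqP ->.
Qed.

(** The delicate case is [2 * D p <= M * M], where [D p] may be inexact. If [M] is attained at [p],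
    then [d1 p v] is at least [M], so the squared distance is at least half of [M * M]. If it is
    attained at another point, that point has a neighbour along [qI], so [M < eps], which
    contradicts [2 * eps ^+ 2 <= M * M]. *)
Lemma far_sq v : (v < n)%N -> v <> p -> sq X Y v p = D p.
Proof.
move=> vn vp; have [vQ dv] := far_others vn vp.
have le1 : sq X Y v p <= D p by rewrite sqE Dp ler_pXn2r ?nnegrE ?dist_ge0 ?eps_ge0.
apply/eqP; rewrite eq_le le1 /=; have [_ _ _ _ [h|h]] := ex pn; last first.
  by rewrite sqE /d2 distC -[_ ^+ 2](sqE X Y); exact: h.
have [nr1 [x [y [xn Fx ME]]]] := nr; have [y' [Fx' yn yx _ ymin]] := nr1 x xn.
move: Fx; rewrite Fx' => -[yy']; rewrite yy' in ymin; rewrite -ME in ymin.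
have M0 : 0 <= M by rewrite ME d1_ge0.
have [xp|/eqP xp] := eqVneq x p.
  have hM : M <= d1 p v by rewrite -xp; apply: ymin => //; rewrite xp.
  have h1 : M * M <= d1 p v ^+ 2 by rewrite -expr2 ler_pXn2r ?nnegrE ?d1_ge0.
  have h2 := norm1_sqr_le (pt p) (pt v).
  have h3 : d1 p v ^+ 2 <= 2 * sq X Y v p by rewrite sqE /d2 distC; exact: h2.
  by move: h h1 h3; lra.
have [xQ _] := far_others xn xp.
have sz : (1 < size qI)%N.
  have : (size (iota 0 n) <= size (p :: qI))%N.
    apply: uniq_leq_size; first exact: iota_uniq.
    move=> u; rewrite mem_iota => un; rewrite inE.
    by case: eqP => //= up'; have [] := far_others un up'.
  by rewrite size_iota => h1; rewrite -ltnS; exact: leq_trans n2 h1.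
have [z [zn zx dz]] := neighbour qn' uq xQ sz.
have h1 := ymin z zn zx; have h2 := d1_le_d2 X Y x z.
have far' : 2 * (lenI qI + lenI pI) < eps by rewrite addrC.
have Me : M < eps := le_lt_trans h1 (lt_of_double lp0 h2 dz far').
move: h; rewrite Dp -expr2; have : M ^+ 2 < eps ^+ 2 by rewrite ltr_pXn2r ?nnegrE ?eps_ge0.
by move=> lt le; case: (double_absurd (sqr_ge0 eps) lt le).
Qed.

Lemma far_centre v : (v < n)%N -> ct v = p.+1.
Proof.
have [_ _ _ [[_ H]|[[u [un up' ne]] _]]] := plan; first exact: H.
by case: ne; exact: far_sq.
Qed.

Lemma far_d2 v : (v < n)%N -> v <> p -> d2 v p = eps.
Proof.
move=> vn vp; apply/eqP; rewrite -(eqrXn2 (n := 2)) ?dist_ge0 ?eps_ge0 //.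
by rewrite -[_ ^+ 2](sqE X Y) far_sq // Dp.
Qed.

Lemma far_PL : lenI PL = 0.
Proof.
have allp v : v \in PL -> v = p.
  by move=> /mem_PL[vn <-]; rewrite /cf far_centre // subn1.
have : uniq PL by rewrite filter_uniq // L_uniq.
move: allp; case: PL => [_ _|x [_ _|y l H]]; rewrite /lenI ?curve_length1 //.
  by rewrite /curve_length big_nil.
by rewrite /= (H x) ?mem_head // (H y) ?inE ?eqxx ?orbT //.
Qed.

(** The leaves occupy the positions from 1 to [n.-1], so the curve avoids the first and the last
    tour edge, both of length [eps]. *)
Lemma far_QL : lenI QL <= tour - 2 * eps.
Proof.
have [NE one _ _ _] := gt; have [_ _ tp _] := plan.
have n0 : (0 < n)%N := ltnW (ltnW n2).
have n1 : (n.-1 < n)%N by rewrite ltn_predL.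
have n11 : (1 <= n.-1)%N by rewrite -ltnS prednK // ltnW.
have h1 : pre 1 = eps.
  have [qn qp] := next_ne pn.
  by rewrite pre_step /pre big_ord0 add0r /t /= {1}/d2 distC; exact: far_d2.
have h2 : tour = pre n.-1 + eps.
  rewrite /tour -{1}(prednK n0) pre_step; congr (_ + _).
  rewrite (prednK n0) /t (tour_close NE one pn) far_d2 //; first exact: tour_p.
  by move=> e; move: n11; rewrite (tour_inj NE one pn n1 n0 e).
suff : lenI QL <= pre n.-1 - pre 1 by rewrite h1 h2; lra.
have srt := QL_sorted_one far_centre.
have lt : all (fun v => v < n)%N QL by apply/allP => v /mem_QL[].
have ne : all (fun v => v != p) QL.
  by apply/allP => v /mem_QL[vn cv _]; apply/eqP => vp; apply: cv; rewrite /cf far_centre // subn1.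
move: srt lt ne; case: QL => [_ _ _|x l srt lt ne].
  by have := pre_le n11; rewrite /lenI /curve_length /= big_nil; lra.
apply: le_trans (len_sorted lt srt) _.
have xn : (x < n)%N by apply: (allP lt x); exact: mem_head.
have ln : (last x l < n)%N by apply: (allP lt (last x l)); exact: mem_last.
have h3 : pre (TP (last x l)) <= pre n.-1.
  by apply: pre_le; have [ll _] := tour_TP ln; rewrite -ltnS prednK.
have h4 : pre 1 <= pre (TP x).
  apply: pre_le; rewrite lt0n; apply/eqP => x0; have [_] := tour_TP xn.
  by rewrite x0 /= => px; move: ne; rewrite /= -px eqxx.
lra.
Qed.

(** The bridge in [mst_bound] is taken to be a tree edge at [p], so that its L1 length cancels and
    the rest of the tree weighs at most [2 * ls]. Bounding that length by a multiple of [eps] would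
    leave more than the [2 * eps] that [far_QL] subtracts. *)
Lemma far_tour : tour <= 2 * eps + 4 * ls.
Proof.
have [_ _ [Tn Tc] _ _] := gt; have h0 := tour_weight.
have [q qn qp] : exists2 q, (q < n)%N & q <> p by have [] := next_ne pn; exists (NX p).
(* The tree is connected, so the colouring that singles out [p] is not constant along all of its
   edges. *)
have /hasP[[a b] eT /= ep] : has (fun e => (e.1 == p) != (e.2 == p)) T.
  apply: contraT => /hasPn H; have := Tc p q pn qn (fun v => v == p) (fun _ _ => erefl).
  rewrite eqxx => /(_ _) G; have /esym/eqP : true = (q == p).
    by apply: G => e /H; rewrite negbK => /eqP.
  by [].
have /andP[/= an bn] := allP Tn _ eT.
have [z [zn zp z1 z2]] : exists z, [/\ (z < n)%N, z <> p, d1 a b = d1 p z & d2 a b = eps].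
  move: ep; have [ap|/eqP ap] := eqVneq a p.
    move=> bp; have {}bp : b <> p by move=> e; rewrite e eqxx in bp.
    by exists b; split=> //; rewrite ap // /d2 distC; exact: far_d2.
  have [bp _|//] := eqVneq b p; exists a; split=> //; rewrite bp; first exact: d1C.
  exact: far_d2.
have [zQ _] := far_others zn zp.
have := mst_bound pP zQ; move: h0; rewrite /weight !(big_rem _ eT) /= z1 z2 => h0 h1.
have h2 : \sum_(e <- rem (a, b) T) d2 e.1 e.2 <= \sum_(e <- rem (a, b) T) d1 e.1 e.2.
  by apply: ler_sum => f _; exact: d2_le_d1.
move: h0 h1 h2; move: (\sum_(_ <- _) _) (\sum_(_ <- _) _) (d1 p z) => *; lra.
Qed.

Lemma far_len : lenI PL + lenI QL <= 4 * ls.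
Proof. by have := far_QL; have := far_tour; rewrite far_PL; lra. Qed.

End Far.

End Pair.

(** The curve through [p] comes first; [output_length] exchanges the curves if necessary. The
    constant 120 is 10 tours times the 12 of [close_pair], and the far case needs only 4. *)
Lemma partition_length (Ps Qs : seq (plane R)) : r = eps -> partitioned_by S Ps Qs ->
  (forall x, x \in Ps -> exists2 y, y \in Qs & dist x y <= eps) ->
  (forall y, y \in Qs -> exists2 x, x \in Ps & dist y x <= eps) -> pt p \in Ps ->
  curve_length P + curve_length Q <= 120 * (curve_length Ps + curve_length Qs).
Proof.
move=> r_eps part h1 h2 pP; have [pn _ _ _] := plan.
have [pI PE pIn] : exists2 l, Ps = map pt l & all (fun v => v < n)%N l.
  by apply: index_list => x xP; rewrite (partition_mem _ part) xP.
have [qI QE qIn] : exists2 l, Qs = map pt l & all (fun v => v < n)%N l.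
  by apply: index_list => x xQ; rewrite (partition_mem _ part) xQ orbT.
have mem l v : all (fun v => v < n)%N l -> (v < n)%N -> pt v \in map pt l -> v \in l.
  by move=> ln vn /mapP[u ul /(pt_inj vn (allP ln u ul)) ->].
have cover v : (v < n)%N -> (v \in pI) || (v \in qI).
  move=> vn; have := ptS vn; rewrite (partition_mem _ part) PE QE.
  by case/orP => h; apply/orP; [left|right]; exact: mem h.
have pPI : p \in pI by apply: mem => //; rewrite -PE.
have uP : uniq pI by apply: (@map_uniq _ _ pt); rewrite -PE; exact: partition_uniq part.
have uQ : uniq qI.
  by apply: (@map_uniq _ _ pt); rewrite -QE; exact: partition_uniq (partition_sym part).
have ls0 : 0 <= curve_length Ps + curve_length Qs by rewrite addr_ge0 ?curve_length_ge0.
have [far|near] := ltP (2 * (curve_length Ps + curve_length Qs)) eps.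
  have h3 : lenI PL + lenI QL <= 4 * (lenI pI + lenI qI).
    apply: far_len => //; last by rewrite /lenI -PE -QE.
    move=> v vQ; have [|x] := h2 (pt v); first by rewrite QE; exact: map_f.
    by rewrite PE => /mapP[u uP' ->]; exists u.
  apply: le_trans h3 _; rewrite /lenI -PE -QE; apply: ler_wpM2r => //.
  by rewrite ler_nat.
have [y yQ dy] := h1 _ pP; rewrite QE in yQ; have [b bQ yb] := mapP yQ.
have h3 : tour <= 12 * (lenI pI + lenI qI).
  apply: (@close_pair pI qI pIn qIn cover p b) => //.
  by rewrite /lenI -PE -QE; apply: le_trans near; rewrite yb in dy.
have h4 : lenI PL + lenI QL <= 10 * tour := len_tour; apply: le_trans h4 _.
move: h3; rewrite /lenI -PE -QE => h3.
by rewrite (_ : 120 = 10 * 12) -?natrM // natrM -mulrA ler_pM2l.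
Qed.

Lemma output_length (Ps Qs : seq (plane R)) : frechet_optimal S Ps Qs ->
  curve_length P + curve_length Q <= 120 * (curve_length Ps + curve_length Qs).
Proof.
have [_ r_eps] := output_optimal; move=> [part opt].
have [h1 h2] := partition_partner part; rewrite opt in h1 h2.
have [pn _ _ _] := plan; have := ptS pn.
rewrite (partition_mem _ part) => /orP[pP|pQ]; first exact: partition_length.
rewrite [X in _ <= _ * X]addrC.
exact: partition_length (partition_sym part) h2 h1 pQ.
Qed.

End Optimal.

(** * Time bound and conclusion *)

Section Main.
Variable R : realType.

Lemma algo_post_good n (X Y : nat -> R) (S : {fset plane R}) P Q : (2 < n)%N ->
  (forall i j, (i < n)%N -> (j < n)%N -> X i = X j -> Y i = Y j -> i = j) ->
  perm_eq (map (point X Y) (iota 0 n)) S -> algo_post n X Y (P, Q) ->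
  frechet_optimal S P Q /\ forall Ps Qs, frechet_optimal S Ps Qs ->
    curve_length P + curve_length Q <= 120 * (curve_length Ps + curve_length Qs).
Proof.
move=> n2 dst HS [FN [M [NX [sp [T [F [D [p [TP [ct [o [nr gt ex plan [so [-> ->]]]]]]]]]]]]]].
split; first by have [] := output_optimal n2 dst HS nr gt ex plan so.
by move=> Ps Qs; exact: (output_length n2 dst HS nr gt ex plan so).
Qed.

Lemma cx_le_nlogn n : (2 < n)%N -> (cx n)%:R <= 4 / ln 2 * (n%:R * ln n%:R) :> R.
Proof.
move=> n2; have ln2 : 0 < ln 2 :> R by rewrite ln_gt0 // ltr1n.
have lg0 : (0 < lg n)%N by rewrite trunc_log_gt0 /= ltnW.
(* Each of the two successors in [cx] costs at most a factor 2, since [n] and [lg n] are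
   positive. *)
have le1 : (cx n <= 4 * (n * lg n))%N by rewrite /cx; nia.
apply: le_trans (_ : (4 * (n * lg n))%:R <= _); first by rewrite ler_nat.
have lgn : (lg n)%:R * ln 2 <= ln n%:R :> R.
  rewrite mulr_natl -lnXn // ler_ln ?posrE ?exprn_gt0 ?ltr0n //; last by rewrite (ltn_trans _ n2).
  by rewrite -natrX ler_nat trunc_logP // ltnW // ltnW.
rewrite !natrM -[4 / _ * _]mulrA ler_pM2l // mulrCA ler_pM2l ?ltr0n; last by rewrite (ltn_trans _ n2).
by rewrite mulrC ler_pdivlMr.
Qed.

Lemma findable : findable_in_nlogn (fun (S : {fset plane R}) P Q =>
  frechet_optimal S P Q /\ forall Ps Qs, frechet_optimal S Ps Qs ->
    curve_length P + curve_length Q <= 120 * (curve_length Ps + curve_length Qs)).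
Proof.
have [C H] := runs_main R.
(* The table of grid cells has quadratically many addresses; exponent 9 makes
   words large enough from [n = 3] on. *)
exists main_prog, 9%N, (C%:R * (4 / ln 2)) => S s sS n2.
have us : uniq s by rewrite (perm_uniq sS) fset_uniq.
have W : (100 * (size s * size s) + 1000 < size s ^ 9)%N.
  (* 3 ^ 7 is 2187; the remaining two factors of the ninth power supply the square. *)
  have le7 : (2000 <= size s ^ 7)%N by apply: (@leq_trans (3 ^ 7)); rewrite ?leq_exp2r.
  by rewrite (expnD _ 7 2) -mulnn; nia.
have [t [st [E tC [X [Y [XY post]]]]]] := H _ s us n2 W.
case out : (output st) post => [P Q] post; exists t, P, Q; split.
- by exists st.
- apply: le_trans (_ : (C * cx (size s))%:R <= _); first by rewrite ler_nat.
  by rewrite natrM -mulrA ler_wpM2l // cx_le_nlogn.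
apply: algo_post_good post => //; first exact: distinct_input us XY.
suff -> : map (point X Y) (iota 0 (size s)) = s by [].
rewrite -[RHS](mkseq_nth (0, 0)); apply/eq_in_map => i.
by rewrite mem_iota => im; exact: XY.
Qed.

Lemma findable_weaken (G G' : {fset plane R} -> seq (plane R) -> seq (plane R) -> Prop) :
  (forall S P Q, G S P Q -> G' S P Q) -> findable_in_nlogn G -> findable_in_nlogn G'.
Proof.
move=> GG' [prog [c [K H]]]; exists prog, c, K => S s sS n2.
by have [t [P [Q [E tK g]]]] := H S s sS n2; exists t, P, Q; split=> //; exact: GG'.
Qed.

End Main.

Theorem corollary18 (R : realType) :
  (exists C : R,
     findable_in_nlogn (fun (S : {fset plane R}) (P Q : seq (plane R)) =>
       frechet_optimal S P Q /\
       forall Ps Qs : seq (plane R), best_pair S Ps Qs ->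
         curve_length P + curve_length Q <=
         C * (curve_length Ps + curve_length Qs)))
  /\
  (exists C : R,
     findable_in_nlogn (fun (S : {fset plane R}) (P Q : seq (plane R)) =>
       frechet_optimal S P Q /\
       forall Ps Qs : seq (plane R), best_pair S Ps Qs ->
         max_length P Q <= C * max_length Ps Qs)).
Proof.
split; [exists 120|exists (120 * 2)]; apply: findable_weaken (findable R) => S P Q [opt H];
  split=> // Ps Qs [/H le _] //.
(* A maximum of two lengths is between half of their sum and the sum, whence the additional factor
   2. *)
apply: le_trans (max_length_le P Q) (le_trans le _).
by rewrite -mulrA ler_pM2l // max_length_ge.
Qed.
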